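(* Let $S$ be a smooth surface and let $f$ be a homeomorphism of $S$. Then $f\in \mathrm{Homeo}^1(S)$ if and only if $f$ has the following three properties: (a) $f$ maps every $C^1$ curve in $S$ to a $C^1$ curve; (b) the induced map $\bar{d}f_p:\mathbb{P}T_pS\to \mathbb{P}T_{f(p)}S$ is a homeomorphism for all $p\in S$; and (c) $f$ maps every transverse sequence to a transverse sequence, i.e. for every transverse sequence $\{(p_n,k_n)\}$ in $\mathbb{P}TS$, the sequence $\{(f(p_n),\bar{d}f_{p_n}(k_n))\}$ is a transverse sequence.
   Context: A $C^1$ curve in a smooth surface $S$ is a simple closed curve in $S$ that is a properly embedded one-dimensional $C^1$ submanifold; equivalently, the image of a continuously differentiable injective map $\gamma:S^1\to S$ with $\gamma'(t)\neq 0$ for all $t\in S^1$. $\mathrm{Homeo}(S)$ is the group of homeomorphisms of $S$. $\mathrm{Homeo}^1(S)$ is the set of $f\in \mathrm{Homeo}(S)$ such that both $f$ and $f^{-1}$ map every $C^1$ curve to a $C^1$ curve. $\mathbb{P}T_pS$ is the projectivization of the tangent space $T_pS$ (the space of lines through the origin of $T_pS$, a circle), and $\mathbb{P}TS$ is the projective tangent bundle, whose points are written $(p,\ell)$ with $p\in S$, $\ell\in\mathbb{P}T_pS$. Induced maps: a homeomorphism $f$ of $S$ that maps every $C^1$ curve to a $C^1$ curve has the property that $C^1$ curves through $p$ with the same tangent line at $p$ are sent to $C^1$ curves with the same tangent line at $f(p)$. The map $\bar{d}f_p:\mathbb{P}T_pS\to\mathbb{P}T_{f(p)}S$ sends the tangent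 line at $p$ of a $C^1$ curve $\alpha$ through $p$ to the tangent line at $f(p)$ of $f(\alpha)$. Together these define $\bar{d}f:\mathbb{P}TS\to\mathbb{P}TS$, $(p,\ell)\mapsto (f(p),\bar{d}f_p(\ell))$. (Properties (b) and (c) are understood for $f$ satisfying (a).) Convergence along a line: let $\ell$ be a line of slope $m$ in $\mathbb{R}^2$ through $(x,y)$. A sequence $\{(x_n,y_n)\}$ of points different from $(x,y)$ and converging to $(x,y)$ converges along $\ell$ to $(x,y)$ if $\lim_{n\to\infty}\frac{y_n-y}{x_n-x}=m$ (limit in $\mathbb{R}\cup\{\infty\}$, with $m=\infty$ for a vertical line). For a surface $S$, $p\in S$ and a line $\ell\subset T_pS$ through the origin (also viewed as a point $\ell\in\mathbb{P}T_pS$), a sequence $\{p_n\}$ in $S$ converges along $\ell$ to $p$ if there is a smooth coordinate chart $\varphi:U\subset S\to T_pS\cong\mathbb{R}^2$ based at $p$ (that is, $\varphi(p)=0$ and the differential of $\varphi$ at $p$ is the identity; e.g. the inverse of a Riemannian exponential map at $p$) such that $\varphi(p_n)$ converges along $\ell$ to $\varphi(p)$. Transverse sequences: a transverse sequence for $(p,\ell)\in\mathbb{P}TS$ is a sequence $\{(p_n,k_n)\}$ in $\mathbb{P}TS$ such that $\{p_n\}$ converges along $\ell$ to $p$ and no subsequence of $\{(p_n,k_n)\}$ converges to $(p,\ell)$ in $\mathbb{P}TS$. A sequence is a transverse sequence if it is a transverse sequence for some $(p,\ell)$. *)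

(* Defs.v *)
(* The real line is an arbitrary R : realType. *)
From HB Require Import structures.
From mathcomp Require Import all_boot all_order all_algebra.
From mathcomp Require Import all_classical all_reals.
From mathcomp Require Import topology normedtype landau derive.

Set Implicit Arguments.
Unset Strict Implicit.
Unset Printing Implicit Defensive.

Import Order.TTheory GRing.Theory Num.Theory.
Import numFieldNormedType.Exports.

Local Open Scope classical_set_scope.
Local Open Scope ring_scope.

Notation plane R := (R * R)%type.

Fixpoint C_on (R : realType) (V W : normedModType R) (k : nat)
    (U : set V) (g : V -> W) : Prop :=
  if k is k'.+1 then
    (forall x, U x -> differentiable g x) /\
    (forall v, C_on k' U (fun x => 'D_v g x))
  else forall x, U x -> {for x, continuous g}.

Definition smooth_on (R : realType) (V W : normedModType R)
    (U : set V) (g : V -> W) : Prop := forall k, C_on k U g.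

(* [to_plane] and [of_plane] are total functions; their values outside
   [dom] and [to_plane @` dom] are irrelevant. *)
Record chart (R : realType) (T : topologicalType) := Chart {
  dom : set T;
  to_plane :> T -> plane R;
  of_plane : plane R -> T;
  dom_open : open dom;
  codom_open : open (to_plane @` dom);
  to_planeK : forall p, dom p -> of_plane (to_plane p) = p;
  to_plane_continuous : forall p, dom p -> {for p, continuous to_plane};
  of_plane_continuous :
    forall z, (to_plane @` dom) z -> {for z, continuous of_plane} }.

Definition transition (R : realType) (T : topologicalType) (c c' : chart R T) :
  plane R -> plane R := c' \o of_plane c.

Definition compatible (R : realType) (T : topologicalType)
    (c c' : chart R T) : Prop :=
  smooth_on (c @` (dom c `&` dom c')) (transition c c') /\
  smooth_on (c' @` (dom c `&` dom c')) (transition c' c).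

(* Surfaces have no boundary; they need not be connected, compact or
   orientable. The smooth structure is a maximal atlas, so that the members
   of [atlas] are all the smooth coordinate charts. *)
Record smoothSurface (R : realType) := SmoothSurface {
  carrier :> topologicalType;
  carrier_hausdorff : hausdorff_space carrier;
  carrier_second_countable : @second_countable carrier;
  atlas : set (chart R carrier);
  atlas_cover : forall p, exists2 c, atlas c & dom c p;
  atlas_compatible : forall c c', atlas c -> atlas c' -> compatible c c';
  atlas_maximal : forall c, (forall c', atlas c' -> compatible c c') ->
    atlas c }.

Section TangentSpace.
Context {R : realType} (S : smoothSurface R).

Definition chart_at (p : S) : set (chart R S) :=
  [set c | atlas c /\ dom c p].

(* A tangent vector at p is the family of its coordinate vectors in all the
   charts at p, subject to the usual transformation rule; the value 0 at the
   other indices makes Leibniz equality the right one. T_pS is a subspace of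
   the vector space [family], and v |-> v c is the differential at p of a
   chart c, a linear isomorphism from T_pS to the plane. *)
Definition family : Type := chart R S -> plane R.

Definition tangent_space (p : S) : set family :=
  [set v | (forall c c', chart_at p c -> chart_at p c' ->
              v c' = 'd (transition c c') (c p) (v c)) /\
           (forall c, ~ chart_at p c -> v c = 0)].

Definition spanned (v : family) : set family :=
  [set w | exists a : R, w = (fun c => a *: v c)].

(* PT p is the projectivization of T_pS and PTS the projective tangent bundle. *)
Record PT (p : S) := ProjLine {
  line : set family;
  lineP : exists v, [/\ tangent_space p v, v <> (fun=> 0) & line = spanned v] }.

Record PTS := ProjPoint { base : S; fiber : PT base }.

End TangentSpace.

Arguments base {R S}.
Arguments fiber {R S}.

Section Tangent_lemmas.
Context {R : realType} (S : smoothSurface R).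
Implicit Types (p : S) (c : chart R S).

Lemma dom_nbhs p c : dom c p -> nbhs p (dom c).
Proof. by move=> cp; apply: open_nbhs_nbhs; split => //; exact: dom_open. Qed.

Lemma transition_differentiable p c c' : chart_at p c -> chart_at p c' ->
  differentiable (transition c c') (c p).
Proof.
move=> [ac cp] [ac' cp'].
have [/(_ 1%N)[/= + _] _] := atlas_compatible ac ac'.
by apply; exists p.
Qed.

Lemma transition_val p c c' : dom c p -> transition c c' (c p) = c' p.
Proof. by move=> cp; rewrite /transition /= to_planeK. Qed.

Lemma near_chart p c (P : set S) : dom c p -> nbhs p P ->
  \forall z \near c p, [/\ (c @` dom c) z, dom c (of_plane c z) &
     P (of_plane c z)].
Proof.
move=> cp Pp.
have imc : (c @` dom c) (c p) by exists p.
have ctn := of_plane_continuous imc.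
have np : nbhs (of_plane c (c p)) (dom c `&` P).
  rewrite to_planeK //; apply: filterI => //; exact: dom_nbhs.
have n1 : nbhs (c p) (c @` dom c).
  by apply: open_nbhs_nbhs; split => //; exact: codom_open.
have n2 := ctn _ np.
near=> z; have [? ?] : (dom c `&` P) (of_plane c z) by near: z.
by split => //; near: z.
Unshelve. all: by end_near. Qed.

Lemma of_planeK c z : (c @` dom c) z -> c (of_plane c z) = z.
Proof. by move=> [q cq <-]; rewrite to_planeK. Qed.


Lemma diff_comp_near (U V W : normedModType R) (g : U -> V) (h : V -> W)
    (k : U -> W) (x w : U) (y : V) : g x = y ->
  differentiable g x -> differentiable h y -> differentiable k x ->
  {near x, h \o g =1 k} -> 'd h y ('d g x w) = 'd k x w.
Proof.
move=> <- dg dh dk hgk.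
have e : 'd (h \o g) x w = 'd h (g x) ('d g x w).
  by have /(congr1 (fun u => u w)) := diff_comp dg dh.
apply: (etrans (esym e)); apply: (etrans (esym (deriveE w _))).
  exact: differentiable_comp.
apply: (etrans (near_eq_derive _ hgk)); exact: deriveE.
Qed.

Lemma diff_near_id (V : normedModType R) (g : V -> V) (x w : V) :
  differentiable g x -> {near x, g =1 id} -> 'd g x w = w.
Proof.
move=> dg gid; apply: (etrans (esym (deriveE w dg))).
by apply: (etrans (near_eq_derive _ gid)); exact: derive_id.
Qed.

Lemma diff_transition p c c' c'' (w : plane R) :
  chart_at p c -> chart_at p c' -> chart_at p c'' ->
  'd (transition c' c'') (c' p) ('d (transition c c') (c p) w)
  = 'd (transition c c'') (c p) w.
Proof.
move=> pc pc' pc''; have [cp cp'] := (pc.2, pc'.2).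
apply: (diff_comp_near _ (transition_val c' cp)).
- exact: transition_differentiable.
- exact: transition_differentiable.
- exact: transition_differentiable.
have := near_chart cp (dom_nbhs cp').
apply: filterS => z [_ _ cz'].
by rewrite /transition /= to_planeK.
Qed.

Lemma diff_transition_id p c (w : plane R) : chart_at p c ->
  'd (transition c c) (c p) w = w.
Proof.
move=> pc; apply: diff_near_id; first exact: transition_differentiable.
have := near_chart pc.2 (dom_nbhs pc.2).
by apply: filterS => z [cz _ _]; rewrite /transition /= of_planeK.
Qed.

Lemma tangent_space_exists p c (w : plane R) : chart_at p c ->
  exists2 v : family S, tangent_space p v & v c = w.
Proof.
move=> pc.
exists (fun c' => if pselect (chart_at p c') is left _
                  then 'd (transition c c') (c p) w else 0).
  split=> [c1 c2 pc1 pc2|c1 pc1]; last by case: pselect.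
  case: pselect => // _; case: pselect => // _.
  exact/esym/diff_transition.
by case: pselect => // _; exact: diff_transition_id.
Qed.

Lemma tangent_space_inj p c (v w : family S) : chart_at p c ->
  tangent_space p v -> tangent_space p w -> v c = w c -> v = w.
Proof.
move=> pc [v1 v0] [w1 w0] vw; apply/funext => c'.
have [pc'|pc'] := pselect (chart_at p c'); last by rewrite v0 // w0.
by rewrite (v1 _ _ pc pc') (w1 _ _ pc pc') vw.
Qed.

Lemma tangent_space0 p : tangent_space p (fun=> 0 : plane R).
Proof. by split=> // c c' _ _; exact/esym/linear0. Qed.

Lemma tangent_spaceZ p (a : R) (v : family S) : tangent_space p v ->
  tangent_space p (fun c => a *: v c).
Proof.
move=> [v1 v0]; split=> [c c' pc pc'|c pc]; last by rewrite v0 // scaler0.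
by rewrite (v1 _ _ pc pc'); exact/esym/linearZ.
Qed.

Lemma line_tangent p (l : PT p) v : line l v -> tangent_space p v.
Proof.
by have [w [pw _ ->]] := lineP l => -[a ->]; exact: tangent_spaceZ.
Qed.

Lemma line_spanned p (l : PT p) v : line l v -> v <> (fun=> 0) ->
  line l = spanned v.
Proof.
have [w [_ w0 ->]] := lineP l => -[a ->] v0.
have a0 : a != 0.
  by apply/eqP => a0; apply: v0; apply/funext => c; rewrite a0 scale0r.
rewrite eqEsubset; split=> u [b ->].
  by exists (b / a); apply/funext => c; rewrite scalerA divfK.
by exists (b * a); apply/funext => c; rewrite scalerA.
Qed.

Lemma PT_eq p (l m : PT p) : line l = line m -> l = m.
Proof.
case: l m => [l lP] [m mP] /= lm; rewrite -lm in mP *.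
by rewrite (Prop_irrelevance lP mP).
Qed.

Lemma PT_exists p c (w : plane R) : chart_at p c -> w != 0 ->
  exists (l : PT p) (v : family S), [/\ line l v, v <> (fun=> 0) & v c = w].
Proof.
move=> pc w0; have [v pv vc] := tangent_space_exists w pc.
have v0 : v <> (fun=> 0) by move=> v0; move: w0; rewrite -vc v0 eqxx.
exists (@ProjLine _ _ p (spanned v) (ex_intro _ v (And3 pv v0 erefl))), v.
by split=> //; exists 1; apply/funext => c'; rewrite scale1r.
Qed.

Lemma PT_inhabited p : inhabited (PT p).
Proof.
have [c ac cp] := atlas_cover p.
have [|l _] := @PT_exists p c (1, 1) (conj ac cp); last by [].
by apply/eqP => -[] /eqP; rewrite oner_eq0.
Qed.

End Tangent_lemmas.

Section Topologies.
Context {R : realType} (S : smoothSurface R).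
Implicit Types (p : S) (c : chart R S).

(* The nonzero vectors on the lines of a family of lines, read in the chart c. *)
Definition PT_read (p : S) (c : chart R S) (A : set (PT p)) : set (plane R) :=
  [set w | exists (l : PT p) (v : family S),
     [/\ A l, line l v, v <> (fun=> 0) & w = v c]].

Definition PTS_read (c : chart R S) (A : set (PTS S)) :
    set (plane R * plane R) :=
  [set z | exists (q : PTS S) (v : family S),
     [/\ A q /\ dom c (base q), line (fiber q) v, v <> (fun=> 0) &
         z = (c (base q), v c)]].

(* The quotient topologies of the nonzero tangent vectors, themselves
   topologized through the charts. *)
Definition PT_open (p : S) (A : set (PT p)) : Prop :=
  forall c, chart_at p c -> open (PT_read c A).

Definition PTS_open (A : set (PTS S)) : Prop :=
  forall c, atlas c -> open (PTS_read c A).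

Lemma PT_read_inj p c (l m : PT p) v w : chart_at p c ->
  line l v -> line m w -> v <> (fun=> 0) -> v c = w c -> l = m /\ v = w.
Proof.
move=> pc lv mw v0 vw.
have {}vw := tangent_space_inj pc (line_tangent lv) (line_tangent mw) vw.
split=> //; apply: PT_eq.
by rewrite (line_spanned lv) // (line_spanned mw) -?vw.
Qed.

Lemma open_nonzero : open [set w : plane R | w != 0].
Proof.
rewrite (_ : [set _ | _] = ~` [set 0]); last first.
  by apply/seteqP; split=> w /= /eqP.
by rewrite openC; apply: accessible_closed_set1; apply: hausdorff_accessible;
  exact: norm_hausdorff.
Qed.

Lemma tangent_neq0 p c (v : family S) : chart_at p c -> tangent_space p v ->
  v <> (fun=> 0) -> v c != 0.
Proof.
move=> pc pv v0; apply/eqP => vc; apply: v0.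
exact: (tangent_space_inj pc pv (tangent_space0 p)).
Qed.

Lemma PT_openT p : PT_open [set: PT p].
Proof.
move=> c pc; rewrite (_ : PT_read _ _ = [set w | w != 0]).
  exact: open_nonzero.
apply/seteqP; split=> [_ [l [v [_ lv v0 ->]]]|w /= w0].
  exact: (tangent_neq0 pc (line_tangent lv)).
by have [l [v [lv v0 <-]]] := PT_exists pc w0; exists l, v.
Qed.

Lemma PT_openI p : setI_closed (@PT_open p).
Proof.
move=> A B oA oB c pc.
rewrite (_ : PT_read _ _ = PT_read c A `&` PT_read c B).
  by apply: openI; [exact: oA | exact: oB].
apply/seteqP; split=> [_ [l [v [[Al Bl] lv v0 ->]]]|].
  by split; exists l, v.
move=> _ [[l [v [Al lv v0 ->]]] [m [w [Bm mw w0 vw]]]].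
have [lm _] := PT_read_inj pc lv mw v0 vw.
by exists l, v; split=> //; split=> //; rewrite lm.
Qed.

Lemma PT_open_bigU p (I : Type) (F : I -> set (PT p)) :
  (forall i, PT_open (F i)) -> PT_open (\bigcup_i F i).
Proof.
move=> oF c pc.
rewrite (_ : PT_read _ _ = \bigcup_i PT_read c (F i)).
  by apply: bigcup_open => i _; exact: oF.
apply/seteqP; split=> [_ [l [v [[i _ Fi] lv v0 ->]]]|_ [i _ [l [v [Fi lv v0 ->]]]]].
  by exists i => //; exists l, v.
by exists l, v; split=> //; exists i.
Qed.

Lemma PTS_openT : PTS_open setT.
Proof.
move=> c ac; rewrite (_ : PTS_read _ _ =
    (fst @^-1` (c @` dom c)) `&` (snd @^-1` [set w | w != 0])).
  apply: openI.
    by apply: open_comp => [z _|]; [exact: cvg_fst | exact: codom_open].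
  by apply: open_comp => [z _|]; [exact: cvg_snd | exact: open_nonzero].
apply/seteqP; split=> [_ [q [v [[_ cq] lv v0 ->]]]|[z w] /= [[p cp <-] w0]].
  split=> /=; first by exists (base q).
  exact: (tangent_neq0 (conj ac cq) (line_tangent lv)).
have [l [v [lv v0 <-]]] := PT_exists (conj ac cp) w0.
by exists (ProjPoint l), v.
Qed.

Lemma PTS_openI : setI_closed PTS_open.
Proof.
move=> A B oA oB c ac.
rewrite (_ : PTS_read _ _ = PTS_read c A `&` PTS_read c B).
  by apply: openI; [exact: oA | exact: oB].
apply/seteqP; split=> [_ [l [v [[[Al Bl] cl] lv v0 ->]]]|].
  by split; exists l, v.
move=> _ [[[p l] [v [[Al /= cl] /= lv v0 ->]]]
          [[q m] [w [[Bm /= cm] /= mw w0 /= [pq vw]]]]].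
have {}pq : p = q by rewrite -(to_planeK cl) -(to_planeK cm) pq.
subst q.
have [lm _] := PT_read_inj (conj ac cl) lv mw v0 vw.
by exists (ProjPoint l), v; split=> //; split=> //; split=> //; rewrite lm.
Qed.

Lemma PTS_open_bigU (I : Type) (F : I -> set (PTS S)) :
  (forall i, PTS_open (F i)) -> PTS_open (\bigcup_i F i).
Proof.
move=> oF c ac.
rewrite (_ : PTS_read _ _ = \bigcup_i PTS_read c (F i)).
  by apply: bigcup_open => i _; exact: oF.
apply/seteqP; split.
  by move=> _ [q [v [[[i _ Fi] cq] lv v0 ->]]]; exists i => //; exists q, v.
by move=> _ [i _ [q [v [[Fi cq] lv v0 ->]]]]; exists q, v; split=> //; split=> //; exists i.
Qed.

End Topologies.

HB.instance Definition _ (R : realType) (S : smoothSurface R) (p : S) :=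
  gen_eqMixin (PT p).
HB.instance Definition _ (R : realType) (S : smoothSurface R) (p : S) :=
  gen_choiceMixin (PT p).
HB.instance Definition _ (R : realType) (S : smoothSurface R) (p : S) :=
  isOpenTopological.Build (PT p) (@PT_openT R S p) (@PT_openI R S p)
    (@PT_open_bigU R S p).

HB.instance Definition _ (R : realType) (S : smoothSurface R) :=
  gen_eqMixin (PTS S).
HB.instance Definition _ (R : realType) (S : smoothSurface R) :=
  gen_choiceMixin (PTS S).
HB.instance Definition _ (R : realType) (S : smoothSurface R) :=
  isOpenTopological.Build (PTS S) (@PTS_openT R S) (@PTS_openI R S)
    (@PTS_open_bigU R S).

Section Curves.
Context {R : realType} (S : smoothSurface R).

(* The circle is R/Z; [C1_param g] says that g induces an injective C^1 map
   from R/Z to S with nowhere zero derivative. *)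
Definition C1_param (g : R -> S) : Prop :=
  [/\ continuous g,
      forall s t, g s = g t <-> exists k : int, t = s + k%:~R
    & forall t c, chart_at (g t) c ->
        [/\ derivable (c \o g) t 1,
            {for t, continuous (derive1 (c \o g))}
          & derive1 (c \o g) t <> 0]].

Definition C1_curve (alpha : set S) : Prop :=
  exists2 g : R -> S, C1_param g & alpha = range g.

Definition velocity (g : R -> S) (t : R) : family S :=
  fun c => if `[< chart_at (g t) c >] then derive1 (c \o g) t else 0.

Definition tangent_line_at (alpha : set S) (p : S) (l : PT p) : Prop :=
  exists g : R -> S, exists2 t : R,
    [/\ C1_param g, alpha = range g & g t = p]
  & line l = spanned (velocity g t).

Definition maps_C1_curves (f : S -> S) : Prop :=
  forall alpha, C1_curve alpha -> C1_curve (f @` alpha).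

(* When f maps C^1 curves to C^1 curves, exactly one line m qualifies;
   otherwise the value is arbitrary. *)
Definition dbar (f : S -> S) (p : S) (l : PT p) : PT (f p) :=
  xget (inhabited_witness (PT_inhabited (f p)))
    [set m | exists2 alpha, tangent_line_at alpha l &
                            tangent_line_at (f @` alpha) m].

Definition dbarS (f : S -> S) (q : PTS S) : PTS S :=
  ProjPoint (dbar f (fiber q)).

End Curves.

Section Homeo.
Variables T U : topologicalType.

Definition inverse_homeo (f : T -> U) (g : U -> T) : Prop :=
  [/\ continuous f, continuous g, cancel f g & cancel g f].

Definition homeo (f : T -> U) : Prop := exists g, inverse_homeo f g.

End Homeo.

Definition Homeo1 (R : realType) (S : smoothSurface R) : set (S -> S) :=
  [set f | exists g, [/\ inverse_homeo f g, maps_C1_curves f &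
                         maps_C1_curves g]].

Section Transverse.
Context {R : realType}.

(* Slopes live in the circle R u {oo}, with oo represented by None. *)
Definition slope (w : plane R) : one_point_compactification R :=
  if w.1 == 0 then None else Some (w.2 / w.1).

Definition line_of_slope (m : one_point_compactification R) (z : plane R) :
    set (plane R) :=
  if m is Some a then [set w | w.2 - z.2 = a * (w.1 - z.1)]
  else [set w | w.1 = z.1].

Definition plane_converges_along (l : set (plane R)) (z : plane R)
    (u : nat -> plane R) : Prop :=
  exists2 m, l = line_of_slope m z &
    [/\ forall n, u n <> z, u @ \oo --> z & slope (u n - z) @[n --> \oo] --> m].

Context (S : smoothSurface R).

(* Through v |-> v c, T_pS is identified with the plane in such a way that
   the differential of c at p becomes the identity. The chart c is applied to
   the terms of the sequence from some rank N on, where they lie in dom c. *)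
Definition converges_along (p : S) (l : PT p) (u : nat -> S) : Prop :=
  (forall n, u n <> p) /\
  exists c (N : nat),
    [/\ chart_at p c, c p = 0, forall n, dom c (u (N + n)%N) &
        plane_converges_along [set v c | v in line l] (c p)
          (fun n => c (u (N + n)%N))].

Definition transverse_for (q : PTS S) (u : nat -> PTS S) : Prop :=
  converges_along (fiber q) (base \o u) /\
  forall i : nat -> nat, {homo i : m n / (m < n)%N} ->
    ~ (u \o i @ \oo --> q).

Definition transverse (u : nat -> PTS S) : Prop :=
  exists q, transverse_for q u.

End Transverse.

(* Main.v *)
Require Import Defs.
From HB Require Import structures.
From mathcomp Require Import all_boot all_order all_algebra.
From mathcomp Require Import all_classical all_reals.
From mathcomp Require Import topology normedtype landau derive.
From mathcomp Require Import sequences realfun trigo.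
From mathcomp Require finmap.
From mathcomp Require Import ring lra zify.

(** Tangent directions are handled through filters. A nonzero tangent vector v
    at p has a filter [sector p v] of approach to p along the ray of v; a C^1
    curve leaves each of its points along the sector of its velocity and,
    backwards, along the opposite sector ([velocity_right], [velocity_left]).
    Converging to p along a line means converging along the union of the two
    sectors of the line ([converges_alongP]).

    The heart of the matter is [sector_image]: an injective continuous map f
    which maps C^1 curves to C^1 curves carries sectors to sectors, although it
    need not be differentiable. Take a C^1 curve r leaving p along v; its image
    leaves f p along some ray w. If f did not carry the whole sector of v to
    the sector of w, one could find points tending to p along v whose images
    stay away from some neighbourhood of that ray. One C^1 curve can be drawn
    through infinitely many of these points and infinitely many points of r
    ([curve_through_points]); its image is a C^1 curve, hence leaves f p along
    a single ray, which must be w because of the points of r, a contradiction.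
    Consequently the induced map on lines is the relation [line_image], which
    is functorial.

    If f and its inverse g both preserve C^1 curves, then the induced maps of f
    and g are inverse bijections, and they are continuous because a thin cone
    of rays is carried into a thin cone. Convergence along a line is preserved
    since sectors are. If the image of a transverse sequence had a subsequence
    converging in the bundle, a C^1 curve could be drawn through infinitely
    many of its points, tangent there to the given lines ([curve_through]);
    applying g yields a C^1 curve through the original points tangent to the
    original lines, and the continuity of its tangent contradicts
    transversality ([transverse_image]).

    Conversely let beta be a C^1 parametrization and delta := g \o beta.
    Because the induced maps of f are bijective, delta leaves each of its
    points along opposite rays, those of V t and of its opposite
    ([direction_exists]). Because f maps transverse sequences to transverse
    sequences, the line of V t depends continuously on t
    ([direction_continuous]). It remains to see that such a closed curve has a
    regular C^1 parametrization. Near t0, in a chart, the scalar product of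
    delta with V t0 has no local extremum, as the two sides of delta at a point
    are opposite; it is therefore an increasing coordinate X, with respect to
    which delta is continuously differentiable ([local_coordinate]). Composing
    such coordinates with smooth steps gives degree one functions on the
    circle, and the average tau of finitely many of them has a positive
    derivative with respect to every coordinate ([global_parameter]); then
    delta \o tau^-1 is a regular C^1 parametrization
    ([regular_reparametrization]). *)

Set Implicit Arguments.
Unset Strict Implicit.
Unset Printing Implicit Defensive.

Import Order.TTheory GRing.Theory Num.Theory.
Import numFieldNormedType.Exports.
Import Defs.

Local Open Scope classical_set_scope.
Local Open Scope ring_scope.

(** * Joint limits of difference quotients *)

Lemma nbhs_normC (R : realType) (V : normedModType R) (v : V) (A : set V) :
  nbhs v A <-> exists2 e : R, 0 < e & forall b, `|b - v| < e -> A b.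
Proof.
split=> [/nbhs_ballP[e /= e0 eA]|[e e0 eA]].
  exists e => // b bv; apply: eA; by rewrite -ball_normE /= distrC.
apply/nbhs_ballP; exists e => //= b.
by rewrite -ball_normE /= distrC; exact: eA.
Qed.

Lemma near_normC (R : realType) (V : normedModType R) (v : V) (e : R) :
  0 < e -> nbhs v [set b | `|b - v| < e].
Proof. by move=> e0; apply/nbhs_normC; exists e. Qed.

(** Letting the direction vary together with the step is what makes sectors
    independent of the chart. *)
Lemma diff_quotient_cvg (R : realType) (V W : normedModType R) (T : V -> W)
    (z d : V) : differentiable T z ->
  (fun hb : R * V => hb.1^-1 *: (T (z + hb.1 *: hb.2) - T z))
    @ filter_prod 0^' (nbhs d) --> 'd T z d.
Proof.
move=> dT; have /= /eqaddoP dTo := diff_locally dT.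
have cT : {for d, continuous ('d T z)} by exact: diff_continuous.
apply/cvgrPdist_lt => e e0.
have e20 : 0 < e / 2 by rewrite divr_gt0.
have nd : 0 < `|d| + 1 by rewrite ltr_wpDl.
have k0 : 0 < e / 2 / (`|d| + 1) by rewrite divr_gt0.
have /nbhs_ballP[r /= r0 hr] := dTo _ k0.
have sm : 0 < r / (`|d| + 1) by rewrite divr_gt0.
have n1 : \forall h \near (0 : R)^', `|h| < r / (`|d| + 1) /\ h != 0.
  by near=> h; split; [near: h; exact: dnbhs0_lt|near: h; exact: nbhs_dnbhs_neq].
have n2 : \forall b \near d, `|b - d| < 1 /\ `|'d T z d - 'd T z b| < e / 2.
  near=> b; split; near: b; first exact: cvgr_distC_lt.
  by move/cvgrPdist_lt : cT; apply.
exists ([set h : R | `|h| < r / (`|d| + 1) /\ h != 0],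
   [set b | `|b - d| < 1 /\ `|'d T z d - 'd T z b| < e / 2]) => //=.
move=> [h b] /= [[hr1 h0] [bd dTb]].
have b1 : `|b| < `|d| + 1.
  by rewrite -(subrK d b) addrC (le_lt_trans (ler_normD _ _))// ltrD2l.
have hb : ball (0 : V) r (h *: b).
  rewrite -ball_normE /= sub0r normrN normrZ.
  rewrite (le_lt_trans (ler_wpM2l (normr_ge0 h) (ltW b1)))//.
  by rewrite -ltr_pdivlMr.
have := hr _ hb; rewrite /= !fctE /= => {}hr.
rewrite -(subrK ('d T z b) ('d T z d)) -addrA.
rewrite (le_lt_trans (ler_normD _ _))// (splitr e) ltrD //.
rewrite -normrN opprB.
rewrite -['d T z b](scalerK h0) -scalerBr normrZ normfV ltr_pdivrMl ?normr_gt0//.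
rewrite -linearZ /= [z + _]addrC -addrA -opprD.
apply: le_lt_trans hr _.
rewrite normrZ mulrCA ltr_pM2l ?normr_gt0//.
by rewrite mulrAC ltr_pdivrMr // ltr_pM2l.
Unshelve. all: by end_near. Qed.

Section Plane.
Context {R : realType}.
Implicit Types (v w z : plane R).

(** The differential at y is linear with the two partial derivatives at y as
    coefficients, and those are continuous in y. *)
Lemma diff_joint_continuous (U : set (plane R)) (T : plane R -> plane R) z w :
  open U -> C_on 1 U T -> U z ->
  (fun zw : plane R * plane R => (fun y u : plane R => 'd T y u) zw.1 zw.2)
    @ (z, w) --> 'd T z w.
Proof.
move=> oU /= [dT cT] Uz.
have split2 (y u : plane R) : U y ->
    'd T y u = u.1 *: 'D_(1, 0) T y + u.2 *: 'D_(0, 1) T y.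
  move=> Uy; rewrite !deriveE; [|exact: dT|exact: dT].
  rewrite -!linearZ -linearD /=; congr ('d T y _).
  case: u => a b; congr (_, _).
    by rewrite /= /GRing.scale /= mulr1 mulr0 addr0.
  by rewrite /= /GRing.scale /= mulr1 mulr0 add0r.
have nU : \forall y \near (z, w), U y.1.
  have : fst @ (z, w) --> z by exact: cvg_fst.
  by apply; exact: open_nbhs_nbhs.
have c1 : fst @ (z, w) --> z by exact: cvg_fst.
have c2 : snd @ (z, w) --> w by exact: cvg_snd.
have c21 : (fun y : plane R * plane R => y.2.1) @ (z, w) --> w.1.
  exact: (cvg_comp _ _ c2 (@cvg_fst _ _ _ _ _)).
have c22 : (fun y : plane R * plane R => y.2.2) @ (z, w) --> w.2.
  exact: (cvg_comp _ _ c2 (@cvg_snd _ _ _ _ _)).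
pose F (y : plane R * plane R) :=
  y.2.1 *: 'D_(1, 0) T y.1 + y.2.2 *: 'D_(0, 1) T y.1.
have cF : F @ (z, w) --> w.1 *: 'D_(1, 0) T z + w.2 *: 'D_(0, 1) T z.
  apply: cvgD; apply: cvgZ => //.
    exact: (cvg_comp _ _ c1 (cT (1, 0) z Uz)).
  exact: (cvg_comp _ _ c1 (cT (0, 1) z Uz)).
apply: (eq_ind_r (fun l => _ @ (z, w) --> l) _ (split2 z w Uz)).
apply: cvg_trans cF; apply: near_eq_cvg.
by apply: filterS nU => y Uy; exact/esym/split2.
Qed.

End Plane.

(** * Approaching a point along a ray *)

Section Sectors.
Context {R : realType} (S : smoothSurface R).
Implicit Types (p q : S) (c : chart R S) (v w b : plane R).

(** The points c^-1 (c p + x b) with x small and positive and b close to v: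
    the trace in the chart c of thin cones around the ray of v. *)
Definition sect (c : chart R S) (p : S) (v : plane R) : set_system S :=
  (fun xb : R * plane R => of_plane c (c p + xb.1 *: xb.2))
    @ filter_prod (0 : R)^'+ (nbhs v).

Global Instance sect_filter c p v : ProperFilter (sect c p v).
Proof. exact: fmap_proper_filter. Qed.

Lemma sectP c p v (A : set S) : sect c p v A <->
  exists2 e : R, 0 < e & forall x b, 0 < x < e -> `|b - v| < e ->
    A (of_plane c (c p + x *: b)).
Proof.
split=> [[[P Q] /= [P0 Qv] PQA]|[e e0 he]].
  move: P0 => /nbhs_ballP[r /= r0 rP].
  move: Qv => /nbhs_ballP[s /= s0 sQ].
  exists (Num.min r s); first by rewrite lt_min r0 s0.
  move=> x b /andP[x0]; rewrite !lt_min => /andP[xr _] /andP[_ bs].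
  apply: (PQA (x, b)); split=> /=.
    by apply: rP => //; rewrite -ball_normE/= sub0r normrN gtr0_norm.
  by apply: sQ; rewrite -ball_normE /= distrC.
exists ([set x | 0 < x < e], [set b | `|b - v| < e]).
  split=> /=.
    near=> x => /=; apply/andP; split; first by near: x; exact: nbhs_right_gt.
    by near: x; exact: nbhs_right_lt.
  exact: near_normC.
by move=> [x b] /= [xe be]; exact: he.
Unshelve. all: by end_near. Qed.

Lemma sect_base_cvg (z v : plane R) :
  (fun xb : R * plane R => z + xb.1 *: xb.2) @ filter_prod (0 : R)^'+ (nbhs v)
    --> z.
Proof.
rewrite -[X in _ --> X]addr0 -(scale0r v).
apply: cvgD; first exact: cvg_cst.
apply: cvgZ; last exact: cvg_snd.
have c0 : (0 : R)^'+ --> (0 : R) by exact: cvg_within.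
exact: (cvg_trans cvg_fst c0).
Qed.

Lemma sect_nbhs c p v (A : set S) : dom c p -> nbhs p A -> sect c p v A.
Proof.
move=> cp Ap; have := near_chart cp Ap => nA.
have := @sect_base_cvg (c p) v _ nA; by apply: (@filterS _ (filter_prod (0 : R)^'+ (nbhs v))) => xb [].
Qed.

Lemma sect_scale c p v (a : R) : 0 < a -> sect c p v --> sect c p (a *: v).
Proof.
move=> a0 A /sectP[e e0 eA]; apply/sectP.
exists (Num.min (e * a) (e / a)); first by rewrite lt_min mulr_gt0 ?divr_gt0.
move=> x b /andP[x0]; rewrite !lt_min => /andP[xe _] /andP[_ be].
have := eA (a^-1 * x) (a *: b); rewrite !scalerA mulrAC mulVf ?gt_eqF// mul1r.
apply.
  by rewrite mulr_gt0 ?invr_gt0//= mulrC ltr_pdivrMr.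
by rewrite -scalerBr normrZ gtr0_norm // mulrC -ltr_pdivlMr.
Qed.

(** A transition maps c p + x b to c' p + x b' where b' is its difference
    quotient, which tends to the image of v as x tends to 0 and b to v. *)
Lemma sect_chart c c' p v : chart_at p c -> chart_at p c' ->
  sect c p v --> sect c' p ('d (transition c c') (c p) v).
Proof.
move=> pc pc'; have [cp cp'] := (pc.2, pc'.2).
have dT := transition_differentiable pc pc'.
have q := @diff_quotient_cvg _ _ _ _ _ v dT.
move: (q); set g := fun hb : R * plane R => _ => gq.
have {}gq : g @ filter_prod 0^'+ (nbhs v)
   --> 'd (transition c c') (c p) v.
  apply: cvg_trans gq; apply: cvg_app; move=> A [[P Q] /= [P0 Qv] PQA].
  exists (P, Q) => //; split=> //=; move: P0.
  rewrite /dnbhs /within /=; apply: filterS => x Px x0; apply: Px.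
  by rewrite gt_eqF.
have c1 : (fun hb : R * plane R => (hb.1, g hb)) @ filter_prod 0^'+ (nbhs v)
    --> filter_prod 0^'+ (nbhs ('d (transition c c') (c p) v)).
  move=> B [[P Q] /= [P0 Qv] PQB].
  have nP : filter_prod (0 : R)^'+ (nbhs v) (fun hb => P hb.1).
    by exists (P, setT) => [|x []//]; split=> //; exact: filterT.
  have nQ := gq _ Qv.
  apply: (@filterS2 _ (filter_prod (0 : R)^'+ (nbhs v)) _ _ _ _ _ nP nQ).
  by move=> hb Pg Qg; exact: PQB.
move=> A sA; have nA := c1 _ sA.
have nd := @sect_base_cvg (c p) v _ (near_chart cp (dom_nbhs cp')).
have nx : filter_prod (0 : R)^'+ (nbhs v) (fun xb => 0 < xb.1).
  exists ([set x | 0 < x], setT) => [|x []//].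
  by split=> /=; [exact: nbhs_right_gt | exact: filterT].
apply: (@filterS3 _ (filter_prod (0 : R)^'+ (nbhs v)) _ _ _ _ _ _ nA nd nx).
move=> -[x b] /= + [_ cz cz'] x0.
rewrite /g /= transition_val // scalerA divff ?gt_eqF// scale1r addrC subrK.
by rewrite /transition /= to_planeK.
Qed.

End Sectors.

Section RayPlane.
Context {R : realType}.
Implicit Types (v w b : plane R).

Definition dot v w : R := v.1 * w.1 + v.2 * w.2.
Definition det v w : R := v.1 * w.2 - v.2 * w.1.

Lemma plane_neq0 v : v != 0 -> 0 < dot v v.
Proof.
case: v => a b; rewrite /dot /= -!expr2 => ab0.
rewrite lt0r; apply/andP; split; last by apply: addr_ge0; exact: sqr_ge0.
apply: contra ab0; rewrite paddr_eq0; [|exact: sqr_ge0|exact: sqr_ge0].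
by rewrite !sqrf_eq0 => /andP[/eqP-> /eqP->].
Qed.

Lemma dot_det_cvg v w : (fun u : plane R * plane R => dot u.1 u.2) @ (v, w)
    --> dot v w /\
  (fun u : plane R * plane R => det u.1 u.2) @ (v, w) --> det v w.
Proof.
have c1 : fst @ (v, w) --> v by exact: cvg_fst.
have c2 : snd @ (v, w) --> w by exact: cvg_snd.
have c11 : (fun y : plane R * plane R => y.1.1) @ (v, w) --> v.1.
  exact: (cvg_comp _ _ c1 (@cvg_fst _ _ _ _ _)).
have c12 : (fun y : plane R * plane R => y.1.2) @ (v, w) --> v.2.
  exact: (cvg_comp _ _ c1 (@cvg_snd _ _ _ _ _)).
have c21 : (fun y : plane R * plane R => y.2.1) @ (v, w) --> w.1.
  exact: (cvg_comp _ _ c2 (@cvg_fst _ _ _ _ _)).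
have c22 : (fun y : plane R * plane R => y.2.2) @ (v, w) --> w.2.
  exact: (cvg_comp _ _ c2 (@cvg_snd _ _ _ _ _)).
by split; [apply: cvgD|apply: cvgB]; apply: cvgM.
Qed.

(** Two rays whose thin cones always meet have a determinant that is zero and
    a scalar product that is nonnegative, both by continuity. *)
Lemma ray_unique v w : v != 0 -> w != 0 ->
  (forall e : R, 0 < e -> exists x b x' b', [/\ 0 < x, 0 < x',
     `|b - v| < e, `|b' - w| < e & x *: b = x' *: b']) ->
  exists2 a : R, 0 < a & w = a *: v.
Proof.
move=> v0 w0 H.
have key (g : plane R -> plane R -> R) (P : set R) :
    (fun u : plane R * plane R => g u.1 u.2) @ (v, w) --> g v w ->
    nbhs (g v w) P ->
    exists x b x' b', [/\ 0 < x, 0 < x', x *: b = x' *: b' & P (g b b')].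
  move=> gc /gc [[A B] /= [Av Bw] ABP].
  have [e1 e10 e1A] := (nbhs_normC v A).1 Av.
  have [e2 e20 e2B] := (nbhs_normC w B).1 Bw.
  have [|x [b [x' [b' [x0 x'0]]]]] := H (Num.min e1 e2).
    by rewrite lt_min e10.
  rewrite !lt_min => /andP[be1 be2] /andP[b1 b2] e.
  exists x, b, x', b'; split=> //.
  by apply: (ABP (b, b')); split=> /=; [exact: e1A|exact: e2B].
have [cdot cdet] := dot_det_cvg v w.
have det0 : det v w = 0.
  apply/eqP; apply: contraT => d0.
  have [|x [[b1 b2] [x' [[b1' b2'] [x0 x'0 [e1 e2]]]]]] :=
      key _ [set r | r != 0] cdet.
    by apply: open_nbhs_nbhs; split=> //; exact: open_neq.
  rewrite /= /det /= => /negP[]; apply/eqP.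
  have E : x * (b1 * b2' - b2 * b1') = 0.
    rewrite mulrBr !mulrA.
    have -> : x * b1 = x' * b1' by [].
    have -> : x * b2 = x' * b2' by [].
    by ring.
  by move/eqP: E; rewrite mulf_eq0 gt_eqF //= => /eqP.
have dot0 : 0 <= dot v w.
  rewrite leNgt; apply/negP => d0.
  have [|x [[b1 b2] [x' [[b1' b2'] [x0 x'0 [e1 e2]]]]]] :=
      key _ [set r | r < 0] cdot.
    by apply: open_nbhs_nbhs; split=> //; exact: open_lt.
  rewrite /= /dot /= => d1.
  have E : x * (b1 * b1' + b2 * b2') = x' * (b1' ^+ 2 + b2' ^+ 2).
    rewrite mulrDr !mulrA.
    have -> : x * b1 = x' * b1' by [].
    have -> : x * b2 = x' * b2' by [].
    by ring.
  have : 0 <= x' * (b1' ^+ 2 + b2' ^+ 2).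
    by apply: mulr_ge0; [exact: ltW | apply: addr_ge0; exact: sqr_ge0].
  by rewrite -E leNgt pmulr_rlt0 // d1.
have v1 := plane_neq0 v0.
have wE : w = (dot v w / dot v v) *: v.
  case: v w v0 w0 {H key cdot cdet dot0} det0 v1 => [v1 v2] [w1 w2] _ _.
  rewrite /det /dot /= => det0 vv; congr (_, _); rewrite /= /GRing.scale /=;
    apply: (@mulfI _ (v1 * v1 + v2 * v2)); rewrite ?gt_eqF //.
    rewrite mulrAC mulrCA divff ?gt_eqF// mulr1.
    have : v2 * (v1 * w2 - v2 * w1) = 0 by rewrite det0 mulr0.
    by move=> ?; lra.
  rewrite mulrAC mulrCA divff ?gt_eqF// mulr1.
  have : v1 * (v1 * w2 - v2 * w1) = 0 by rewrite det0 mulr0.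
  by move=> ?; lra.
exists (dot v w / dot v v) => //.
rewrite divr_gt0 // lt_neqAle dot0 andbT eq_sym; apply: contra w0 => /eqP d0.
by rewrite wE d0 mul0r scale0r.
Qed.

End RayPlane.

Section ChartShift.
Context {R : realType}.

Lemma addc_continuous (V : normedModType R) (a : V) :
  continuous (fun x : V => x + a).
Proof.
move=> x; apply: (@continuousD _ V V id (cst a)); last exact: cst_continuous.
by move=> A.
Qed.

(** Directional derivatives commute with translations, so the induction on the
    order of smoothness applies to the shifted directional derivatives. *)
Lemma C_on_shift (V W : normedModType R) (k : nat) (U : set V) (g : V -> W)
    (a : V) :
  C_on k U g -> C_on k [set x | U (x + a)] (fun x => g (x + a)).
Proof.
elim: k g => [|k IH] g /=.
  move=> cg x Ux; apply: (@continuous_comp _ _ _ (fun x => x + a) g).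
    exact: addc_continuous.
  exact: cg.
move=> [dg Dg]; split=> [x Ux|v].
  by apply: (@differentiable_comp _ _ _ _ (fun x => x + a) g) => //; exact: dg.
have -> : (fun x => 'D_v (fun y => g (y + a)) x) = (fun x => 'D_v g (x + a)).
  apply/funext => x; rewrite /derive.
  set g1 := fun h => h^-1 *: _; set g2 := fun h => h^-1 *: _.
  by suff -> : g1 = g2 by []; apply/funext => h; rewrite /g1 /g2 /= addrA.
exact: (IH (fun x => 'D_v g x) (Dg v)).
Qed.

Lemma C_on_addc (V W : normedModType R) (k : nat) (U : set V) (g : V -> W)
    (a : W) : C_on k U g -> C_on k U (fun x => g x + a).
Proof.
case: k => [|k] /= cg.
  move=> x Ux; apply: (@continuous_comp _ _ _ g (fun y => y + a)).
    exact: cg.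
  exact: addc_continuous.
case: cg => dg Dg; split=> [x Ux|v]; first by apply: differentiableD => //; exact: dg.
have -> // : (fun x => 'D_v (fun y => g y + a) x) = (fun x => 'D_v g x).
apply/funext => x; rewrite /derive.
set g1 := fun h => h^-1 *: _; set g2 := fun h => h^-1 *: _.
suff -> : g1 = g2 by []; apply/funext => h.
by rewrite /g1 /g2 /= opprD addrACA subrr addr0.
Qed.

Variable S : smoothSurface R.
Implicit Types (c : chart R S) (a : plane R).

Let shift_to c a (q : S) : plane R := c q - a.
Let shift_of c a z : S := of_plane c (z + a).

Let shift_image c a (D : set S) :
  shift_to c a @` D = [set x | (c @` D) (x + a)].
Proof.
apply/seteqP; split=> [_ [q Dq <-]|x [q Dq cq]] /=.
  by exists q; rewrite // subrK.
by exists q => //; rewrite /shift_to cq addrK.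
Qed.

Definition chart_shift c a : chart R S.
Proof.
refine (@Chart R S (dom c) (shift_to c a) (shift_of c a) (@dom_open _ _ c) _ _ _ _).
- rewrite shift_image; apply: (@open_comp _ _ (fun x : plane R => x + a)).
    by move=> x _; exact: addc_continuous.
  exact: codom_open.
- by move=> p cp; rewrite /shift_to /shift_of subrK to_planeK.
- move=> p cp.
  apply: (@continuous_comp _ _ _ c (fun x : plane R => x - a)).
    exact: to_plane_continuous.
  exact: addc_continuous.
- move=> z; rewrite shift_image => cz.
  apply: (@continuous_comp _ _ _ (fun x : plane R => x + a) (of_plane c)).
    exact: addc_continuous.
  exact: of_plane_continuous.
Defined.

Lemma chart_shift_atlas c a : atlas c -> atlas (chart_shift c a).
Proof.
move=> ac; apply: atlas_maximal => c' ac'.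
have [s1 s2] := atlas_compatible ac ac'.
split=> k.
  have := @C_on_shift _ _ k _ _ a (s1 k).
  by rewrite -(shift_image c a).
exact: (C_on_addc (- a) (s2 k)).
Qed.

Lemma chart_at_origin (p : S) : exists2 c : chart R S, chart_at p c & c p = 0.
Proof.
have [c ac cp] := atlas_cover p.
exists (chart_shift c (c p)); last by rewrite /= /shift_to subrr.
by split=> //; exact: chart_shift_atlas.
Qed.

End ChartShift.

Section SectorSet.
Context {R : realType} (S : smoothSurface R).
Implicit Types (p q : S) (c : chart R S) (v w : family S).

(** Unlike the sets of [sect], which are images under the inverse chart, this
    cone consists of points of the domain of c, where c is injective. *)
Definition sector_set c p (v : plane R) (e : R) : set S :=
  [set q | dom c q /\ exists x b, [/\ 0 < x < e, `|b - v| < e &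
     c q = c p + x *: b]].

Lemma sect_sector_set c p (v : plane R) (e : R) : dom c p -> 0 < e ->
  sect c p v (sector_set c p v e).
Proof.
move=> cp e0.
have n1 : filter_prod (0 : R)^'+ (nbhs v) [set xb | 0 < xb.1 < e /\ `|xb.2 - v| < e].
  exists ([set x | 0 < x < e], [set b | `|b - v| < e]) => [|[x b] //].
  split=> /=; last exact: near_normC.
  near=> x => /=; apply/andP; split; first by near: x; exact: nbhs_right_gt.
  by near: x; exact: nbhs_right_lt.
have n2 := @sect_base_cvg _ (c p) v _ (near_chart cp (dom_nbhs cp)).
apply: (@filterS2 _ (filter_prod (0 : R)^'+ (nbhs v)) _ _ _ _ _ n2 n1).
move=> -[x b] /= [cz dz _] [xe be].
by split=> //; exists x, b; split=> //; rewrite of_planeK.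
Unshelve. all: by end_near. Qed.

Lemma sect_sectorP c p (v : plane R) (A : set S) : dom c p ->
  sect c p v A <-> exists2 e, 0 < e & sector_set c p v e `<=` A.
Proof.
move=> cp; split=> [/sectP[e e0 eA]|[e e0 eA]].
  exists e => // q [cq [x [b [xe be cqE]]]].
  by rewrite -(to_planeK cq) cqE; exact: eA.
by apply: filterS eA _; exact: sect_sector_set.
Qed.

(** The filter of approach to p along the ray of v. Asking for all the charts
    makes it intrinsic; one chart suffices when v is a tangent vector
    ([sectorE]). *)
Definition sector p v : set_system S :=
  [set A | forall c, chart_at p c -> sect c p (v c) A].

Global Instance sector_filter p v : ProperFilter (sector p v).
Proof.
split; last split.
- have [c ac cp] := atlas_cover p.
  by move=> /(_ c (conj ac cp)); exact: filter_not_empty.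
- by move=> c pc; exact: filterT.
- by move=> A B pA pB c pc; apply: filterI; [exact: pA|exact: pB].
- by move=> A B AB pA c pc; apply: filterS AB _; exact: pA.
Qed.

Lemma sectorE p v c (A : set S) : tangent_space p v -> chart_at p c ->
  sector p v A <-> sect c p (v c) A.
Proof.
move=> [tv _] pc; split=> [|sA c' pc']; first exact.
by apply: (sect_chart pc' pc); rewrite -tv.
Qed.

Lemma sectorP p v c (A : set S) : tangent_space p v -> chart_at p c ->
  sector p v A <-> exists2 e, 0 < e & sector_set c p (v c) e `<=` A.
Proof.
by move=> tv pc; rewrite (sectorE _ tv pc); apply: sect_sectorP; exact: pc.2.
Qed.

Lemma sector_scale p v (a : R) : 0 < a ->
  sector p v --> sector p (fun c => a *: v c).
Proof. by move=> a0 A sA c pc; apply: (sect_scale a0); exact: sA. Qed.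

Lemma sector_nbhs p v : sector p v --> p.
Proof. by move=> A pA c pc; apply: sect_nbhs => //; exact: pc.2. Qed.

(** A proper filter that follows two rays contains points lying in thin cones
    around both. *)
Lemma sector_unique (F : set_system S) p v w : ProperFilter F ->
  tangent_space p v -> tangent_space p w -> v <> (fun=> 0) -> w <> (fun=> 0) ->
  F --> sector p v -> F --> sector p w ->
  exists2 a : R, 0 < a & w = fun c => a *: v c.
Proof.
move=> FF tv tw v0 w0 Fv Fw.
have [c ac cp] := atlas_cover p; have pc : chart_at p c by [].
have [|||a a0 wva] := @ray_unique _ (v c) (w c).
- exact: (tangent_neq0 pc tv).
- exact: (tangent_neq0 pc tw).
- move=> e e0.
  have /Fv nv : sector p v (sector_set c p (v c) e).
    by apply/(sectorP _ tv pc); exists e.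
  have /Fw nw : sector p w (sector_set c p (w c) e).
    by apply/(sectorP _ tw pc); exists e.
  have [q [[_ [x [b [/andP[x0 _] be E]]]] [_ [x' [b' [/andP[x'0 _] be' E']]]]]] :=
    filter_ex (filterI nv nw).
  exists x, b, x', b'; split=> //.
  by move: E; rewrite E' => /addrI.
exists a => //; apply: (tangent_space_inj pc tw) => //.
exact: tangent_spaceZ.
Qed.

Definition negv v : family S := fun c => - v c.

Lemma tangent_negv p v : tangent_space p v -> tangent_space p (negv v).
Proof.
move=> /(tangent_spaceZ (-1)); congr (tangent_space _ _).
by apply/funext => c; rewrite scaleN1r.
Qed.

Lemma negv_neq0 v : v <> (fun=> 0) -> negv v <> (fun=> 0).
Proof.
move=> v0 nv; apply: v0; apply/funext => c.
by rewrite -[v c]opprK -/(negv v c) nv oppr0.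
Qed.

Lemma negvK : involutive negv.
Proof. by move=> v; apply/funext => c; rewrite /negv opprK. Qed.

End SectorSet.

Lemma fmap_ultra (T U : Type) (f : T -> U) (F : set_system T) :
  UltraFilter F -> UltraFilter (f @ F).
Proof.
move=> FU; split; first exact: fmap_proper_filter.
move=> G GF FG; apply/seteqP; split=> // A GA.
have [//|FnA] := in_ultra_setVsetC (f @^-1` A) FU.
have GnA : G (~` A) by exact: FG.
have GAA : G (A `&` ~` A) by exact: filterI.
by have [x []] := filter_ex GAA.
Qed.

Section Approach.
Context {R : realType} (S : smoothSurface R).
Implicit Types (p q : S) (c : chart R S) (v w : family S).

Lemma cvg_sect (T : Type) (F : set_system T) (h : T -> R) (u : T -> S)
    c p (v : plane R) : Filter F -> dom c p ->
  h @ F --> (0 : R)^'+ -> u @ F --> p ->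
  (fun x => (h x)^-1 *: (c (u x) - c p)) @ F --> v ->
  u @ F --> sect c p v.
Proof.
move=> FF cp h0 up quo A /(sect_sectorP _ _ cp)[e e0 eA].
have n1 : F [set x | 0 < h x < e].
  suff /h0 : (0 : R)^'+ [set x | 0 < x < e] by [].
  near=> x => /=; apply/andP; split.
    by near: x; exact: nbhs_right_gt.
  by near: x; exact: nbhs_right_lt.
have n2 : F [set x | dom c (u x)] := up _ (dom_nbhs cp).
have n3 : F [set x | `|(h x)^-1 *: (c (u x) - c p) - v| < e].
  exact: (quo _ (near_normC v e0)).
apply: (@filterS3 _ F _ _ _ _ (u @^-1` A) _ n1 n2 n3) => x /= hx cx qx.
apply: eA; split=> //; exists (h x), ((h x)^-1 *: (c (u x) - c p)); split=> //.
have /andP[hx0 _] := hx.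
by rewrite scalerA divff ?gt_eqF// scale1r addrC subrK.
Unshelve. all: by end_near. Qed.

Lemma sphere_compact : compact [set z : plane R | `|z| = 1].
Proof.
have c1 : compact (`[(-1 : R), 1] `*` `[(-1 : R), 1])%classic.
  by apply: compact_setX; exact: segment_compact.
apply: (subclosed_compact _ c1).
  apply: (@closed_comp _ _ (fun z : plane R => `|z|) [set 1]).
    by move=> z _; exact: norm_continuous.
  exact: closed_eq.
move=> [a b] /= ab1; rewrite /= !in_itv /= -!ler_norml.
have : `|(a, b)| <= 1 by rewrite ab1.
by rewrite prod_normE /= ge_max => /andP[].
Qed.

(** By compactness of the unit circle, the normalized differences c q - c p
    converge along an ultrafilter; the limit is the direction of approach. *)
Lemma sector_of_ultra (F : set_system S) p : UltraFilter F -> F --> p ->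
  F [set q | q <> p] ->
  exists v, [/\ tangent_space p v, v <> (fun=> 0) & F --> sector p v].
Proof.
move=> UF Fp Fnp; have FF : Filter F by exact: filter_filter.
have [c ac cp] := atlas_cover p; have pc : chart_at p c by [].
pose r q := `|c q - c p|.
pose d q : plane R := (r q)^-1 *: (c q - c p).
have Fc : F (dom c) := Fp _ (dom_nbhs cp).
have r0 : F [set q | 0 < r q].
  apply: (@filterS2 _ F _ _ _ _ _ Fc Fnp) => q cq qp /=; rewrite normr_gt0 subr_eq0.
  by apply/eqP => /(congr1 (of_plane c)); rewrite !to_planeK.
have Fd1 : F [set q | `|d q| = 1].
  apply: filterS r0 => q /= r0; rewrite normrZ normfV normr_id mulVf //.
  by rewrite gt_eqF.
have UdF : UltraFilter (d @ F) by exact: fmap_ultra.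
have := sphere_compact; rewrite compact_ultra => /(_ _ UdF Fd1)[w [/= w1 dw]].
have [v tv vw] := tangent_space_exists w pc.
exists v; split=> //.
  by move=> v0; move: w1; rewrite -vw v0 normr0 => /esym/eqP; rewrite oner_eq0.
have : id @ F --> sect c p (v c).
  apply: (@cvg_sect _ _ r) => //; last by rewrite vw.
  have cc : c @ F --> c p.
    apply: cvg_trans (to_plane_continuous cp).
    by move=> A /= Ap; apply: Fp.
  have rr : r @ F --> (0 : R).
    rewrite -(normr0 (plane R)) -(subrr (c p)).
    by apply: cvg_norm; apply: cvgB => //; exact: cvg_cst.
  move=> A rA; apply: (@filterS2 _ F _ _ _ (r @^-1` A) _ r0 (rr _ rA)).
  by move=> q /= q0; exact.
move=> sF A /(sectorE _ tv pc); exact: sF.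
Qed.

(** The filter of approach to p along the line of v, from either side. *)
Definition bisector p v : set_system S :=
  [set A | sector p v A /\ sector p (negv v) A].

Global Instance bisector_filter p v : ProperFilter (bisector p v).
Proof.
split; last split.
- by move=> [/filter_not_empty].
- by split; exact: filterT.
- by move=> A B [A1 A2] [B1 B2]; split; [exact: (filterI A1 B1)|exact: (filterI A2 B2)].
- by move=> A B AB [A1 A2]; split; [exact: (filterS AB A1)|exact: (filterS AB A2)].
Qed.

(** An ultrafilter chooses a side. *)
Lemma bisector_ultra (F : set_system S) p v : UltraFilter F ->
  F --> bisector p v -> F --> sector p v \/ F --> sector p (negv v).
Proof.
move=> UF Fv; apply: contrapT => /not_orP[].
move=> /existsNP[A /not_implyP[sA nA]] /existsNP[B /not_implyP[sB nB]].
have : F (A `|` B).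
  apply: Fv; split.
    exact: (@filterS _ (sector p v) _ A _ (fun x => @or_introl _ _) sA).
  exact: (@filterS _ (sector p (negv v)) _ B _ (fun x => @or_intror _ _) sB).
have [//|FA] := in_ultra_setVsetC A UF; have [//|FB] := in_ultra_setVsetC B UF.
move=> FAB; have : F ((A `|` B) `&` (~` A `&` ~` B)).
  by apply: filterI => //; exact: filterI.
have -> : (A `|` B) `&` (~` A `&` ~` B) = set0.
  by apply/seteqP; split=> // x [[|] + [+ +]].
exact: filter_not_empty.
Qed.

Lemma bisector_unique (F : set_system S) p v w : ProperFilter F ->
  tangent_space p v -> tangent_space p w -> v <> (fun=> 0) -> w <> (fun=> 0) ->
  F --> bisector p v -> F --> bisector p w ->
  exists a : R, w = fun c => a *: v c.
Proof.
move=> FF tv tw v0 w0 Fv Fw.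
have [G [UG FG]] := ultraFilterLemma FF.
have [tv' tw'] := (tangent_negv tv, tangent_negv tw).
have [v'0 w'0] := (negv_neq0 v0, negv_neq0 w0).
have Gv : G --> bisector p v by exact: cvg_trans Fv.
have Gw : G --> bisector p w by exact: cvg_trans Fw.
have [{}Gv|{}Gv] := bisector_ultra UG Gv;
  have [{}Gw|{}Gw] := bisector_ultra UG Gw.
- by have [a _ ->] := sector_unique _ tv tw v0 w0 Gv Gw; exists a.
- have [a _ E] := sector_unique _ tv tw' v0 w'0 Gv Gw; exists (- a).
  by rewrite -(negvK w) E; apply/funext => c; rewrite /negv scaleNr.
- have [a _ ->] := sector_unique _ tv' tw v'0 w0 Gv Gw; exists (- a).
  by apply/funext => c; rewrite /negv scaleNr scalerN.
- have [a _ E] := sector_unique _ tv' tw' v'0 w'0 Gv Gw; exists a.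
  by rewrite -(negvK w) E; apply/funext => c; rewrite /negv scalerN opprK.
Qed.

End Approach.

(** * The rays of a C^1 curve *)

Section CurveVelocity.
Context {R : realType} (S : smoothSurface R).
Implicit Types (p q : S) (c : chart R S) (g : R -> S) (t : R).

Lemma velocityE g t c : chart_at (g t) c ->
  velocity g t c = derive1 (c \o g) t.
Proof. by move=> gc; rewrite /velocity asboolT. Qed.

Lemma derive1_quotient (V : normedModType R) (f : R -> V) t : derivable f t 1 ->
  (fun h => h^-1 *: (f (t + h) - f t)) @ (0 : R)^' --> derive1 f t.
Proof.
move=> df; rewrite derive1E.
have -> : (fun h => h^-1 *: (f (t + h) - f t)) =
    (fun h => h^-1 *: ((f \o shift t) (h *: 1) - f t)).
  by apply/funext => h /=; rewrite [h *: 1]mulr1 [t + h]addrC.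
exact: df.
Qed.

Lemma velocity_tangent g t : C1_param g ->
  tangent_space (g t) (velocity g t) /\ velocity g t <> (fun=> 0).
Proof.
move=> [gc _ gd]; split; first split.
- move=> c c' pc pc'; rewrite !velocityE //.
  have [/derivable1_diffP d1 _ _] := gd _ _ pc.
  have [/derivable1_diffP d2 _ _] := gd _ _ pc'.
  rewrite !derive1E' //; apply/esym; apply: diff_comp_near => //.
    exact: transition_differentiable.
  apply: (@filterS _ (nbhs t) _ (g @^-1` dom c) _ _ (gc t _ (dom_nbhs pc.2))).
  move=> s cs /=.
  by rewrite transition_val.
- by move=> c pc; rewrite /velocity asboolF.
have [c ac cp] := atlas_cover (g t); have pc : chart_at (g t) c by [].
have [_ _ n0] := gd _ _ pc.
by move=> /(congr1 (fun u => u c)); rewrite velocityE.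
Qed.

Lemma velocity_right g t : C1_param g ->
  (fun x => g (t + x)) @ (0 : R)^'+ --> sector (g t) (velocity g t).
Proof.
move=> Cg; have [gc _ gd] := Cg; have [tv _] := velocity_tangent t Cg.
have [c ac cp] := atlas_cover (g t); have pc : chart_at (g t) c by [].
have [dg _ _] := gd _ _ pc.
have c0 : (0 : R)^'+ --> (0 : R) by exact: cvg_within.
have c1 : (fun x => t + x) @ (0 : R)^'+ --> t.
  by rewrite -[X in _ --> X]addr0; apply: cvgD => //; exact: cvg_cst.
have key : (fun x => g (t + x)) @ (0 : R)^'+ --> sect c (g t) (velocity g t c).
  rewrite velocityE //.
  apply: (@cvg_sect R S R (0 : R)^'+ id (fun x => g (t + x))).
  - exact: pc.2.
  - by move=> A.
  - exact: (cvg_comp _ _ c1 (gc t)).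
  - exact/cvg_dnbhs_at_right/(derive1_quotient dg).
by move=> A /(sectorE _ tv pc) /key.
Qed.

Lemma velocity_left g t : C1_param g ->
  (fun x => g (t - x)) @ (0 : R)^'+ --> sector (g t) (negv (velocity g t)).
Proof.
move=> Cg; have [gc _ gd] := Cg; have [/tangent_negv tv _] := velocity_tangent t Cg.
have [c ac cp] := atlas_cover (g t); have pc : chart_at (g t) c by [].
have [dg _ _] := gd _ _ pc.
have c0 : (0 : R)^'+ --> (0 : R) by exact: cvg_within.
have c1 : (fun x => t - x) @ (0 : R)^'+ --> t.
  rewrite -[X in _ --> X]subr0; apply: cvgB => //; exact: cvg_cst.
have key : (fun x => g (t - x)) @ (0 : R)^'+
    --> sect c (g t) (negv (velocity g t) c).
  rewrite /negv velocityE //.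
  apply: (@cvg_sect R S R (0 : R)^'+ id (fun x => g (t - x))).
  - exact: pc.2.
  - by move=> A.
  - exact: (cvg_comp _ _ c1 (gc t)).
  - have := cvg_dnbhs_at_left (derive1_quotient dg).
    rewrite -[X in X^'-]oppr0 at_leftN => H.
    have {}H : (fun x => (- x)^-1 *: ((c \o g) (t + - x) - (c \o g) t))
        @ (0 : R)^'+ --> derive1 (c \o g) t by exact: H.
    have -> : (fun x => id x ^-1 *: (c (g (t - x)) - c (g t))) =
        (fun x => - ((- x)^-1 *: ((c \o g) (t + - x) - (c \o g) t))).
      by apply/funext => x; rewrite /= invrN scaleNr opprK.
    exact: cvgN.
by move=> A /(sectorE _ tv pc) /key.
Qed.

End CurveVelocity.

(** * Simple closed curves *)

Section SimpleClosed.
Context {R : realType} (S : smoothSurface R).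
Implicit Types (p q : S) (g u : R -> S) (s t : R).

(** A topological parametrization of a simple closed curve by R/Z. *)
Definition simple_closed g : Prop :=
  continuous g /\ forall s t, g s = g t <-> exists k : int, t = s + k%:~R.

Lemma C1_simple_closed g : C1_param g -> simple_closed g.
Proof. by case. Qed.

Lemma simple_closed_period g t (k : int) : simple_closed g ->
  g (t + k%:~R) = g t.
Proof. by move=> [_ gi]; apply/esym/gi; exists k. Qed.

Lemma int_small (k : int) : `|k%:~R : R| < 1 -> k = 0.
Proof. by rewrite -intr_norm -[1]/(1%:~R) ltr_int; lia. Qed.

Lemma simple_closed_inj g s t : simple_closed g -> `|s - t| < 1 ->
  g s = g t -> s = t.
Proof.
move=> [_ gi] st /gi[k tE]; have : k = 0.
  by apply: int_small; move: st; rewrite tE opprD addNKr normrN.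
by move=> k0; rewrite tE k0 addr0.
Qed.

(** The circle is compact, so a point of the curve is close to g t only if its
    parameter is close to t modulo 1. *)
Lemma simple_closed_embedding g t (e : R) : simple_closed g -> 0 < e ->
  exists2 U, nbhs (g t) U &
    forall s, U (g s) -> exists k : int, `|s + k%:~R - t| < e.
Proof.
move=> sg e0; have [cg gi] := sg.
pose K := [set s | s \in `[t - 1/2, t + 1/2]] `&` [set s | e <= `|s - t|].
have cK : compact K.
  apply: (subclosed_compact _ (@segment_compact _ (t - 1/2) (t + 1/2))); last first.
    by move=> s [].
  apply: closedI; first exact: interval_closed.
  apply: (@closed_comp _ _ (fun s => `|s - t|) [set r | e <= r]).
    move=> s _; apply: (@continuous_comp _ _ _ (fun s => s - t) (fun s => `|s|)).
      exact: addc_continuous.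
    exact: norm_continuous.
  exact: closed_ge.
have clK : closed (g @` K).
  apply: (compact_closed (@carrier_hausdorff _ S)).
  by apply: continuous_compact => //; apply: continuous_subspaceT.
exists (~` (g @` K)).
  apply: open_nbhs_nbhs; split; first by rewrite openC.
  move=> [s [/=]]; rewrite in_itv /= => /andP[s1 s2] s3 gst.
  have E : s = t.
    by apply: simple_closed_inj gst => //; rewrite ltr_norml; lra.
  by move: s3; rewrite E subrr normr0 leNgt e0.
move=> s Us; exists (- Num.floor (s - t + 1/2)).
rewrite ltNge; apply/negP => es; apply: Us.
exists (s + (- Num.floor (s - t + 1/2))%:~R); last exact: simple_closed_period.
split=> //=; rewrite in_itv /= intrN.
have := floor_le (s - t + 1/2); have := floorD1_gt (s - t + 1/2).
by rewrite intrD; lra.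
Qed.

(** A curve u that stays on the closed curve g factors locally through the
    parameter of g: near s0, a parameter is determined by the point, and it
    depends continuously on it since g is an embedding of the circle. *)
Lemma lift_through u g t0 s0 : simple_closed g -> continuous u ->
  (forall t, range g (u t)) -> g s0 = u t0 ->
  exists h : R -> R, exists2 d : R, 0 < d &
    h t0 = s0 /\ forall t, `|t - t0| < d ->
      [/\ u t = g (h t), `|h t - s0| < 1/4 & {for t, continuous h}].
Proof.
move=> sg cu ug gu.
have q0 : 0 < (1/4 : R) by lra.
pose h t := xget s0 [set s | `|s - s0| < 1/4 /\ g s = u t].
have [U nU hU] := simple_closed_embedding s0 sg q0.
have nu : nbhs t0 (u @^-1` U) by apply: cu; rewrite -gu.
have [d d0 dU] := (nbhs_normC _ _).1 nu.
have hP t : `|t - t0| < d -> `|h t - s0| < 1/4 /\ g (h t) = u t.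
  move=> td; rewrite /h; case: xgetP => [_ _ //|no].
  have [s _ gs] := ug t; have := dU _ td; rewrite /= -gs => /hU[k sk].
  by case: (no (s + k%:~R)); split=> /=; rewrite ?simple_closed_period.
have hu t s : `|t - t0| < d -> `|s - s0| < 1/4 -> g s = u t -> h t = s.
  move=> td ss gs; have [ht gh] := hP _ td.
  apply: (simple_closed_inj sg); last by rewrite gh.
  by move: ht ss; rewrite !ltr_norml; lra.
exists h, d => //; split.
  by apply: hu; rewrite ?subrr ?normr0.
move=> t td; have [ht gh] := hP _ td; split=> //.
move=> A /nbhs_normC[e e0 eA].
have m0 : 0 < Num.min e (1/4) by rewrite lt_min e0.
have [V nV hV] := simple_closed_embedding (h t) sg m0.
have nuV : nbhs t (u @^-1` V) by apply: cu; rewrite -gh.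
have nd : nbhs t [set s | `|s - t0| < d].
  apply/nbhs_normC; exists (d - `|t - t0|); first by rewrite subr_gt0.
  move=> s; rewrite ltrBrDr => sd; rewrite /= -(subrK t s) -addrA.
  exact: le_lt_trans (ler_normD _ _) sd.
apply: (@filterS2 _ (nbhs t) _ _ _ (h @^-1` A) _ nuV nd) => s /= Vs sd.
have [hs ghs] := hP _ sd.
move: Vs; rewrite -ghs => /hV[k]; rewrite lt_min => /andP[k1 k2].
have k0 : k = 0.
  by apply: int_small; move: hs ht k2; rewrite !ltr_norml; lra.
by apply: eA; move: k1; rewrite k0 addr0.
Qed.

(** The local change of parameter is continuous and injective. *)
Lemma lift_monotone u g t0 s0 : simple_closed g -> simple_closed u ->
  (forall t, range g (u t)) -> g s0 = u t0 ->
  exists h : R -> R, exists2 d : R, 0 < d &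
    [/\ h t0 = s0, forall t, `|t - t0| < d -> u t = g (h t),
        forall t, `|t - t0| < d -> {for t, continuous h}
      & (forall s t, `|s - t0| < d -> `|t - t0| < d -> s < t -> h s < h t) \/
        (forall s t, `|s - t0| < d -> `|t - t0| < d -> s < t -> h t < h s)].
Proof.
move=> sg su ug gu.
have [h [d d0 [h0 hP]]] := lift_through sg su.1 ug gu.
exists h, (Num.min d (1/4)); first by rewrite lt_min d0; lra.
have dd t : `|t - t0| < Num.min d (1/4) -> `|t - t0| < d /\ `|t - t0| < 1/4.
  by rewrite lt_min => /andP[].
split=> //; [by move=> t /dd[/hP[]]|by move=> t /dd[/hP[]]|].
set e := Num.min d (1/4).
have inE t : (t \in `]t0 - e, t0 + e[) = (`|t - t0| < e).
  by rewrite in_itv /= ltr_distl.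
have := @itv_continuous_inj_mono _ h `]t0 - e, t0 + e[.
case.
- apply: continuous_in_subspaceT => t /set_mem /=.
  by rewrite inE => /dd[/hP[]].
- move=> s t; rewrite !inE => /dd[sd s4] /dd[td t4] hst.
  apply: (simple_closed_inj su).
    by move: s4 t4; rewrite !ltr_norml; lra.
  by have [-> _ _] := hP _ sd; have [-> _ _] := hP _ td; rewrite hst.
- by move=> H; left => s t sd td; apply: H; rewrite inE.
- by move=> H; right => s t sd td; apply: H; rewrite inE.
Qed.

(** The local change of parameter is monotone: according to its direction, u
    leaves the point along the velocity of g or along its opposite. *)
Lemma simple_closed_sides u g t0 s0 : C1_param g -> simple_closed u ->
  (forall t, range g (u t)) -> g s0 = u t0 ->
  exists w : family S, [/\ w = velocity g s0 \/ w = negv (velocity g s0),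
    (fun x => u (t0 + x)) @ (0 : R)^'+ --> sector (u t0) w &
    (fun x => u (t0 - x)) @ (0 : R)^'+ --> sector (u t0) (negv w)].
Proof.
move=> Cg su ug gu; have sg := C1_simple_closed Cg.
have [h [d d0 [h0 uh hc hm]]] := lift_monotone sg su ug gu.
have [gr gl] := (velocity_right (t:=s0) Cg, velocity_left (t:=s0) Cg).
rewrite gu in gr gl.
have c0 : (0 : R)^'+ --> (0 : R) by exact: cvg_within.
have d00 : `|t0 - t0| < d by rewrite subrr normr0.
have ct : {for t0, continuous h} := hc _ d00.
have cr : (fun x => h (t0 + x)) @ (0 : R)^'+ --> s0.
  have c1 : (fun x => t0 + x) @ (0 : R)^'+ --> t0.
    by rewrite -[X in _ --> X]addr0; apply: cvgD => //; exact: cvg_cst.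
  by rewrite -h0; exact: (cvg_comp _ _ c1 ct).
have cl : (fun x => h (t0 - x)) @ (0 : R)^'+ --> s0.
  have c1 : (fun x => t0 - x) @ (0 : R)^'+ --> t0.
    by rewrite -[X in _ --> X]subr0; apply: cvgB => //; exact: cvg_cst.
  by rewrite -h0; exact: (cvg_comp _ _ c1 ct).
have nx : (0 : R)^'+ [set x | 0 < x < d].
  near=> x => /=; apply/andP; split; first by near: x; exact: nbhs_right_gt.
  by near: x; exact: nbhs_right_lt.
have side (a b : R) (v : family S) : `|a| = 1 -> `|b| = 1 ->
   (forall x, 0 < x < d -> 0 < b * (h (t0 + a * x) - s0)) ->
   (fun x => h (t0 + a * x)) @ (0 : R)^'+ --> s0 ->
   (fun x => g (s0 + b * x)) @ (0 : R)^'+ --> sector (u t0) v ->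
   (fun x => u (t0 + a * x)) @ (0 : R)^'+ --> sector (u t0) v.
  move=> a1 b1 ab ch cv A /cv nA.
  have c2 : (fun x => b * (h (t0 + a * x) - s0)) @ (0 : R)^'+ --> (0 : R).
    have c3 : (fun x => h (t0 + a * x) - s0) @ (0 : R)^'+ --> s0 - s0.
      by apply: (cvgB ch); exact: cvg_cst.
    have : (fun x => b * (h (t0 + a * x) - s0)) @ (0 : R)^'+ --> b * (s0 - s0).
      by apply: (@cvgM _ _ _ _ (cst b)) => //; exact: cvg_cst.
    by rewrite subrr mulr0.
  have nA2 : nbhs (0 : R) (fun y => 0 < y -> A (g (s0 + b * y))) := nA.
  have nA' : (0 : R)^'+ (fun x => 0 < b * (h (t0 + a * x) - s0) ->
      A (g (s0 + b * (b * (h (t0 + a * x) - s0))))) by exact: (c2 _ nA2).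
  apply: (@filterS2 _ (0 : R)^'+ _ _ _ _ _ nA' nx) => x /= Ax xd.
  have := Ax (ab _ xd).
  have bb : b * b = 1 by rewrite -expr2 -real_normK ?num_real// b1 expr1n.
  rewrite mulrA bb mul1r addrC subrK uh //.
  have /andP[x0 xd'] := xd.
  by rewrite addrC addKr normrM a1 mul1r gtr0_norm.
have e1 (F : R -> S) t : (fun x => F (t + 1 * x)) = fun x => F (t + x).
  by apply/funext => x; rewrite mul1r.
have e2 (F : R -> S) t : (fun x => F (t + -1 * x)) = fun x => F (t - x).
  by apply/funext => x; rewrite mulN1r.
have e1' (F : R -> R) t : (fun x => F (t + 1 * x)) = fun x => F (t + x).
  by apply/funext => x; rewrite mul1r.
have e2' (F : R -> R) t : (fun x => F (t + -1 * x)) = fun x => F (t - x).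
  by apply/funext => x; rewrite mulN1r.
have n1 : `|1 : R| = 1 by rewrite normr1.
have nN1 : `|-1 : R| = 1 by rewrite normrN normr1.
have tr x : 0 < x < d -> `|t0 + x - t0| < d.
  by move=> /andP[x0 xd]; rewrite addrC addKr gtr0_norm.
have tl x : 0 < x < d -> `|t0 - x - t0| < d.
  by move=> /andP[x0 xd]; rewrite addrC addKr normrN gtr0_norm.
case: hm => hm.
  exists (velocity g s0); split; first by left.
    rewrite -e1; apply: (side 1 1); rewrite ?e1 ?e1' //.
    move=> x xd; rewrite !mul1r subr_gt0 -[X in X < _]h0; apply: hm => //.
      exact: tr.
    by case/andP: xd => x0 _; rewrite ltrDl.
  rewrite -e2; apply: (side (-1) (-1)); rewrite ?e2 ?e2' //.
  move=> x xd; rewrite !mulN1r oppr_gt0 subr_lt0 -[X in _ < X]h0; apply: hm => //.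
    exact: tl.
  by case/andP: xd => x0 _; rewrite gtrBl.
exists (negv (velocity g s0)); rewrite negvK; split; first by right.
  rewrite -e1; apply: (side 1 (-1)); rewrite ?e1 ?e1' ?e2 //.
  move=> x xd; rewrite !mulN1r mul1r oppr_gt0 subr_lt0 -[X in _ < X]h0.
  apply: hm => //; first exact: tr.
  by case/andP: xd => x0 _; rewrite ltrDl.
rewrite -e2; apply: (side (-1) 1); rewrite ?e2 ?e2' ?e1 //.
move=> x xd; rewrite !mul1r mulN1r subr_gt0 -[X in X < _]h0; apply: hm => //.
  exact: tl.
by case/andP: xd => x0 _; rewrite gtrBl.
Unshelve. all: by end_near. Qed.

End SimpleClosed.

(** * Regularity of parametrizations in one chart *)

Section LocalCharts.
Context {R : realType} (S : smoothSurface R).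
Implicit Types (p q : S) (c : chart R S) (g : R -> S) (t : R).

Lemma chart_image_open c (O : set S) : open O -> open (c @` (dom c `&` O)).
Proof.
move=> oO; rewrite openE => _ [q [cq Oq] <-].
have nO : nbhs q O by exact: open_nbhs_nbhs.
apply: (@filterS _ (nbhs (c q)) _ _ _ _ (near_chart cq nO)).
by move=> z [zc cz Oz]; exists (of_plane c z) => //; exact: of_planeK.
Qed.

Lemma transition_diff_neq0 p c c' (w : plane R) : chart_at p c ->
  chart_at p c' -> w != 0 -> 'd (transition c c') (c p) w != 0.
Proof.
move=> pc pc'; apply: contra => /eqP d0.
have e1 := diff_transition w pc pc' pc.
have e2 := diff_transition_id w pc.
have e3 : 'd (transition c' c) (c' p) 0 = 0 by exact: linear0.
apply/eqP; apply: (etrans (esym e2)); apply: (etrans (esym e1)).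
exact: (etrans (congr1 _ d0) e3).
Qed.

Lemma derive1_comp_diff (V W : normedModType R) (T : V -> W) (Z : R -> V) t :
  differentiable T (Z t) -> derivable Z t 1 ->
  derivable (T \o Z) t 1 /\ derive1 (T \o Z) t = 'd T (Z t) (derive1 Z t).
Proof.
move=> dT /derivable1_diffP dZ.
have dTZ : differentiable (T \o Z) t by exact: differentiable_comp.
have e : 'd (T \o Z) t 1 = 'd T (Z t) ('d Z t 1).
  by have /(congr1 (fun u => u 1)) := diff_comp dZ dT.
split; first exact/derivable1_diffP.
by rewrite (derive1E' dTZ) (derive1E' dZ).
Qed.

(** It suffices to check the differentiability in one chart around each point:
    in another chart, the derivative is multiplied by the differential of the
    transition, which is invertible and jointly continuous. *)
Lemma C1_param_local g : simple_closed g ->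
  (forall t, exists c, [/\ chart_at (g t) c,
     \forall s \near t, derivable (c \o g) s 1,
     {for t, continuous (derive1 (c \o g))} & derive1 (c \o g) t <> 0]) ->
  C1_param g.
Proof.
move=> [cg gi] gl; split=> // t c' pc'.
have [c [pc nd cd d0]] := gl t.
pose U := c @` (dom c `&` dom c'); pose T := transition c c'.
have oU : open U by apply: chart_image_open; exact: dom_open.
have [/(_ 1%N) C1 _] := atlas_compatible pc.1 pc'.1.
have nU : \forall s \near t, dom c (g s) /\ dom c' (g s).
  apply: (@filterI _ (nbhs t)); first exact: (cg t _ (dom_nbhs pc.2)).
  exact: (cg t _ (dom_nbhs pc'.2)).
have loc s : derivable (c \o g) s 1 -> dom c (g s) -> dom c' (g s) ->
    (\forall x \near s, (T \o (c \o g)) x = (c' \o g) x) ->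
    derivable (c' \o g) s 1 /\
    derive1 (c' \o g) s = 'd T (c (g s)) (derive1 (c \o g) s).
  move=> ds cs cs' eqs.
  have dT : differentiable T (c (g s)) by apply: C1.1; exists (g s).
  have [d1 d2] := @derive1_comp_diff _ _ T (c \o g) s dT ds.
  split; first exact: near_eq_derivable d1.
  apply: etrans d2; rewrite !derive1E; apply/esym.
  exact: near_eq_derive.
have nE : \forall s \near t, \forall x \near s, (T \o (c \o g)) x = (c' \o g) x.
  have : \forall s \near t, \forall x \near s, dom c (g x).
    exact: (near_join (cg t _ (dom_nbhs pc.2))).
  apply: (@filterS _ (nbhs t)) => s.
  by apply: (@filterS _ (nbhs s)) => x cx; rewrite /= /T transition_val.
have [d1 d2] := loc t (nbhs_singleton nd) pc.2 pc'.2 (nbhs_singleton nE).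
have d3 : 'd T (c (g t)) (derive1 (c \o g) t) <> 0.
  by apply/eqP; exact: (transition_diff_neq0 pc pc' (introN eqP d0)).
split; [exact: d1 | | exact: (eq_ind_r (fun w => w <> 0) d3 d2)].
have jc : (fun s => 'd T (c (g s)) (derive1 (c \o g) s)) @ t
    --> 'd T (c (g t)) (derive1 (c \o g) t).
  have c1 : (fun s => (c (g s), derive1 (c \o g) s)) @ t
      --> (c (g t), derive1 (c \o g) t).
    have cc : {for t, continuous (c \o g)}.
      apply: (@continuous_comp _ _ _ g c); first exact: cg.
      exact: (to_plane_continuous pc.2).
    move=> A [[P Q] /= [Pn Qn] PQA].
    apply: (@filterS2 _ (nbhs t) _ _ _ _ _ (cc _ Pn) (cd _ Qn)) => s Ps Qs.
    exact: (PQA (c (g s), derive1 (c \o g) s)).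
  have Ut : U (c (g t)) by exists (g t) => //; split; [exact: pc.2|exact: pc'.2].
  exact: (cvg_comp _ _ c1 (diff_joint_continuous (w := _) oU C1 Ut)).
rewrite /prop_for /continuous_at.
apply: (eq_ind_r (fun l => _ @ t --> l) _ d2).
apply: cvg_trans jc; apply: near_eq_cvg.
apply: (@filterS3 _ (nbhs t) _ _ _ _ _ _ nd nU nE) => s ds [cs cs'] es.
by have [_ /esym] := loc s ds cs cs' es.
Qed.

Lemma C1_param_of_chart c (Z : R -> plane R) : atlas c ->
  (forall t, (c @` dom c) (Z t)) ->
  (forall t, derivable Z t 1) -> continuous (derive1 Z) ->
  (forall t, derive1 Z t != 0) ->
  (forall s t, Z s = Z t <-> exists k : int, t = s + k%:~R) ->
  C1_param (of_plane c \o Z) /\ c \o (of_plane c \o Z) = Z.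
Proof.
move=> ac cZ dZ cZ' Z0 Zi.
have cE : c \o (of_plane c \o Z) = Z.
  by apply/funext => t /=; rewrite of_planeK.
split=> //; apply: C1_param_local.
  split.
    move=> t; apply: (@continuous_comp _ _ _ Z (of_plane c)).
      by apply: differentiable_continuous; apply/derivable1_diffP.
    exact: of_plane_continuous.
  move=> s t; rewrite -Zi /=; split=> [|-> //].
  by move=> /(congr1 c); rewrite !of_planeK.
move=> t; exists c; rewrite cE; split => //.
- split=> //=; have [q cq <-] := cZ t; by rewrite to_planeK.
- exact: (@nearW _ (nbhs t)).
- exact: cZ'.
- exact/eqP.
Qed.

End LocalCharts.

(** * A C^1 function with prescribed values and slopes *)

Section RealFunctions.
Context {R : realType}.
Implicit Types (x y s t u e : R).

Lemma is_derive_of_bound (f : R -> R) x a :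
  (forall e, 0 < e -> exists2 d, 0 < d &
     forall k, `|k| < d -> `|f (x + k) - f x - k * a| <= e * `|k|) ->
  is_derive x 1 f a.
Proof.
move=> H.
have C : (fun h => h^-1 *: ((f \o shift x) (h *: 1) - f x)) @ (0 : R)^' --> a.
  apply/cvgrPdist_le => e e0; have [d d0 dH] := H e e0.
  near=> k.
  have k0 : k != 0 by near: k; exact: nbhs_dnbhs_neq.
  have kd : `|k| < d by near: k; exact: dnbhs0_lt.
  have := dH k kd; rewrite /= [k *: 1]mulr1 [x + k]addrC distrC => {}dH.
  rewrite -[a in `|a - _|](scalerK k0) -scalerBr normrZ normfV.
  rewrite ler_pdivrMl ?normr_gt0 // mulrC; move: dH.
  by rewrite opprB.
apply: DeriveDef; first by apply/cvg_ex; exists a.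
exact: cvg_lim.
Unshelve. all: by end_near. Qed.

(** The C^1 truncated square, from which bumps and steps are built. *)
Definition pos2 u : R := Num.max 0 u ^+ 2.

Lemma pos2_ge0 u : 0 <= pos2 u.
Proof. exact: sqr_ge0. Qed.

Lemma max0_cvg : continuous (fun u : R => Num.max 0 u).
Proof. by move=> u; apply: continuous_max; [exact: cst_continuous | move=> A]. Qed.

Lemma is_derive_pos2 u : is_derive u 1 pos2 (2 * Num.max 0 u).
Proof.
apply: is_derive_of_bound => e e0; exists e => // k ke.
apply: (@le_trans _ _ (`|k| * `|k|)); last by rewrite ler_wpM2r // ltW.
rewrite -normrM -expr2 [leRHS]ger0_norm ?sqr_ge0 // ler_norml /pos2.
have [u0|u0] := leP 0 u; have [uk|uk] := leP 0 (u + k); nra.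
Qed.

Lemma pos2_eq0 u : u <= 0 -> pos2 u = 0.
Proof. by move=> u0; rewrite /pos2 max_l // expr0n. Qed.

End RealFunctions.

Section Interpolation.
Context {R : realType}.
Implicit Types (x y s t u e : R).

(** A C^1 bump supported by [-1, 1], with value 1 and slope 0 at 0. *)
Let phi u : R := pos2 (1 - u ^+ 2).
Let phi' u : R := 2 * Num.max 0 (1 - u ^+ 2) * (- (2 * u)).

Let is_derive_1sq u : is_derive u 1 (fun u => 1 - u ^+ 2) (- (2 * u)).
Proof.
apply: is_derive_of_bound => e e0; exists e => // k ke.
have -> : 1 - (u + k) ^+ 2 - (1 - u ^+ 2) - k * - (2 * u) = - (k * k) by ring.
by rewrite normrN normrM ler_wpM2r // ltW.
Qed.

Let is_derive_phi u : is_derive u 1 phi (phi' u).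
Proof.
have d1 := is_derive_1sq u.
have d2 := is_derive_pos2 (1 - u ^+ 2).
exact: (@is_derive1_comp _ pos2 (fun u => 1 - u ^+ 2) u _ _ d2 d1).
Qed.

Let phi_out u : 1 <= `|u| -> phi u = 0 /\ phi' u = 0.
Proof.
move=> u1; have u2 : 1 - u ^+ 2 <= 0.
  by rewrite subr_le0 -[u ^+ 2]real_normK ?num_real// -[1](expr1n _ 2) lerXn2r // nnegrE.
by rewrite /phi /phi' pos2_eq0 // max_l // mulr0 mul0r.
Qed.

Let phi_in u : `|u| <= 1 -> `|phi u| <= 1 /\ `|phi' u| <= 4.
Proof.
rewrite /phi /phi' /pos2 !ler_norml => /andP[u1 u2].
have [|] := leP 0 (1 - u ^+ 2) => H; split; apply/andP; split; nra.
Qed.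

Let phi0 : phi 0 = 1 /\ phi' 0 = 0.
Proof.
by rewrite /phi /phi' /pos2 expr0n subr0 max_r ?ler01 // expr1n !mulr0 oppr0 mulr0.
Qed.

Let is_derive_affine a s x0 x : is_derive x 1 (fun x => a + s * (x - x0)) s.
Proof.
apply: is_derive_of_bound => e e0; exists e => // k ke.
have -> : a + s * (x + k - x0) - (a + s * (x - x0)) - k * s = 0 by ring.
by rewrite normr0 mulr_ge0 // ltW.
Qed.

(** For z = (x0, y, s): a bump of half-width x0 / 4 around x0 whose value and slope
    at x0 are y and s. *)
Let bump (z : R * R * R) x : R :=
  let: (x0, y, s) := z in (y + s * (x - x0)) * phi (0 + 4 / x0 * (x - x0)).

Let bump' (z : R * R * R) x : R :=
  let: (x0, y, s) := z in
  (y + s * (x - x0)) * (phi' (0 + 4 / x0 * (x - x0)) * (4 / x0)) +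
  phi (0 + 4 / x0 * (x - x0)) * s.

Let is_derive_bump z x : is_derive x 1 (bump z) (bump' z x).
Proof.
case: z => -[x0 y] s.
have d1 := is_derive_affine y s x0 x.
have d2 := is_derive_affine 0 (4 / x0) x0 x.
have d3 := @is_derive1_comp _ phi _ x _ _ (is_derive_phi _) d2.
exact: (is_deriveM d1 d3).
Qed.

Lemma continuous_of_derive (f f' : R -> R) :
  (forall x, is_derive x 1 f (f' x)) -> continuous f.
Proof.
move=> df x; apply: differentiable_continuous; apply/derivable1_diffP.
exact: (@ex_derive _ _ _ _ _ _ _ (df x)).
Qed.

Let continuous_bump' z : continuous (bump' z).
Proof.
case: z => -[x0 y] s x.
have ca a b : continuous (fun x => a + b * (x - x0)).
  exact: (continuous_of_derive (is_derive_affine a b x0)).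
have cp : continuous phi := continuous_of_derive is_derive_phi.
have cp' : continuous phi'.
  move=> u; apply: (@cvgM _ _ _ _ (fun u => 2 * Num.max 0 (1 - u ^+ 2))).
    apply: (@cvgM _ _ _ _ (cst 2)); first exact: cvg_cst.
    apply: (@continuous_comp _ _ _ (fun u => 1 - u ^+ 2)); last exact: max0_cvg.
    exact: (continuous_of_derive is_derive_1sq).
  have d2 t : is_derive t 1 (fun u => - (2 * u)) (- 2 : R).
    apply: is_derive_of_bound => e e0; exists e => // k ke.
    have -> : - (2 * (t + k)) - - (2 * t) - k * - 2 = 0 by ring.
    by rewrite normr0 mulr_ge0 // ltW.
  exact: (continuous_of_derive d2).
pose w x := 0 + 4 / x0 * (x - x0).
have c1 : {for x, continuous (phi \o w)}.
  by apply: continuous_comp; [exact: ca|exact: cp].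
have c2 : {for x, continuous (phi' \o w)}.
  by apply: continuous_comp; [exact: ca|exact: cp'].
apply: (@cvgD _ _ _ _ _ (fun x => (y + s * (x - x0)) * ((phi' \o w) x * (4 / x0)))
   (fun x => (phi \o w) x * s)).
  apply: cvgM; first exact: ca.
  by apply: cvgM => //; exact: cvg_cst.
by apply: cvgM => //; exact: cvg_cst.
Qed.

Let supp (z : R * R * R) : set R :=
  [set x | 3 / 4 * z.1.1 < x < 5 / 4 * z.1.1].

Let bump_out z x : 0 < z.1.1 -> ~ supp z x -> bump z x = 0 /\ bump' z x = 0.
Proof.
case: z => -[x0 y] s; rewrite /supp /= => x00 nx.
have [|p1 p2] := @phi_out (0 + 4 / x0 * (x - x0)).
  rewrite add0r leNgt; apply/negP => H; apply: nx.
  move: H; rewrite mulrAC normrM normfV (gtr0_norm x00) ltr_pdivrMr // mul1r.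
  rewrite ltr_norml => /andP[h1 h2]; apply/andP; split; lra.
by rewrite p1 p2 mul0r !mulr0 mul0r addr0.
Qed.

Let bump_in z x e : 0 < z.1.1 -> supp z x -> `|z.1.2| <= e * z.1.1 ->
  `|z.2| <= e -> `|bump z x| <= 2 * e * x /\ `|bump' z x| <= 21 * e.
Proof.
case: z => -[x0 y] s; rewrite /supp /= => x00 /andP[x1 x2] ye se.
have e0 : 0 <= e by exact: le_trans se.
have [|p1 p2] := @phi_in (0 + 4 / x0 * (x - x0)).
  rewrite add0r mulrAC normrM normfV (gtr0_norm x00) ler_pdivrMr // mul1r.
  rewrite ler_norml; apply/andP; split; lra.
have q : `|y + s * (x - x0)| <= 5 / 4 * e * x0.
  have -> : 5 / 4 * e * x0 = e * x0 + e * (x0 / 4) by field.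
  apply: (le_trans (ler_normD _ _)); apply: lerD => //.
  rewrite normrM ler_pM //.
  by rewrite ler_norml; apply/andP; split; lra.
split.
  rewrite normrM; apply: (@le_trans _ _ (5 / 4 * e * x0 * 1)).
    by apply: ler_pM.
  by nra.
apply: (le_trans (ler_normD _ _)).
have -> : 21 * e = 5 / 4 * e * x0 * (4 * (4 / x0)) + 1 * e.
  by field; rewrite gt_eqF.
apply: lerD; rewrite normrM; apply: ler_pM => //.
rewrite normrM; apply: ler_pM => //.
by rewrite gtr0_norm // divr_gt0.
Qed.

Let bump_at z : 0 < z.1.1 ->
  [/\ supp z z.1.1, bump z z.1.1 = z.1.2 & bump' z z.1.1 = z.2].
Proof.
case: z => -[x0 y] s /= x00; have [p1 p2] := phi0; split.
- by rewrite /supp /=; apply/andP; split; lra.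
- by rewrite subrr !mulr0 !addr0 p1 mulr1.
- by rewrite subrr !mulr0 !addr0 p1 p2 mul0r mulr0 add0r mul1r.
Qed.

(** Points are chosen inductively, each closer to 0 than half of the preceding
    one, with the parity of the index deciding between the two families. The
    bumps at these points have disjoint supports, each of length comparable to
    its distance to 0, so that the prescribed values, small compared to this
    distance, and the prescribed slopes, small as well, control the sum and its
    derivative. *)
Lemma C1_interpolation (P : bool -> set (R * R * R)) :
  (forall b e, 0 < e -> exists2 z, P b z &
     [/\ 0 < z.1.1, z.1.1 < e, `|z.1.2| <= e * z.1.1 & `|z.2| <= e]) ->
  exists h h' : R -> R, [/\ forall x, is_derive x 1 h (h' x), continuous h',
    h 0 = 0, h' 0 = 0 &
    forall b e, 0 < e -> exists2 z, P b z &
      [/\ 0 < z.1.1, z.1.1 < e, h z.1.1 = z.1.2 & h' z.1.1 = z.2]].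
Proof.
move=> freq.
have [F FP] : {F : nat -> R -> R * R * R & forall n e, 0 < e ->
    P (odd n) (F n e) /\ [/\ 0 < (F n e).1.1, (F n e).1.1 < e,
     `|(F n e).1.2| <= e * (F n e).1.1 & `|(F n e).2| <= e]}.
  have [F FP] : {F : nat * R -> R * R * R & forall ne, 0 < ne.2 ->
    P (odd ne.1) (F ne) /\ [/\ 0 < (F ne).1.1, (F ne).1.1 < ne.2,
     `|(F ne).1.2| <= ne.2 * (F ne).1.1 & `|(F ne).2| <= ne.2]}.
    apply: (@choice _ _ (fun (ne : nat * R) z => 0 < ne.2 -> P (odd ne.1) z /\
      [/\ 0 < z.1.1, z.1.1 < ne.2, `|z.1.2| <= ne.2 * z.1.1 & `|z.2| <= ne.2])).
    move=> [n e] /=; have [e0|e0] := pselect (0 < e); last by exists 0.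
    by have [z Pz Hz] := freq (odd n) e e0; exists z.
  by exists (fun n e => F (n, e)) => n e e0; exact: (FP (n, e)).
(* The bound of the next point: half of the current one, for the supports to
   be disjoint, and at most 1 / (n + 2), for the points to tend to 0. *)
pose step n (ez : R * (R * R * R)) :=
  let e := Num.min (ez.2.1.1 / 2) (n.+2%:R^-1) in (e, F n.+1 e).
pose z_ := fix z_ n : R * (R * R * R) :=
  if n is n'.+1 then step n' (z_ n') else (1, F 0%N 1).
pose e_ n := (z_ n).1; pose z n := (z_ n).2; pose x_ n := (z n).1.1.
have zE n : z n = F n (e_ n) by case: n.
have e_gt0 n : 0 < e_ n.
  elim: n => [|n IH]; first exact: ltr01.
  rewrite /e_ /= lt_min invr_gt0 ltr0n andbT divr_gt0 //.
  by have [_ []] := FP n _ IH; rewrite -zE.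
have zP n : P (odd n) (z n) /\ [/\ 0 < x_ n, x_ n < e_ n,
    `|(z n).1.2| <= e_ n * x_ n & `|(z n).2| <= e_ n].
  by rewrite /x_ zE; exact: FP.
have x_gt0 n : 0 < x_ n by have [_ []] := zP n.
have e_half n : e_ n.+1 <= x_ n / 2 by rewrite /e_ /= ge_min lexx.
have e_inv n : e_ n <= n.+1%:R^-1.
  by case: n => [|n]; [rewrite invr1 | rewrite /e_ /= ge_min lexx orbT].
have x_half n : x_ n.+1 < x_ n / 2.
  by have [_ [_ H _ _]] := zP n.+1; exact: lt_le_trans (e_half n).
have x_dist m n : (m < n)%N -> x_ n < x_ m / 2.
  elim: n => // n IH; rewrite ltnS leq_eqVlt => /orP[/eqP->|/IH H]; first exact: x_half.
  have := x_half n; have := x_gt0 n; lra.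
have x_anti m n : (m <= n)%N -> x_ n <= x_ m.
  rewrite leq_eqVlt => /orP[/eqP->//|/x_dist H].
  have := x_gt0 m; lra.
have e_anti m n : (m < n)%N -> e_ n <= e_ m.
  elim: n => // n IH; rewrite ltnS leq_eqVlt => /orP[/eqP->|/IH H].
    have [_ [_ H _ _]] := zP n; have := e_half n; have := x_gt0 n; lra.
  have [_ [_ H' _ _]] := zP n; have := e_half n; have := x_gt0 n; lra.
pose ka x := xget 0%N [set n | supp (z n) x].
pose h x := bump (z (ka x)) x.
pose h' x := bump' (z (ka x)) x.
have supp_uniq n m x : 2 / 3 * x_ n < x < 4 / 3 * x_ n -> supp (z m) x -> m = n.
  move=> /andP[n1 n2] /andP[]; rewrite -/(x_ m) => m1 m2.
  have [mn|nm|//] := ltngtP m n.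
    have H := x_dist _ _ mn; exfalso; clear mn; lra.
  have H := x_dist _ _ nm; exfalso; clear nm; lra.
have h_none x : (forall n, ~ supp (z n) x) -> h x = 0 /\ h' x = 0.
  by move=> no; exact: (bump_out (x_gt0 _) (no _)).
have h_thick n x : 2 / 3 * x_ n < x < 4 / 3 * x_ n ->
    h x = bump (z n) x /\ h' x = bump' (z n) x.
  move=> nx; have [sn|nsn] := pselect (exists m, supp (z m) x).
    have [m sm] := sn; have kx : ka x = n.
      rewrite /ka; case: xgetP => [k _ sk|/(_ m)//].
      exact: (supp_uniq n k x).
    by rewrite /h /h' kx.
  have [|-> ->] := h_none x; first by move=> m sm; apply: nsn; exists m.
  have [|-> ->//] := bump_out (x_gt0 n) (x := x).
  by move=> sm; apply: nsn; exists n.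
have loc x0 : x0 != 0 -> exists G G' : R -> R,
    [/\ forall x, is_derive x 1 G (G' x), continuous G' &
        \forall x \near x0, h x = G x /\ h' x = G' x].
  move=> x00; have [neg|pos] := ltP x0 0.
    exists (cst (0 : R)), (cst (0 : R)).
    split; [by move=> x; exact: is_derive_cst|exact: cst_continuous|].
    near=> x; apply: h_none => n /andP[]; rewrite -/(x_ n) => s1 _.
    have : x < 0 by near: x; exact: lt_nbhsl.
    have := x_gt0 n; lra.
  have {x00 pos} pos : 0 < x0 by rewrite lt_neqAle eq_sym x00.
  have [[n nx]|no] := pselect (exists n, 2 / 3 * x_ n < x0 < 4 / 3 * x_ n).
    exists (bump (z n)), (bump' (z n)); split.
    - exact: is_derive_bump.
    - exact: continuous_bump'.
    have /andP[n1 n2] := nx.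
    near=> x; apply: h_thick; apply/andP; split.
      by near: x; exact: lt_nbhsr.
    by near: x; exact: lt_nbhsl.
  exists (cst (0 : R)), (cst (0 : R)).
  split; [by move=> x; exact: is_derive_cst|exact: cst_continuous|].
  near=> x; apply: h_none => n /andP[]; rewrite -/(x_ n) => s1 s2; apply: no.
  exists n.
  have q1 : 19 / 20 * x0 < x by near: x; apply: lt_nbhsr; lra.
  have q2 : x < 21 / 20 * x0 by near: x; apply: lt_nbhsl; lra.
  by apply/andP; split; lra.
have small e : 0 < e -> exists2 d, 0 < d & forall x, `|x| < d ->
    `|h x| <= 2 * e * `|x| /\ `|h' x| <= 21 * e.
  move=> e0; have [K Ke] : exists K : nat, e_ K <= e.
    exists (Num.truncn e^-1); apply: (le_trans (e_inv _)).
    rewrite invf_ple ?posrE // ltW //.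
    have : 0 <= e^-1 by rewrite invr_ge0 ltW.
    by move=> /truncn_itv /andP[].
  exists (3 / 4 * x_ K); first by have := x_gt0 K; lra.
  move=> x xK; have [[n sn]|no] := pselect (exists n, supp (z n) x); last first.
    have [|-> ->] := h_none x; first by move=> n sn; apply: no; exists n.
    by rewrite normr0 mulr_ge0 // mulr_ge0 // ltW.
  have /andP[] := sn; rewrite -/(x_ n) => s1 s2.
  have x0 : 0 < x by have := x_gt0 n; lra.
  have nK : (K < n)%N.
    rewrite ltnNge; apply/negP => /x_anti.
    by move: xK; rewrite gtr0_norm //; lra.
  have [|-> ->] := h_thick n x; first by clear nK; apply/andP; split; have := x_gt0 n; lra.
  have [_ [_ _ y1 y2]] := zP n.
  have en : e_ n <= e := le_trans (e_anti _ _ nK) Ke.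
  have ye : `|(z n).1.2| <= e * x_ n by apply: (le_trans y1); rewrite ler_pM2r.
  by rewrite (gtr0_norm x0); exact: (bump_in (x_gt0 n) sn ye (le_trans y2 en)).
have h00 : h 0 = 0 /\ h' 0 = 0.
  by apply: h_none => n /andP[]; rewrite -/(x_ n); have := x_gt0 n; lra.
exists h, h'; split.
- move=> x; have [->|x0] := eqVneq x 0.
    rewrite h00.2; apply: is_derive_of_bound => e e0.
    have [|d d0 dP] := small (e / 2); first by rewrite divr_gt0.
    exists d => // k /dP[+ _]; rewrite add0r h00.1 subr0 mulr0 subr0.
    by have -> : 2 * (e / 2) = e by field.
  have [G [G' [dG _ nG]]] := loc x x0.
  have [_ ->] := nbhs_singleton nG.
  apply: near_eq_is_derive (dG x).
  by apply: (@filterS _ (nbhs x) _ _ _ _ nG) => y [].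
- move=> x; have [->|x0] := eqVneq x 0.
    apply/cvgrPdist_le => e e0; rewrite h00.2.
    have [|d d0 dP] := small (e / 21); first by rewrite divr_gt0.
    have n0 := near_normC (0 : R) d0.
    apply: (@filterS _ (nbhs (0 : R)) _ _ _ _ n0) => y /=.
    rewrite subr0 => /dP[_]; rewrite sub0r normrN.
    by have -> : 21 * (e / 21) = e by field.
  have [G [G' [_ cG nG]]] := loc x x0.
  have [_ E] := nbhs_singleton nG.
  rewrite /prop_for /continuous_at E; apply: cvg_trans (cG x).
  apply: near_eq_cvg.
  by apply: (@filterS _ (nbhs x) _ _ _ _ nG) => y [].
- exact: h00.1.
- exact: h00.2.
- move=> b e e0.
  (* An index of parity b beyond e^-1. *)
  pose n := ((Num.truncn e^-1).*2 + b)%N.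
  have on : odd n = b by rewrite /n oddD odd_double /= oddb.
  exists (z n); first by rewrite -on; exact: (zP n).1.
  have [b1 b2 b3] := bump_at (x_gt0 n).
  have xn := x_gt0 n.
  have [|h1 h2] := h_thick n (x_ n); first by apply/andP; split; lra.
  split=> //; [|by rewrite h1|by rewrite h2].
  have [_ [_ H _ _]] := zP n; apply: (lt_le_trans H).
  apply: (le_trans (e_inv n)); rewrite invf_ple ?posrE // ltW //.
  have /truncn_itv /andP[_ H2] : 0 <= e^-1 by rewrite invr_ge0 ltW.
  by apply: (lt_le_trans H2); rewrite ler_nat /n; lia.
Unshelve. all: by end_near. Qed.

End Interpolation.

(** * Closed curves containing the graph of a function *)

Section ClosedModel.
Context {R : realType}.
Implicit Types (s t x y : R).

Let tau : R := pi *+ 2.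

Lemma cos_eq1 t : cos t = 1 -> exists k : int, t = tau * k%:~R.
Proof.
have tau0 : 0 < tau by rewrite pmulrn_lgt0 // pi_gt0.
move=> ct; exists (Num.floor (t / tau)).
set k := Num.floor _; pose u := t - tau * k%:~R.
have per (f : R -> R) : periodic f tau -> forall (n : int) a, f (a + tau * n%:~R) = f a.
  move=> pf [n|n] a; first by rewrite mulr_natr periodicn.
  rewrite NegzE intrN mulrN mulr_natr.
  have := periodicn pf n.+1 (a - tau *+ n.+1); rewrite subrK => ->.
  by [].
have cu : cos u = 1.
  have := per cos (@cosD2pi R) (- k) t.
  by rewrite intrN mulrN -/u ct.
have u0 : 0 <= u.
  have := floor_le (t / tau); rewrite ler_pdivlMr // mulrC => H.
  by rewrite subr_ge0.
have u1 : u < tau.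
  have := floorD1_gt (t / tau); rewrite ltr_pdivrMr // mulrC intrD mulrDr mulr1 => H.
  by rewrite ltrBlDl.
have pi0 : 0 <= pi :> R := pi_ge0 R.
suff : u = 0 by move/eqP; rewrite subr_eq0 => /eqP.
have [up|up] := leP u pi.
  by apply: (@cos_inj R); rewrite ?in_itv /= ?u0 ?lexx ?pi0 // cos0.
have tp : tau = pi + pi by rewrite /tau mulr2n.
have : tau - u = 0.
  apply: (@cos_inj R); rewrite ?in_itv /= ?lexx ?pi0 //.
    by apply/andP; split; lra.
  rewrite cos0 -cosN opprB -cu.
  by have := per cos (@cosD2pi R) (-1) u; rewrite mulrN1z mulrN mulr1.
lra.
Qed.

(** The D-shaped closed curve (X r, Y r): it moves along the first axis as
    long as the cosine exceeds 1/2, and returns above it. *)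
Let X r t : R := r * sin (tau * t).
Let Y r t : R := r * pos2 (1/2 - cos (tau * t)).
Let X' r t : R := r * (tau * cos (tau * t)).
Let Y' r t : R :=
  r * (2 * Num.max 0 (1/2 - cos (tau * t)) * (tau * sin (tau * t))).

Let is_derive_tau t : is_derive t 1 (fun t => tau * t) tau.
Proof.
apply: is_derive_of_bound => e e0; exists e => // k ke.
have -> : tau * (t + k) - tau * t - k * tau = 0 by ring.
by rewrite normr0 mulr_ge0 // ltW.
Qed.

Let is_derive_X r t : is_derive t 1 (X r) (X' r t).
Proof.
have d1 := is_derive1_comp (is_derive_sin (tau * t)) (is_derive_tau t).
by apply: (@is_derive_eq _ _ _ (X r) t 1 _ _ (is_deriveZ r d1)); rewrite /GRing.scale /= /X' [cos _ * _]mulrC.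
Qed.

Let is_derive_half_cos t :
  is_derive t 1 (fun t => 1/2 - cos (tau * t)) (tau * sin (tau * t)).
Proof.
have d1 := is_derive1_comp (is_derive_cos (tau * t)) (is_derive_tau t).
apply: (@is_derive_eq _ _ _ (fun t => 1/2 - cos (tau * t)) t 1 _ _
  (is_deriveB (is_derive_cst (1/2 : R) t 1) d1)).
by rewrite sub0r mulNr opprK mulrC.
Qed.

Let is_derive_Y r t : is_derive t 1 (Y r) (Y' r t).
Proof.
have d3 := @is_derive1_comp R pos2 (fun t => 1/2 - cos (tau * t)) t _ _
  (is_derive_pos2 _) (is_derive_half_cos t).
by apply: (@is_derive_eq _ _ _ (Y r) t 1 _ _ (is_deriveZ r d3)); rewrite /GRing.scale /= /Y'.
Qed.

Lemma derive1_of_quotient (V : normedModType R) (f : R -> V) t (a : V) :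
  (fun h => h^-1 *: (f (t + h) - f t)) @ (0 : R)^' --> a ->
  derivable f t 1 /\ derive1 f t = a.
Proof.
have -> : (fun h => h^-1 *: (f (t + h) - f t)) =
    (fun h => h^-1 *: ((f \o shift t) (h *: 1) - f t)).
  by apply/funext => h /=; rewrite [h *: 1]mulr1 [t + h]addrC.
move=> C; split; first by apply/cvg_ex; exists a.
by rewrite derive1E; exact: cvg_lim.
Qed.

Definition perp (v : plane R) : plane R := (- v.2, v.1).

Let is_derive_quotient (f : R -> R) t a : is_derive t 1 f a ->
  (fun h => h^-1 *: (f (t + h) - f t)) @ (0 : R)^' --> a.
Proof.
move=> df; have d1 : derivable f t 1 by exact: ex_derive.
have := derive1_quotient d1.
by rewrite derive1E (@derive_val _ _ _ _ _ _ _ df).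
Qed.

Lemma derive1_combination (z v w : plane R) (a b : R -> R) t a' b' :
  is_derive t 1 a a' -> is_derive t 1 b b' ->
  derivable (fun t => z + a t *: v + b t *: w) t 1 /\
  derive1 (fun t => z + a t *: v + b t *: w) t = a' *: v + b' *: w.
Proof.
move=> /is_derive_quotient da /is_derive_quotient db.
apply: derive1_of_quotient.
have -> : (fun h => h^-1 *: (z + a (t + h) *: v + b (t + h) *: w -
      (z + a t *: v + b t *: w))) =
    (fun h => (h^-1 *: (a (t + h) - a t)) *: v + (h^-1 *: (b (t + h) - b t)) *: w).
  apply/funext => h; rewrite -[(h^-1 *: _) *: v]scalerA -[(h^-1 *: _) *: w]scalerA.
  have alg (V : zmodType) (y A B A' B' : V) :
      y + A + B - (y + A' + B') = (A - A') + (B - B').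
    by rewrite -[y + A + B]addrA -[y + A' + B']addrA opprD addrACA subrr add0r
      opprD addrACA.
  by rewrite alg -!scalerBl scalerDr.
by apply: cvgD; apply: cvgZr_tmp.
Qed.

Let coords (v : plane R) x y : dot v (x *: v + y *: perp v) = x * dot v v /\
  det v (x *: v + y *: perp v) = y * dot v v.
Proof. by case: v => v1 v2; rewrite /dot /det /= /GRing.scale /=; split; ring. Qed.

Lemma frame_inj (v : plane R) x y x' y' : v != 0 ->
  x *: v + y *: perp v = x' *: v + y' *: perp v -> x = x' /\ y = y'.
Proof.
move=> v0 E; have vv := plane_neq0 v0.
have [d1 d2] := coords v x y; have [d1' d2'] := coords v x' y'.
split; apply: (@mulIf _ (dot v v)); rewrite ?gt_eqF //.
  by rewrite -d1 -d1' E.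
by rewrite -d2 -d2' E.
Qed.

Lemma frame_decompose (v u : plane R) : v != 0 ->
  u = (dot v u / dot v v) *: v + (det v u / dot v v) *: perp v.
Proof.
move=> v0; have vv := plane_neq0 v0.
have := gt_eqF vv; case: v u {v0 vv} => [v1 v2] [u1 u2].
rewrite /dot /det /= => /negbT vv.
by congr (_, _); rewrite /= /GRing.scale /=; field.
Qed.

Let tau_gt0 : 0 < tau.
Proof. by rewrite pmulrn_lgt0 // pi_gt0. Qed.

(** The abscissa determines the sine, hence the cosine up to sign; the ordinate
    decides the sign, since it decreases in the cosine until it vanishes, and
    two opposite cosines are not both at least 1/2. *)
Let model_inj r s t : 0 < r -> X r s = X r t -> Y r s = Y r t ->
  exists k : int, t = s + k%:~R.
Proof.
move=> r0 /(mulfI (lt0r_neq0 r0)) sE /(mulfI (lt0r_neq0 r0)) yE.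
have cE : cos (tau * s) = cos (tau * t).
  have : cos (tau * s) ^+ 2 = cos (tau * t) ^+ 2 by rewrite !cos2sin2 sE.
  move/eqP; rewrite eqf_sqr => /orP[/eqP//|/eqP cE].
  move: yE; rewrite /pos2 cE.
  by have [|] := leP 0 (1/2 - - cos (tau * t));
    have [|] := leP 0 (1/2 - cos (tau * t)); nra.
have /cos_eq1[k kE] : cos (tau * t - tau * s) = 1.
  by rewrite cosB cE sE -!expr2 cos2Dsin2.
exists k; apply: (mulfI (lt0r_neq0 tau_gt0)).
by rewrite mulrDr -kE addrC subrK.
Qed.

Let model_period r s (k : int) : X r (s + k%:~R) = X r s /\
  Y r (s + k%:~R) = Y r s.
Proof.
have per (f : R -> R) : periodic f tau ->
    forall (n : int) a, f (a + tau * n%:~R) = f a.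
  move=> pf [n|n] a; first by rewrite mulr_natr periodicn.
  rewrite NegzE intrN mulrN mulr_natr.
  by have := periodicn pf n.+1 (a - tau *+ n.+1); rewrite subrK => ->.
by rewrite /X /Y mulrDr per ?per //; [exact: cosD2pi|exact: sinD2pi].
Qed.

Let continuous_cos_tau : continuous (fun t => cos (tau * t)).
Proof.
move=> t; apply: (@continuous_comp _ _ _ (fun t => tau * t) cos).
  exact: (continuous_of_derive is_derive_tau).
exact: continuous_cos.
Qed.

Let continuous_sin_tau : continuous (fun t => sin (tau * t)).
Proof.
move=> t; apply: (@continuous_comp _ _ _ (fun t => tau * t) sin).
  exact: (continuous_of_derive is_derive_tau).
exact: continuous_sin.
Qed.

Let continuous_mulC (f : R -> R) a : continuous f -> continuous (fun t => a * f t).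
Proof. by move=> cf t; apply: (@cvgM _ _ _ _ (cst a)); [exact: cvg_cst|exact: cf]. Qed.

Let continuous_X' r : continuous (X' r).
Proof. by do 2!apply: continuous_mulC. Qed.

Let continuous_Y' r : continuous (Y' r).
Proof.
apply: continuous_mulC => t.
apply: (@cvgM _ _ _ _ (fun t => 2 * Num.max 0 (1/2 - cos (tau * t)))).
  apply: (continuous_mulC (f := fun t => Num.max 0 (1/2 - cos (tau * t)))) => x.
  apply: (@continuous_comp _ _ _ (fun t => 1/2 - cos (tau * t))).
    exact: (continuous_of_derive is_derive_half_cos).
  exact: max0_cvg.
by apply: (continuous_mulC (f := fun t => sin (tau * t))).
Qed.

Variable S : smoothSurface R.
Implicit Types (p : S) (c : chart R S) (v w : plane R) (h : R -> R).

(** The closed curve is the shear, by the graph of h, of a small copy of the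
    D-shaped curve (X, Y) whose flat side lies along the line through v. Since
    the shear is a bijection, the curve is simple; on the flat side it runs
    along the graph of h. *)
Lemma graph_curve p c v h (h' : R -> R) : chart_at p c -> v != 0 ->
  (forall x, is_derive x 1 h (h' x)) -> continuous h' -> h 0 = 0 -> h' 0 = 0 ->
  exists g : R -> S, [/\ C1_param g, g 0 = p,
    exists2 a, 0 < a & derive1 (c \o g) 0 = a *: v &
    forall e, 0 < e -> exists2 d, 0 < d & forall x, 0 < x < d ->
      exists t, [/\ 0 < t < e, dom c (g t),
        c (g t) = c p + x *: v + h x *: perp v &
        exists2 a, 0 < a & derive1 (c \o g) t = a *: (v + h' x *: perp v)]].
Proof.
move=> pc v0 dh ch' h0 h'0.
have ch := continuous_of_derive dh.
have nc : nbhs (c p) (c @` dom c).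
  apply: open_nbhs_nbhs; split; first exact: codom_open.
  by exists p => //; exact: pc.2.
have [rho rho0 rhoP] := (nbhs_normC _ _).1 nc.
pose w := perp v; pose M := `|v| + `|w| + 1.
have M0 : 0 < M by rewrite ltr_wpDl // addr_ge0.
(* A size of the copy for which the curve stays in the image of the chart. *)
pose ka := rho / (8 * M).
have ka0 : 0 < ka by rewrite divr_gt0 // mulr_gt0.
have [d d0 dP] := (nbhs_normC _ _).1 (ch 0 _ (near_normC (h 0) ka0)).
pose r := Num.min ka (d / 2).
have r0 : 0 < r by rewrite lt_min ka0 divr_gt0.
have rka : r <= ka by rewrite ge_min lexx.
have rd : r <= d / 2 by rewrite ge_min lexx orbT.
pose Z t := c p + X r t *: v + (Y r t + h (X r t)) *: w.
have Xr t : `|X r t| <= r.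
  by rewrite normrM (gtr0_norm r0) ger_pMr // sin_max.
have Zc t : (c @` dom c) (Z t).
  apply: rhoP; rewrite /Z -[c p + _ + _]addrA [c p + _]addrC addrK.
  have Yr : `|Y r t| <= 3 * r.
    rewrite normrM (gtr0_norm r0) mulrC ler_pM2r // ger0_norm ?pos2_ge0 //.
    rewrite /pos2; have := cos_geN1 (tau * t); have := cos_le1 (tau * t).
    by have [|] := leP 0 (1/2 - cos (tau * t)); nra.
  have hX : `|h (X r t)| <= ka.
    have : `|X r t - 0| < d by rewrite subr0; apply: (le_lt_trans (Xr t)); lra.
    by move/dP; rewrite /= h0 subr0 => /ltW.
  apply: (le_lt_trans (ler_normD _ _)); rewrite [`|_ *: v|]normrZ [`|_ *: w|]normrZ.
  have YhX : `|Y r t + h (X r t)| <= 3 * r + ka.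
    by apply: (le_trans (ler_normD _ _)); exact: lerD.
  apply: (@le_lt_trans _ _ (ka * M + (4 * ka) * M)).
    apply: lerD; apply: ler_pM => //.
    - exact: (le_trans (Xr t) rka).
    - by rewrite /M -addrA lerDl addr_ge0.
    - by apply: (le_trans YhX); lra.
    - by rewrite /M addrAC lerDr addr_ge0.
  have -> : ka * M + 4 * ka * M = 5 / 8 * rho by rewrite /ka; field; rewrite gt_eqF.
  lra.
have db t : is_derive t 1 (fun t => Y r t + h (X r t))
    (Y' r t + h' (X r t) * X' r t).
  have d1 := @is_derive1_comp R h (X r) t _ _ (dh _) (is_derive_X r t).
  exact: (is_deriveD (is_derive_Y r t) d1).
have dZ t := derive1_combination (c p) v w (is_derive_X r t) (db t).
have Z'E t : derive1 Z t = X' r t *: v + (Y' r t + h' (X r t) * X' r t) *: w.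
  exact: (dZ t).2.
have [Cg cE] : C1_param (of_plane c \o Z) /\ c \o (of_plane c \o Z) = Z.
  apply: C1_param_of_chart pc.1 Zc _ _ _ _.
  - by move=> t; exact: (dZ t).1.
  - have -> : derive1 Z = fun t => X' r t *: v + (Y' r t + h' (X r t) * X' r t) *: w.
      by apply/funext.
    move=> t; apply: (@cvgD _ _ _ _ _ (fun t => X' r t *: v)).
      by apply: cvgZr_tmp; exact: continuous_X'.
    apply: cvgZr_tmp; apply: (@cvgD _ _ _ _ _ (Y' r)); first exact: continuous_Y'.
    apply: (@cvgM _ _ _ _ (h' \o X r)); last exact: continuous_X'.
    apply: continuous_comp; last exact: ch'.
    exact: (continuous_of_derive (is_derive_X r)).
  - move=> t; rewrite Z'E; apply/eqP => E.
    have [] := @frame_inj v (X' r t) (Y' r t + h' (X r t) * X' r t) 0 0 v0.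
      by rewrite E !scale0r addr0.
    move=> X0; rewrite X0 mulr0 addr0 => Y0.
    have c0 : cos (tau * t) = 0.
      move/eqP: X0; rewrite /X' !mulf_eq0 (gt_eqF r0) (gt_eqF tau_gt0) /=.
      by move/eqP.
    move: Y0; rewrite /Y' c0 subr0 max_r; last lra.
    move=> {}Y0; have s0 : sin (tau * t) = 0.
      apply: (mulfI (lt0r_neq0 (mulr_gt0 r0 tau_gt0))).
      by rewrite mulr0 -Y0; field.
    have := cos2Dsin2 (tau * t).
    by rewrite c0 s0 expr0n addr0 => /eqP; rewrite eq_sym oner_eq0.
  - move=> s t; split=> [|[k ->]].
      rewrite /Z -!addrA => /addrI /(frame_inj v0)[XE YE].
      by apply: (model_inj r0 XE); move: YE; rewrite XE => /addIr.
    by rewrite /Z; have [-> ->] := model_period r s k.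
have X0 : X r 0 = 0 by rewrite /X mulr0 sin0 mulr0.
have Y0 : Y r 0 = 0.
  by rewrite /Y mulr0 cos0 pos2_eq0 ?mulr0 //; lra.
have X'0 : 0 < X' r 0 by rewrite /X' mulr0 cos0 mulr1 mulr_gt0.
have Y'flat t : 1/2 < cos (tau * t) -> Y r t = 0 /\ Y' r t = 0.
  move=> ct; have c0 : 1/2 - cos (tau * t) <= 0 by lra.
  by rewrite /Y /Y' pos2_eq0 // max_l // !(mulr0, mul0r).
exists (of_plane c \o Z); split=> //.
- by rewrite /= /Z X0 Y0 h0 !addr0 !scale0r !addr0 to_planeK //; exact: pc.2.
- exists (X' r 0) => //; rewrite cE Z'E X0 h'0 mul0r addr0.
  have [|_ ->] := Y'flat 0; first by rewrite mulr0 cos0; lra.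
  by rewrite scale0r addr0.
move=> e e0.
have [d1 d10 d1P] : exists2 d1, 0 < d1 & forall t, `|t| < d1 -> 1/2 < cos (tau * t).
  have q0 : 0 < (1/2 : R) by lra.
  have [d1 d10 d1P] := (nbhs_normC _ _).1 (continuous_cos_tau (near_normC (cos (tau * 0)) q0)).
  exists d1 => // t; have := d1P t; rewrite subr0 => H /H /=.
  by rewrite mulr0 cos0 ltr_norml; lra.
pose b := Num.min (e / 2) (d1 / 2).
have b0 : 0 < b by rewrite lt_min !divr_gt0.
have be : b < e by rewrite gt_min; apply/orP; left; lra.
have bd : b < d1 by rewrite gt_min; apply/orP; right; lra.
have cX : {within `[0, b], continuous (X r)}.
  by apply: continuous_subspaceT; exact: (continuous_of_derive (is_derive_X r)).
have Xb : 0 < X r b.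
  have dX t : derivable (X r) t 1 by have [] := is_derive_X r t.
  have dX' t : derive1 (X r) t = X' r t.
    by rewrite derive1E; have [_ ->] := is_derive_X r t.
  rewrite -X0; apply: (@gtr0_derive1_lt_cc R (X r) 0 b _ _ cX) => //.
  - move=> t; rewrite in_itv /= => /andP[t0 tb].
    rewrite dX' /X'.
    rewrite !mulr_gt0 //; apply: (@lt_trans _ _ (1/2)); first lra.
    by apply: d1P; rewrite gtr0_norm //; exact: lt_trans bd.
  - by rewrite in_itv /= lexx ltW.
  - by rewrite in_itv /= lexx ltW.
exists (X r b) => // x /andP[x0 xb].
have [t] : exists2 t, t \in `[0, b] & X r t = x.
  apply: IVT => //; first exact: ltW.
  by rewrite X0 min_l ?max_r ?ltW // x0 /= ltW.
rewrite in_itv /= => /andP[t0 tb] XE.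
have {}t0 : 0 < t.
  rewrite lt_neqAle t0 andbT eq_sym; apply: contraTneq x0 => tE.
  by rewrite -XE tE X0 ltxx.
have ct : 1/2 < cos (tau * t).
  by apply: d1P; rewrite gtr0_norm //; exact: le_lt_trans bd.
have [Yt Y't] := Y'flat t ct.
exists t; split.
- by rewrite t0 /=; exact: le_lt_trans be.
- by have [q cq <-] := Zc t; rewrite /= to_planeK.
- have -> : c ((of_plane c \o Z) t) = Z t by exact: of_planeK.
  by rewrite /Z XE Yt add0r.
- exists (X' r t).
    by rewrite /X' !mulr_gt0 //; apply: (@lt_trans _ _ (1/2)) => //; lra.
  by rewrite cE Z'E Y't add0r XE scalerDr scalerA mulrC.
Qed.

End ClosedModel.

(** * Curves through prescribed points and directions *)

Section CurveThrough.
Context {R : realType} (S : smoothSurface R).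
Implicit Types (p q : S) (c : chart R S).

Lemma frame_cvg (v : plane R) : v != 0 ->
  (fun b => dot v b / dot v v) @ v --> (1 : R) /\
  (fun b => det v b / dot v v) @ v --> (0 : R).
Proof.
move=> v0; have vv := plane_neq0 v0.
have c1 : (fun b : plane R => b.1) @ v --> v.1 by exact: cvg_fst.
have c2 : (fun b : plane R => b.2) @ v --> v.2 by exact: cvg_snd.
have d1 : dot v @ v --> dot v v.
  by apply: cvgD; apply: cvgM => //; exact: cvg_cst.
have d2 : det v @ v --> det v v.
  by apply: cvgB; apply: cvgM => //; exact: cvg_cst.
have dv : det v v = 0 by rewrite /det mulrC subrr.
split.
  by rewrite -[X in _ --> X](divff (lt0r_neq0 vv)); apply: cvgMl.
by rewrite -[X in _ --> X](mul0r (dot v v)^-1) -dv; apply: cvgMl.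
Qed.

(** In the frame of v and its perpendicular, points in thin cones around v are
    points (x, y) with y small compared to x, and vectors close to v have
    small slopes; the graph of a C^1 function interpolates infinitely many of
    them from both families. *)
Lemma curve_through p c (v : plane R) (A : bool -> set (S * plane R)) :
  chart_at p c -> v != 0 ->
  (forall b e, 0 < e -> exists q w,
     [/\ A b (q, w), sector_set c p v e q & `|w - v| < e]) ->
  exists g : R -> S, [/\ C1_param g, g 0 = p,
    exists2 a, 0 < a & derive1 (c \o g) 0 = a *: v &
    forall b e, 0 < e -> exists t w, [/\ 0 < t < e, A b (g t, w) &
      exists2 a, a != 0 & derive1 (c \o g) t = a *: w]].
Proof.
move=> pc v0 freq.
pose P b : set (R * R * R) := [set z | exists q w a,
  [/\ A b (q, w), dom c q, c q = c p + z.1.1 *: v + z.1.2 *: perp v,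
      a != 0 & w = a *: (v + z.2 *: perp v)]].
have [k1 k2] := frame_cvg v0.
have [|h [h' [dh ch' h0 h'0 hP]]] := @C1_interpolation R P.
  move=> b e e0.
  have n1 : nbhs v [set b | `|dot v b / dot v v - 1| < 1/2].
    by apply: (k1 _ (near_normC (1 : R) _)); lra.
  have n2 : nbhs v [set b | `|det v b / dot v v - 0| < e / 2].
    by apply: (k2 _ (near_normC (0 : R) _)); lra.
  have [r r0 rP] := (nbhs_normC _ _).1 (filterI n1 n2).
  have m0 : 0 < Num.min r (e / 2) by rewrite lt_min r0 divr_gt0.
  have [q [w [Aqw [cq [x [u [/andP[x0 xm] um cqE]]]] wm]]] := freq b _ m0.
  move: xm um wm; rewrite !lt_min => /andP[_ xe] /andP[ur _] /andP[wr _].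
  have [] := rP _ ur; have [] := rP _ wr; rewrite /= !subr0.
  set w1 := dot v w / _; set w2 := det v w / _.
  set u1 := dot v u / _; set u2 := det v u / _.
  rewrite !ltr_norml => /andP[w11 w12] /andP[w21 w22] /andP[u11 u12] /andP[u21 u22].
  have w10 : 0 < w1 by lra.
  exists ((x * u1, x * u2), w2 / w1); last split=> /=.
  - exists q, w, w1; split=> //=.
    + rewrite cqE [in LHS](frame_decompose u v0) -/u1 -/u2 scalerDr !scalerA.
      by rewrite addrA.
    + exact: lt0r_neq0.
    + by rewrite scalerDr scalerA mulrCA divff ?mulr1 ?lt0r_neq0 //; exact: frame_decompose.
  - by rewrite mulr_gt0 //; lra.
  - nra.
  - rewrite normrM (gtr0_norm x0) mulrCA ler_pM2l // ler_norml.
    by apply/andP; split; nra.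
  - rewrite ler_norml ler_pdivrMr // ler_pdivlMr //; apply/andP; split; nra.
have [g [Cg g0 gv gP]] := graph_curve pc v0 dh ch' h0 h'0.
exists g; split=> // b e e0.
have [d d0 dP] := gP e e0.
have [[[x y] s] [q [w [a [Aqw cq cqE a0 wE]]]] /= [x0 xd hx h'x]] := hP b d d0.
have [|t [te ct cgE [a' a'0 tv]]] := dP x; first by rewrite x0.
exists t, w; split=> //.
  suff -> : g t = q by [].
  by rewrite -(to_planeK ct) -(to_planeK cq) cgE cqE /= hx.
exists (a' / a); first by rewrite mulf_neq0 ?invr_neq0 // lt0r_neq0.
by rewrite tv wE scalerA divfK // h'x.
Qed.

Lemma sector_frequent p v c (B : set S) (e : R) : tangent_space p v ->
  chart_at p c -> ~ sector p v (~` B) -> 0 < e ->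
  exists2 q, B q & sector_set c p (v c) e q.
Proof.
move=> tv pc nB e0; apply: contrapT => no; apply: nB.
by apply/(sectorP _ tv pc); exists e => // q sq Bq; apply: no; exists q.
Qed.

(** The prescribed vectors of [curve_through] are all taken equal to v. *)
Lemma curve_through_points p (v : family S) (B : bool -> set S) :
  tangent_space p v -> v <> (fun=> 0) -> (forall b, ~ sector p v (~` B b)) ->
  exists g : R -> S, [/\ C1_param g, g 0 = p,
    exists2 a : R, 0 < a & velocity g 0 = fun c => a *: v c &
    forall b e, 0 < e -> exists t, [/\ 0 < t < e & B b (g t)]].
Proof.
move=> tv v0 nB.
have [c ac cp] := atlas_cover p; have pc : chart_at p c by [].
have [|g [Cg g0 [a a0 ga] gP]] := @curve_through p c (v c)
    (fun b => [set qw | B b qw.1]) pc (tangent_neq0 pc tv v0).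
  move=> b e e0; have [q Bq sq] := sector_frequent tv pc (nB b) e0.
  by exists q, (v c); rewrite subrr normr0.
exists g; split=> //.
  exists a => //; have [tg _] := velocity_tangent 0 Cg; rewrite g0 in tg.
  apply: (tangent_space_inj pc tg); first exact: tangent_spaceZ.
  by rewrite velocityE // g0.
by move=> b e /(gP b)[t [w [te Bt _]]]; exists t.
Qed.

End CurveThrough.

(** * The ray carried by a map *)

Section SectorImage.
Context {R : realType} (S : smoothSurface R).
Implicit Types (p q : S) (v w : family S) (g r : R -> S).

Lemma simple_closed_comp (f : S -> S) g : continuous f -> injective f ->
  simple_closed g -> simple_closed (f \o g).
Proof.
move=> cf fi [cg gi]; split.
  by move=> t; apply: continuous_comp; [exact: cg|exact: cf].
by move=> s t; rewrite -gi; split=> [/fi|/= ->].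
Qed.

(** If f does not carry the sector of v to that of w, a C^1 curve g through p
    passes infinitely often through points whose image avoids some set A of the
    sector of w, and infinitely often through points of r. The image of g is
    C^1, so it leaves q along one ray w', and comparing along the points of r
    gives w' = w up to scale. Then the image of g is eventually in A, a
    contradiction. The last hypothesis says that r returns near p only at small
    times, so that the points of r on g have parameters tending to 0. *)
Lemma sector_image_of_path (f : S -> S) p q v w r : continuous f -> injective f ->
  maps_C1_curves f -> f p = q -> tangent_space p v -> v <> (fun=> 0) ->
  tangent_space q w -> w <> (fun=> 0) ->
  r @ (0 : R)^'+ --> sector p v -> (f \o r) @ (0 : R)^'+ --> sector q w ->
  (forall e : R, 0 < e -> exists2 U, nbhs p U &
     forall x, 0 < x < 1/4 -> U (r x) -> x < e) ->
  f @ sector p v --> sector q w.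
Proof.
move=> cf fi mf fp tv v0 tw w0 rv fw remb A qA; apply: contrapT => nA.
pose B (b : bool) := if b then ~` (f @^-1` A) else r @` [set x | 0 < x < 1/4].
have [|g [Cg g0 [a a0 ga] gB]] := @curve_through_points _ _ p v B tv v0.
  case; first by rewrite /B setCK.
  move=> /rv nB; have : (0 : R)^'+ [set x | False].
    have n4 : (0 : R)^'+ [set x | 0 < x < 1/4].
      near=> x => /=; apply/andP; split; first by near: x; exact: nbhs_right_gt.
      by near: x; apply: nbhs_right_lt; lra.
    by apply: (@filterS2 _ (0 : R)^'+ _ _ _ _ _ nB n4) => x /= + x4; apply; exists x.
  exact: filter_not_empty.
have sg := C1_simple_closed Cg.
have [k Ck kE] : C1_curve (f @` range g) by apply: mf; exists g.
have fgk t : range k (f (g t)) by rewrite -kE; exists (g t) => //; exists t.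
have [s0 _ ks0] := fgk 0.
have [w' [w'E right _]] := simple_closed_sides Ck (simple_closed_comp cf fi sg) fgk ks0.
have {right}right : (f \o g) @ (0 : R)^'+ --> sector q w'.
  have E : (fun x => (f \o g) (0 + x)) = f \o g.
    by apply/funext => x /=; rewrite add0r.
  have E0 : (f \o g) 0 = q by rewrite /= g0.
  by rewrite E E0 in right.
have [tk k0] := velocity_tangent s0 Ck.
rewrite ks0 /= g0 fp in tk.
have tw' : tangent_space q w' by case: w'E => ->; [|exact: tangent_negv].
have w'0 : w' <> (fun=> 0) by case: w'E => ->; [|exact: negv_neq0].
(* The times of g at points of r, and the parameters phi of these points. *)
pose F : set_system R := within [set t | B false (g t)] (0 : R)^'+.
have FF : ProperFilter F.
  apply: Build_ProperFilter_ex => D /= FD.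
  have [e /= e0 eD] : exists2 e : R, 0 < e & forall t, 0 < t < e -> B false (g t) -> D t.
    have := FD; rewrite /F /within /= => /nbhs_normC[e e0 eD]; exists e => // t /andP[t0 te].
    by apply: eD => //; rewrite /= subr0 gtr0_norm.
  by have [t [te Bt]] := gB false e e0; exists t; exact: eD te Bt.
pose phi t := xget 0 [set x | 0 < x < 1/4 /\ r x = g t].
have phiP t : B false (g t) -> 0 < phi t < 1/4 /\ r (phi t) = g t.
  move=> [x x4 rx]; rewrite /phi; case: xgetP => [y _ //|/(_ x)[]].
  by [].
have phi0 : phi @ F --> (0 : R)^'+.
  move=> D; rewrite /at_right /within /= => /nbhs_normC[e e0 eD].
  have [U nU hU] := remb e e0.
  have gU : (0 : R)^'+ (g @^-1` U).
    have c0 : (0 : R)^'+ --> (0 : R) by exact: cvg_within.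
    have nU' : nbhs (g 0) U by rewrite g0.
    exact: (c0 _ (sg.1 0 _ nU')).
  rewrite /F; apply: (@filterS _ (0 : R)^'+ _ _ _ _ gU) => t Ut Bt.
  have [p4 rp] := phiP t Bt; have /andP[p0 _] := p4.
  by apply: eD => //; rewrite subr0 gtr0_norm //; apply: hU => //; rewrite rp.
have F1 : (f \o g) @ F --> sector q w.
  have : (f \o r) \o phi @ F --> sector q w by exact: cvg_comp phi0 fw.
  apply: cvg_trans; apply: near_eq_cvg.
  have nB : F [set t | B false (g t)] by exact: withinT.
  by apply: (@filterS _ F _ _ _ _ nB) => t Bt /=; have [_ ->] := phiP t Bt.
have F2 : (f \o g) @ F --> sector q w'.
  apply: cvg_trans right; apply: cvg_app; exact: cvg_within.
have [b b0 wE] := sector_unique _ tw' tw w'0 w0 F2 F1.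
have qA' : sector q w' A by apply: (sector_scale b0); rewrite -wE.
have := right _ qA' => nfA.
have [e e0 eA] : exists2 e : R, 0 < e & forall t, 0 < t < e -> A (f (g t)).
  have := nfA; rewrite /within /= => /nbhs_normC[e e0 eD]; exists e => // t /andP[t0 te].
  by apply: eD => //; rewrite /= subr0 gtr0_norm.
by have [t [te Bt]] := gB true e e0; apply: Bt; exact: eA.
Unshelve. all: by end_near. Qed.

Lemma curve_with_velocity p v : tangent_space p v -> v <> (fun=> 0) ->
  exists g : R -> S, [/\ C1_param g, g 0 = p &
    exists2 a : R, 0 < a & velocity g 0 = fun c => a *: v c].
Proof.
move=> tv v0.
have [|g [Cg g0 ga _]] := @curve_through_points _ _ p v (fun=> setT) tv v0.
  by move=> _; rewrite setCT => /filter_not_empty.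
by exists g.
Qed.

(** Any C^1 curve with velocity v at p serves as the reference curve, on its two
    sides for v and its opposite. *)
Lemma sector_image (f : S -> S) p q v : continuous f -> injective f ->
  maps_C1_curves f -> f p = q -> tangent_space p v -> v <> (fun=> 0) ->
  exists w, [/\ tangent_space q w, w <> (fun=> 0),
    f @ sector p v --> sector q w & f @ sector p (negv v) --> sector q (negv w)].
Proof.
move=> cf fi mf fp tv v0.
have [g [Cg g0 [a a0 ga]]] := curve_with_velocity tv v0.
have sg := C1_simple_closed Cg.
have [k Ck kE] : C1_curve (f @` range g) by apply: mf; exists g.
have fgk t : range k (f (g t)) by rewrite -kE; exists (g t) => //; exists t.
have [s0 _ ks0] := fgk 0.
have [w [wE right left]] :=
  simple_closed_sides Ck (simple_closed_comp cf fi sg) fgk ks0.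
have E0 : (f \o g) 0 = q by rewrite /= g0.
rewrite E0 in right left.
have [tk k0] := velocity_tangent s0 Ck.
rewrite ks0 /= g0 fp in tk.
have tw : tangent_space q w by case: wE => ->; [|exact: tangent_negv].
have w0 : w <> (fun=> 0) by case: wE => ->; [|exact: negv_neq0].
have emb (b : R) : `|b| = 1 -> forall e : R, 0 < e -> exists2 U, nbhs p U &
     forall x, 0 < x < 1/4 -> U (g (0 + b * x)) -> x < e.
  move=> b1 e e0; have m0 : 0 < Num.min e (1/4) by rewrite lt_min e0; lra.
  have [U nU hU] := simple_closed_embedding 0 sg m0.
  exists U; first by rewrite -g0.
  move=> x /andP[x0 x4] /hU[j]; rewrite add0r subr0 lt_min => /andP[j1 j2].
  have bx : `|b * x| = x by rewrite normrM b1 mul1r gtr0_norm.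
  have j0 : j = 0.
    apply: (@int_small R); rewrite -(addKr (b * x) j%:~R).
    by apply: (le_lt_trans (ler_normD _ _)); rewrite normrN bx; lra.
  by move: j1; rewrite j0 addr0 bx.
have right0 := velocity_right (t := 0) Cg.
have left0 := velocity_left (t := 0) Cg.
have aV : 0 < a^-1 by rewrite invr_gt0.
have sv : sector p (velocity g 0) --> sector p v.
  have := @sector_scale _ _ p (velocity g 0) _ aV.
  suff -> : (fun c => a^-1 *: velocity g 0 c) = v by [].
  by apply/funext => c; rewrite ga scalerK // lt0r_neq0.
have svN : sector p (negv (velocity g 0)) --> sector p (negv v).
  have := @sector_scale _ _ p (negv (velocity g 0)) _ aV.
  suff -> : (fun c => a^-1 *: negv (velocity g 0) c) = negv v by [].
  by apply/funext => c; rewrite /negv ga scalerN scalerK // lt0r_neq0.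
rewrite g0 in right0 left0.
exists w; split=> //.
  apply: (@sector_image_of_path f p q v w (fun x => g (0 + x))) => //.
  - exact: (cvg_trans right0 sv).
  - move=> e /(emb 1)[|U nU hU]; first by rewrite normr1.
    by exists U => // x x4; have := hU x x4; rewrite mul1r.
apply: (@sector_image_of_path f p q (negv v) (negv w) (fun x => g (0 - x))) => //.
- exact: tangent_negv.
- exact: negv_neq0.
- exact: tangent_negv.
- exact: negv_neq0.
- exact: (cvg_trans left0 svN).
- move=> e /(emb (-1))[|U nU hU]; first by rewrite normrN normr1.
  by exists U => // x x4; have := hU x x4; rewrite mulN1r.
Qed.

(** A derivative on lines for maps that need not be differentiable. *)
Definition line_image (f : S -> S) p q (l : PT p) (m : PT q) : Prop :=
  exists v w, [/\ line l v, v <> (fun=> 0), line m w, w <> (fun=> 0) &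
    f @ sector p v --> sector q w /\ f @ sector p (negv v) --> sector q (negv w)].

End SectorImage.

(** * The line carried by a map *)

Section LineImage.
Context {R : realType} (S : smoothSurface R).
Implicit Types (p q : S) (v w : family S) (f : S -> S).

Lemma sector_scaleE p v (a : R) : 0 < a ->
  sector p (fun c => a *: v c) = sector p v.
Proof.
move=> a0; apply/seteqP; split; first exact: sector_scale.
have aV : 0 < a^-1 by rewrite invr_gt0.
have := @sector_scale _ _ p (fun c => a *: v c) _ aV.
suff -> : (fun c => a^-1 *: (a *: v c)) = v by [].
by apply/funext => c; rewrite scalerK // lt0r_neq0.
Qed.

Lemma negvZ v (a : R) : negv (fun c => a *: v c) = fun c => a *: negv v c.
Proof. by apply/funext => c; rewrite /negv scalerN. Qed.

Lemma negv_scale v (a : R) : (fun c => - a *: negv v c) = fun c => a *: v c.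
Proof. by apply/funext => c; rewrite /negv scalerN scaleNr opprK. Qed.

Lemma scale_neq0 v (a : R) (w := fun c => a *: v c) : w <> (fun=> 0) -> a != 0.
Proof.
by move=> w0; apply/eqP => a0; apply: w0; apply/funext => c; rewrite /w a0 scale0r.
Qed.

Lemma line_vector p (l : PT p) :
  exists v, [/\ tangent_space p v, v <> (fun=> 0) & line l v].
Proof.
have [v [tv v0 ->]] := lineP l; exists v; split=> //.
by exists 1; apply/funext => c; rewrite scale1r.
Qed.

Lemma line_scale p (l : PT p) v w : line l v -> v <> (fun=> 0) ->
  line l w -> exists a : R, w = fun c => a *: v c.
Proof. by move=> lv v0; rewrite (line_spanned lv v0). Qed.

Lemma line_eq p (l m : PT p) v : line l v -> line m v -> v <> (fun=> 0) -> l = m.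
Proof.
by move=> lv mv v0; apply: PT_eq; rewrite (line_spanned lv) // (line_spanned mv).
Qed.

Lemma line_negv p (l : PT p) v : line l v -> line l (negv v).
Proof.
have [w [_ _ ->]] := lineP l => -[a ->]; exists (- a).
by apply/funext => c; rewrite /negv scaleNr.
Qed.

Lemma line_through p v : tangent_space p v -> v <> (fun=> 0) ->
  exists l : PT p, line l v.
Proof.
move=> tv v0.
exists (@ProjLine _ _ p (spanned v) (ex_intro _ v (And3 tv v0 erefl))).
by exists 1; apply/funext => c; rewrite scale1r.
Qed.

Lemma line_image_vector f p q (l : PT p) (m : PT q) v :
  line_image f l m -> line l v -> v <> (fun=> 0) ->
  exists w, [/\ line m w, w <> (fun=> 0), f @ sector p v --> sector q w &
    f @ sector p (negv v) --> sector q (negv w)].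
Proof.
move=> [v1 [w [lv1 v10 mw w0 [fv1 fv1N]]]] lv v0.
have [a vE] := line_scale lv1 v10 lv.
have a0 : a != 0 by apply: (@scale_neq0 v1); rewrite -vE.
have [an|ap] := ltrP a 0; last first.
  have {}ap : 0 < a by rewrite lt_neqAle eq_sym a0.
  by exists w; split=> //; rewrite vE ?negvZ sector_scaleE.
have Na : 0 < - a by rewrite oppr_gt0.
exists (negv w); rewrite negvK; split=> //.
- exact: line_negv.
- exact: negv_neq0.
- by rewrite vE -negv_scale sector_scaleE.
- by rewrite vE -negv_scale negvZ sector_scaleE // negvK.
Qed.

Lemma line_image_unique f p q (l : PT p) (m m' : PT q) :
  line_image f l m -> line_image f l m' -> m = m'.
Proof.
move=> lm [v [w' [lv v0 mw' w'0 [fv' _]]]].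
have [w [mw w0 fv _]] := line_image_vector lm lv v0.
have [a a0 wE] := sector_unique _ (line_tangent mw) (line_tangent mw') w0 w'0 fv fv'.
apply: (@line_eq _ _ _ w') => //.
by rewrite (line_spanned mw) //; exists a.
Qed.

Lemma line_image_exists f p q (l : PT p) : continuous f -> injective f ->
  maps_C1_curves f -> f p = q -> exists m : PT q, line_image f l m.
Proof.
move=> cf fi mf fp; have [v [tv v0 lv]] := line_vector l.
have [w [tw w0 fv fvN]] := sector_image cf fi mf fp tv v0.
by have [m mw] := line_through tw w0; exists m, v, w.
Qed.

Lemma line_image_comp (f g h : S -> S) p q r (l : PT p) (m : PT q) (n : PT r) :
  h =1 g \o f -> line_image f l m -> line_image g m n -> line_image h l n.
Proof.
move=> /funext -> [v [w [lv v0 mw w0 [fv fvN]]]] mn.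
have [u [nu u0 gw gwN]] := line_image_vector mn mw w0.
exists v, u; split=> //; split.
  exact: (cvg_comp _ _ fv gw).
exact: (cvg_comp _ _ fvN gwN).
Qed.

Lemma line_image_id p (l : PT p) : line_image id l l.
Proof. by have [v [_ v0 lv]] := line_vector l; exists v, v; split. Qed.

(** By functoriality, the image by g of the image of l is the image of l by
    the identity. *)
Lemma line_image_inverse f g p q (l : PT p) (m : PT q) :
  inverse_homeo f g -> maps_C1_curves g -> f p = q ->
  line_image f l m -> line_image g m l.
Proof.
move=> [cf cg fK gK] mg fp lm.
have gq : g q = p by rewrite -fp fK.
have [l' ml'] := line_image_exists m cg (can_inj gK) mg gq.
suff -> : l = l' by [].
apply: (line_image_unique (line_image_id l)).
by apply: line_image_comp lm ml' => x /=; rewrite fK.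
Qed.

(** The image curve leaves f p both along the sector carried from that of the
    velocity of u and along a sector of its own velocity. *)
Lemma line_image_velocity f (u k : R -> S) (t s : R) p q (l : PT p) (m : PT q) :
  continuous f -> injective f -> C1_param u -> C1_param k ->
  f @` range u = range k -> u t = p -> k s = q -> f p = q ->
  line l (velocity u t) -> line_image f l m -> line m = spanned (velocity k s).
Proof.
move=> cf fi Cu Ck kE up ks fp lu lm; move: ks; subst q => ks; subst p.
have su := C1_simple_closed Cu.
have fuk x : range k (f (u x)) by rewrite -kE; exists (u x) => //; exists x.
have [w [wE right _]] := simple_closed_sides Ck (simple_closed_comp cf fi su) fuk ks.
have [tk k0] := velocity_tangent s Ck; rewrite ks in tk.
have [tu u0] := velocity_tangent t Cu.
have tw : tangent_space (f (u t)) w by case: wE => ->; [|exact: tangent_negv].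
have w0 : w <> (fun=> 0) by case: wE => ->; [|exact: negv_neq0].
have [w' [mw' w'0 fv _]] := line_image_vector lm lu u0.
have right' : (fun x => (f \o u) (t + x)) @ (0 : R)^'+ --> sector (f (u t)) w'.
  exact: (cvg_comp _ _ (velocity_right (t := t) Cu) fv).
have [a a0 E] := sector_unique _ (line_tangent mw') tw w'0 w0 right' right.
have mw : line m w by rewrite (line_spanned mw') //; exists a.
have mk : line m (velocity k s).
  case: wE => wE; first by rewrite -wE.
  by rewrite -[velocity k s]negvK -wE; exact: line_negv.
exact: line_spanned.
Qed.

(** The defining property of [dbar f l] holds for some line since the image of
    a C^1 curve tangent to l is C^1, and any line with this property is the
    image of l. *)
Lemma dbar_line_image f p (l : PT p) : continuous f -> injective f ->
  maps_C1_curves f -> line_image f l (dbar f l).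
Proof.
move=> cf fi mf; rewrite /dbar; case: xgetP => [m _ [alpha]|no].
- move=> [u [t [Cu uE up] lu]] [k [s [Ck kE ks] mk]].
  subst p.
  have lv : line l (velocity u t).
    by rewrite lu; exists 1; apply/funext => c; rewrite scale1r.
  have [m' lm'] := line_image_exists l cf fi mf (erefl (f (u t))).
  suff -> : m = m' by [].
  apply: PT_eq; rewrite mk; apply/esym.
  apply: (line_image_velocity cf fi Cu Ck _ erefl ks erefl lv lm').
  by rewrite -uE.
- have [v [tv v0 lv]] := line_vector l.
  have [u [Cu u0 [a a0 uE]]] := curve_with_velocity tv v0.
  have [k Ck kE] : C1_curve (f @` range u) by apply: mf; exists u.
  have [s _ ks] : range k (f p) by rewrite -kE; exists p => //; exists 0.
  have [tk k0] := velocity_tangent s Ck; rewrite ks in tk.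
  have [m mk] := line_through tk k0.
  case: (no m); exists (range u).
    exists u, 0; first by [].
    apply: line_spanned; last by case: (velocity_tangent 0 Cu).
    by rewrite (line_spanned lv v0) uE; exists a.
  exists k, s; first by split.
  exact: line_spanned.
Qed.

Lemma dbar_eq f p (l : PT p) (m : PT (f p)) : continuous f -> injective f ->
  maps_C1_curves f -> line_image f l m -> dbar f l = m.
Proof. by move=> cf fi mf; apply: line_image_unique; exact: dbar_line_image. Qed.

End LineImage.

(** * Convergence along a line *)

Section Slope.
Context {R : realType}.
Implicit Types (v w : plane R).

(** A filter is the intersection of the ultrafilters that refine it. *)
Lemma filter_ultraP (T : Type) (F : set_system T) (A : set T) : ProperFilter F ->
  (forall G, UltraFilter G -> F `<=` G -> G A) -> F A.
Proof.
move=> FF H; apply: contrapT => nA.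
have PF : ProperFilter (within (~` A) F).
  apply: Build_ProperFilter_ex => B FB; apply: contrapT => nB; apply: nA.
  apply: (@filterS _ F _ _ _ _ FB) => x Bx; apply: contrapT => Ax.
  by apply: nB; exists x; exact: Bx.
have [G [UG FG]] := ultraFilterLemma PF.
have GA : G A by apply: H => // B FB; apply: FG; apply: (@filterS _ F _ _ _ _ FB).
have GnA : G (~` A) by apply: FG; exact: withinT.
have GAA : G (A `&` ~` A) by exact: filterI.
by have [x []] := filter_ex GAA.
Qed.

Lemma slope_scale v (a : R) : a != 0 -> slope (a *: v) = slope v.
Proof.
move=> a0; rewrite /slope /= mulf_eq0 (negbTE a0) /=; case: ifP => // v10.
by congr Some; rewrite invfM mulrACA divff // mul1r.
Qed.

(** Near a vertical vector the slopes leave every compact set. *)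
Lemma slope_continuous v : v != 0 -> slope @ v --> slope v.
Proof.
move=> v0.
have c1 : (fun b : plane R => b.1) @ v --> v.1 by exact: cvg_fst.
have c2 : (fun b : plane R => b.2) @ v --> v.2 by exact: cvg_snd.
rewrite /slope; case: ifP => [/eqP v1|/negbT v1].
  have v2 : v.2 != 0.
    by apply: contra v0 => /eqP v2; case: v v1 v2 {c1 c2} => a b /= -> ->.
  move=> A [C [cC _] CA].
  have [M [_ MC]] := compact_bounded cC.
  pose N := `|M| + 1.
  have N0 : 0 < N by rewrite ltr_wpDl.
  have bC x : C x -> `|x| <= N by move=> Cx; apply: MC => //; rewrite /N; have := ler_norm M; lra.
  have n2 : nbhs v [set b | `|b.2 - v.2| < `|v.2| / 2].
    by apply: (c2 _ (near_normC _ _)); rewrite divr_gt0 // normr_gt0.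
  have n1 : nbhs v [set b | `|b.1 - v.1| < `|v.2| / 2 / N].
    by apply: (c1 _ (near_normC _ _)); rewrite !divr_gt0 // normr_gt0.
  apply: (@filterS2 _ (nbhs v) _ _ _ _ _ n1 n2) => b /= b1 b2.
  rewrite v1 subr0 in b1; apply: CA; case: ifP => [_|/negbT b10]; first by right.
  left; exists (b.2 / b.1) => // /bC.
  rewrite normrM normfV ler_pdivrMr ?normr_gt0 // => H.
  have b3 : `|v.2| / 2 < `|b.2|.
    have := ler_normD (b.2 - v.2) (- b.2); rewrite normrN.
    have -> : b.2 - v.2 - b.2 = - v.2 by ring.
    by rewrite normrN; lra.
  move: b1; rewrite ltr_pdivlMr // mulrC => b1; lra.
have n1 : nbhs v [set b | b.1 != 0].
  by apply: (c1 [set x | x != 0]); apply: open_nbhs_nbhs; split=> //; exact: open_neq.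
have c3 : (fun b => b.2 / b.1) @ v --> v.2 / v.1 by apply: cvgM => //; exact: cvgV.
have c4 : (fun b => Some (b.2 / b.1) : one_point_compactification R) @ v
    --> (Some (v.2 / v.1) : one_point_compactification R).
  exact: (cvg_comp _ _ c3 (@one_point_compactification_some_continuous R _)).
apply: cvg_trans c4; apply: near_eq_cvg.
by apply: (@filterS _ (nbhs v) _ _ _ _ n1) => b /= /negbTE ->.
Qed.

Lemma slope_eq v w : v != 0 -> slope v = slope w -> exists a : R, w = a *: v.
Proof.
case: v w => [v1 v2] [w1 w2] v0; rewrite /slope /=.
case: (v1 =P 0) => [v10|/eqP v10]; case: (w1 =P 0) => [w10|/eqP w10] //.
  move=> _.
  have v20 : v2 != 0 by apply: contra v0 => /eqP ->; rewrite v10.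
  exists (w2 / v2); congr (_, _); rewrite /= /GRing.scale /=.
    by rewrite v10 w10 mulr0.
  by rewrite divfK.
move=> [E]; exists (w1 / v1); congr (_, _); rewrite /= /GRing.scale /=.
  by rewrite divfK.
by rewrite mulrAC -mulrA E mulrCA divff // mulr1.
Qed.

Lemma line_of_slope_slope v : v != 0 ->
  line_of_slope (slope v) 0 = [set w | exists a : R, w = a *: v].
Proof.
move=> v0; apply/seteqP; split=> [w|w [a ->]].
  case: v w v0 => [v1 v2] [w1 w2] v0; rewrite /slope /=; case: eqP => /= [v10|/eqP v10].
    move=> w10; have v20 : v2 != 0 by apply: contra v0 => /eqP ->; rewrite v10.
    exists (w2 / v2); congr (_, _); rewrite /= /GRing.scale /=.
      by rewrite v10 w10 mulr0.
    by rewrite divfK.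
  rewrite !subr0 => w2E; exists (w1 / v1); congr (_, _); rewrite /= /GRing.scale /=.
    by rewrite divfK.
  by rewrite w2E mulrC mulrA mulrAC.
rewrite /slope; case: eqP => /= [->|/eqP v10]; first by rewrite /GRing.scale /= mulr0.
by rewrite !subr0 /GRing.scale /= mulrCA divfK.
Qed.

Lemma slope_in_line v m : v != 0 -> line_of_slope m 0 v -> slope v = m.
Proof.
case: v => [v1 v2] v0; rewrite /slope /=; case: m => [a|] /=; last by move=> ->; rewrite eqxx.
rewrite !subr0 => v2E; case: eqP => [v10|/eqP v10].
  by move: v0; rewrite v2E v10 mulr0 eqxx.
by rewrite v2E mulfK.
Qed.

Variable S : smoothSurface R.
Implicit Types (p q : S) (u : nat -> S).

Lemma shift_infty (T : Type) (u : nat -> T) (N : nat) (A : set T) :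
  (\forall n \near \oo, A (u (N + n)%N)) <-> (\forall n \near \oo, A (u n)).
Proof.
split=> -[M _ MA].
  exists (N + M)%N => // n /= Mn; rewrite -(subnKC (leq_trans (leq_addr M N) Mn)).
  by apply: MA => /=; lia.
by exists M => // n /= Mn; apply: MA => /=; lia.
Qed.

(** Along an ultrafilter the sequence approaches p along some ray
    ([sector_of_ultra]), whose slope must be the limit of the slopes; hence the
    ray lies on the line l. The right-hand side is independent of the chart,
    so any recentred chart can be used for the converse. *)
Lemma converges_alongP p (l : PT p) (v : family S) u : line l v -> v <> (fun=> 0) ->
  converges_along l u <-> (forall n, u n <> p) /\ u @ \oo --> bisector p v.
Proof.
move=> lv v0; have tv := line_tangent lv; split=> [[np]|[np uv]].
  move=> [c [N [pc cp0 cN [m lE [_ cz cm]]]]]; split=> //.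
  have vc0 := tangent_neq0 pc tv v0.
  have mE : slope (v c) = m.
    by apply: slope_in_line => //; rewrite -cp0 -lE; exists v.
  have up : u @ \oo --> p.
    move=> A pA; apply/(@shift_infty _ u N A).
    have nz := near_chart pc.2 pA.
    apply: (@filterS _ \oo _ _ _ _ (cz _ nz)) => n [_ _].
    by rewrite to_planeK.
  move=> A [A1 A2]; apply: (@filter_ultraP _ (u @ \oo)) => G UG FG.
  have Gp : G --> p by move=> B /up; exact: FG.
  have Gnp : G [set q | q <> p] by apply: FG; exists 0%N => // n _; exact: np.
  have [v' [tv' v'0 Gv']] := sector_of_ultra UG Gp Gnp.
  have vc'0 := tangent_neq0 pc tv' v'0.
  have s1 : (fun q => slope (c q - c p)) @ G --> slope (v' c).
    move=> B /(slope_continuous vc'0)/nbhs_normC[e e0 eB].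
    have : sector p v' (sector_set c p (v' c) e).
      by apply/(sectorP _ tv' pc); exists e.
    move/Gv'; apply: (@filterS _ G) => q [_ [x [b [/andP[x0 _] be cqE]]]] /=.
    by rewrite cqE addrC addKr slope_scale ?lt0r_neq0 //; exact: eB.
  have s2 : (fun q => slope (c q - c p)) @ G --> m.
    move=> B mB; apply: FG.
    apply/(@shift_infty _ u N [set q | B (slope (c q - c p))]); exact: cm.
  have hausR : hausdorff_space (one_point_compactification R).
    apply: one_point_compactification_hausdorff; first exact: locally_compactR.
    exact: Rhausdorff.
  have sE : slope (v' c) = m by exact: (cvg_unique hausR s1 s2).
  have [a aE] := slope_eq vc0 (etrans mE (esym sE)).
  have v'E : v' = fun c => a *: v c.
    by apply: (tangent_space_inj pc tv') => //; exact: tangent_spaceZ.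
  have a0 : a != 0 by apply: (@scale_neq0 _ S v); rewrite -v'E.
  apply: Gv'; rewrite v'E; have [an|ap] := ltrP a 0; last first.
    by rewrite sector_scaleE // lt_neqAle eq_sym a0.
  by rewrite -negv_scale sector_scaleE // oppr_gt0.
split=> //; have [c pc cp0] := chart_at_origin p.
have up : u @ \oo --> p.
  by apply: (cvg_trans uv) => A pA; split; exact: sector_nbhs.
have [N _ cN] := up _ (dom_nbhs pc.2).
have vc0 := tangent_neq0 pc tv v0.
exists c, N; split=> //.
  by move=> n; apply: cN => /=; lia.
exists (slope (v c)).
  rewrite cp0 line_of_slope_slope // (line_spanned lv v0); apply/seteqP; split.
    by move=> _ [_ [a ->] <-]; exists a.
  by move=> _ [a ->]; exists (fun c => a *: v c) => //; exists a.
split.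
- move=> n cE; apply: (np (N + n)%N).
  have dn : dom c (u (N + n)%N) by apply: cN => /=; lia.
  by rewrite -(to_planeK dn) cE to_planeK //; exact: pc.2.
- move=> A cA; apply/(@shift_infty _ u N [set q | A (c q)]).
  exact: (up _ (to_plane_continuous pc.2 cA)).
move=> A sA.
apply/(@shift_infty _ u N [set q | A (slope (c q - c p))]).
apply: (uv [set q | A (slope (c q - c p))]).
have key (w : family S) : tangent_space p w -> w c != 0 -> slope (w c) = slope (v c) ->
    sector p w [set q | A (slope (c q - c p))].
  move=> tw wc0 wv; apply/(sectorP _ tw pc).
  have := slope_continuous wc0; rewrite wv => /(_ _ sA)/nbhs_normC[e e0 eA].
  exists e => // q [_ [x [b [/andP[x0 _] be cqE]]]] /=.
  by rewrite cqE addrC addKr slope_scale ?lt0r_neq0 //; exact: eA.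
split; first exact: key.
apply: key; first exact: tangent_negv.
  by rewrite /negv oppr_eq0.
by rewrite /negv -scaleN1r slope_scale // oppr_eq0 oner_eq0.
Qed.

End Slope.

(** * Neighbourhoods in the projective tangent bundle *)

Section Bundle.
Context {R : realType} (S : smoothSurface R).
Implicit Types (p q : S) (c : chart R S) (X Q : PTS S).

Lemma PTS_eq X (Q : PTS S) (v : family S) : base X = base Q ->
  line (fiber X) v -> line (fiber Q) v -> v <> (fun=> 0) -> X = Q.
Proof.
case: X Q => p l [q m] /= pq; subst q => lv mv v0.
by rewrite (line_eq lv mv v0).
Qed.

(** The projection of vectors to lines is open: a vector on a nearby line can be
    rescaled to be close to v, and this is stable under transitions because
    their differentials are jointly continuous. *)
Lemma PTS_nbhsP Q c (v : family S) (A : set (PTS S)) : chart_at (base Q) c ->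
  line (fiber Q) v -> v <> (fun=> 0) ->
  nbhs Q A <-> exists2 e : R, 0 < e & forall X w, dom c (base X) ->
    `|c (base X) - c (base Q)| < e -> line (fiber X) w -> w <> (fun=> 0) ->
    `|w c - v c| < e -> A X.
Proof.
move=> pc lv v0; have tv := line_tangent lv.
have vc0 := tangent_neq0 pc tv v0.
split.
  rewrite nbhsE => -[B [oB BQ] BA].
  have BrQ : PTS_read c B (c (base Q), v c).
    by exists Q, v; split=> //; split=> //; exact: pc.2.
  have oBr : open (PTS_read c B) by exact: (oB c pc.1).
  have nB : nbhs (c (base Q), v c) (PTS_read c B) by exact: open_nbhs_nbhs.
  have [e e0 eB] := (nbhs_normC _ _).1 nB.
  exists e => // X w cX Xe Xw w0 we.
  have [|Y [u [[BY cY] Yu u0 [zE wE]]]] := eB (c (base X), w c).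
    by rewrite prod_normE /= gt_max Xe we.
  apply: BA; suff -> : X = Y by [].
  have XY : base X = base Y by rewrite -(to_planeK cX) -(to_planeK cY) zE.
  have wu : w = u.
    have Xc : chart_at (base X) c by split=> //; exact: pc.1.
    apply: (tangent_space_inj Xc) => //; first exact: line_tangent Xw.
    by rewrite XY; exact: line_tangent Yu.
  by apply: PTS_eq XY Xw _ w0; rewrite wu.
move=> [e e0 eA].
pose O : set (PTS S) := [set X | [/\ dom c (base X),
   `|c (base X) - c (base Q)| < e & exists w,
   [/\ line (fiber X) w, w <> (fun=> 0) & `|w c - v c| < e]]].
have OA : O `<=` A by move=> X [cX Xe [w [Xw w0 we]]]; exact: eA we.
have OQ : O Q.
  split; [exact: pc.2|by rewrite subrr normr0|].
  by exists v; rewrite subrr normr0.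
rewrite nbhsE; exists O => //; split=> //.
move=> c' ac'; rewrite openE => _ [X [u [[[cX Xe [w [Xw w0 we]]] c'X] Xu u0 ->]]].
have [a wE] := line_scale Xu u0 Xw.
have a0 : a != 0 by apply: (@scale_neq0 _ S u); rewrite -wE.
pose T := transition c' c; pose U := c' @` (dom c' `&` dom c).
have pc' : chart_at (base X) c' by [].
have Xc : chart_at (base X) c by split=> //; exact: pc.1.
have oU : open U by apply: chart_image_open; exact: dom_open.
have Uz : U (c' (base X)) by exists (base X).
have [/(_ 1%N) C1 _] := atlas_compatible ac' pc.1.
have jc := diff_joint_continuous (w := u c') oU C1 Uz.
have TX : T (c' (base X)) = c (base X) by exact: transition_val.
have dT : 'd T (c' (base X)) (u c') = u c.
  by apply/esym; exact: ((line_tangent Xu).1 c' c pc' Xc).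
have f1 : (fst : plane R * plane R -> plane R) @ (c' (base X), u c') --> c' (base X).
  exact: cvg_fst.
have n1 : nbhs (c' (base X), u c') [set zw : plane R * plane R | U zw.1].
  by apply: f1; exact: open_nbhs_nbhs.
have n2 : nbhs (c' (base X), u c') [set zw : plane R * plane R | `|T zw.1 - c (base Q)| < e].
  have Tc : {for c' (base X), continuous T}.
    by apply: differentiable_continuous; exact: (transition_differentiable pc' Xc).
  apply: (f1 [set z | `|T z - c (base Q)| < e]).
  have nb : nbhs (T (c' (base X))) [set z | `|z - c (base Q)| < e].
    rewrite TX; apply/nbhs_normC; exists (e - `|c (base X) - c (base Q)|).
      by rewrite subr_gt0.
    move=> b; rewrite ltrBrDr => H; rewrite /= -(subrK (c (base X)) b) -addrA.
    exact: le_lt_trans (ler_normD _ _) H.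
  exact: (Tc _ nb).
have n3 : nbhs (c' (base X), u c') [set zw : plane R * plane R |
    `|a *: (fun y u : plane R => 'd T y u) zw.1 zw.2 - v c| < e].
  have jc' : (fun zw : plane R * plane R => a *: (fun y u : plane R => 'd T y u) zw.1 zw.2)
      @ (c' (base X), u c') --> a *: u c.
    by apply: cvgZl_tmp; exact: (eq_ind _ (fun l => _ --> l) jc _ dT).
  have nb : nbhs (a *: u c) [set z | `|z - v c| < e].
    apply/nbhs_normC; exists (e - `|w c - v c|); first by rewrite subr_gt0.
    rewrite wE => b; rewrite ltrBrDr => H; rewrite /= -(subrK (a *: u c) b) -addrA.
    exact: le_lt_trans (ler_normD _ _) H.
  exact: (jc' _ nb).
have n4 : nbhs (c' (base X), u c') [set zw : plane R * plane R | zw.2 != 0].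
  have f2 : (snd : plane R * plane R -> plane R) @ (c' (base X), u c') --> u c'.
    exact: cvg_snd.
  apply: (f2 [set z | z != 0]); apply: open_nbhs_nbhs.
  by split; [exact: open_nonzero|exact: tangent_neq0 pc' (line_tangent Xu) u0].
apply: (@filterS2 _ (nbhs (c' (base X), u c')) _ _ _ _ _ (filterI n1 n2) (filterI n3 n4)).
move=> [z y] /= [[x [c'x cx] xz] Tz] [dy y0].
have xc' : chart_at x c' by [].
have xc : chart_at x c by split=> //; exact: pc.1.
have [k [s [ks s0 sE]]] := PT_exists xc' y0.
exists (ProjPoint k), s; split=> //=; last by rewrite xz sE.
split=> //; split=> //=.
  by move: Tz; rewrite -xz /T transition_val.
exists (fun c => a *: s c).
have ss : s c = 'd T z y.
  exact: (etrans ((line_tangent ks).1 c' c xc' xc)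
    (congr2 (fun y u : plane R => 'd T y u) xz sE)).
split.
- by rewrite (line_spanned ks s0); exists a.
- move=> as0; apply: s0; apply/funext => b.
  by have /(congr1 (fun z => z b))/eqP := as0; rewrite scaler_eq0 (negbTE a0) /= => /eqP.
- exact: (eq_ind_r (fun y => `|a *: y - v c| < e) dy ss).
Qed.

Lemma PT_nbhsP p (l : PT p) c (v : family S) (A : set (PT p)) : chart_at p c ->
  line l v -> v <> (fun=> 0) ->
  nbhs l A <-> exists2 e : R, 0 < e & forall k w,
    line k w -> w <> (fun=> 0) -> `|w c - v c| < e -> A k.
Proof.
move=> pc lv v0; have tv := line_tangent lv.
have vc0 := tangent_neq0 pc tv v0.
split.
  rewrite nbhsE => -[B [oB Bl] BA].
  have Brl : PT_read c B (v c) by exists l, v.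
  have oBr : open (PT_read c B) by exact: (oB c pc).
  have nB : nbhs (v c) (PT_read c B) by exact: open_nbhs_nbhs.
  have [e e0 eB] := (nbhs_normC _ _).1 nB.
  exists e => // k w kw w0 we; have [k' [u [Bk' k'u u0 wE]]] := eB _ we.
  by have [-> _] := PT_read_inj pc kw k'u w0 wE; exact: BA.
move=> [e e0 eA].
pose O : set (PT p) := [set k | exists w,
   [/\ line k w, w <> (fun=> 0) & `|w c - v c| < e]].
have OA : O `<=` A by move=> k [w [kw w0 we]]; exact: eA we.
rewrite nbhsE; exists O => //; split; last by exists v; rewrite subrr normr0.
move=> c' pc'; rewrite openE => _ [k [u [[w [kw w0 we]] ku u0 ->]]].
have [a wE] := line_scale ku u0 kw.
have a0 : a != 0 by apply: (@scale_neq0 _ S u); rewrite -wE.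
pose T := transition c' c.
have dT : differentiable T (c' p) by exact: transition_differentiable.
have uE : 'd T (c' p) (u c') = u c.
  by apply/esym; exact: ((line_tangent ku).1 c' c pc' pc).
have cT : (fun y => 'd T (c' p) y) @ u c' --> 'd T (c' p) (u c').
  exact: (diff_continuous dT).
have n1 : nbhs (u c') [set y | `|a *: (fun y : plane R => 'd T (c' p) y) y - v c| < e].
  have jc' : (fun y => a *: (fun y : plane R => 'd T (c' p) y) y) @ u c' --> a *: u c.
    by apply: cvgZl_tmp; exact: (eq_ind _ (fun l => _ --> l) cT _ uE).
  have nb : nbhs (a *: u c) [set z | `|z - v c| < e].
    apply/nbhs_normC; exists (e - `|w c - v c|); first by rewrite subr_gt0.
    rewrite wE => b; rewrite ltrBrDr => H; rewrite /= -(subrK (a *: u c) b) -addrA.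
    exact: le_lt_trans (ler_normD _ _) H.
  exact: (jc' _ nb).
have n2 : nbhs (u c') [set y | y != 0].
  apply: open_nbhs_nbhs.
  by split; [exact: open_nonzero|exact: tangent_neq0 pc' (line_tangent ku) u0].
apply: (@filterS2 _ (nbhs (u c')) _ _ _ _ _ n1 n2) => y /= dy y0.
have [k' [s [ks s0 sE]]] := PT_exists pc' y0.
exists k', s; split=> //.
have ss : s c = 'd T (c' p) y.
  exact: (etrans ((line_tangent ks).1 c' c pc' pc)
    (congr1 (fun y : plane R => 'd T (c' p) y) sE)).
exists (fun c => a *: s c); split.
- by rewrite (line_spanned ks s0); exists a.
- move=> as0; apply: s0; apply/funext => b.
  by have /(congr1 (fun z => z b))/eqP := as0; rewrite scaler_eq0 (negbTE a0) /= => /eqP.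
- exact: (eq_ind_r (fun y => `|a *: y - v c| < e) dy ss).
Qed.

(** Points of the bundle have countable bases of neighbourhoods, so that having
    no convergent subsequence means staying away from a neighbourhood. *)
Lemma no_subsequence Q (u : nat -> PTS S) :
  (forall i : nat -> nat, {homo i : m n / (m < n)%N} -> ~ (u \o i @ \oo --> Q)) ->
  exists2 A, nbhs Q A & \forall n \near \oo, ~ A (u n).
Proof.
move=> H; apply: contrapT => no.
have [c ac cQ] := atlas_cover (base Q); have pc : chart_at (base Q) c by [].
have [v [tv v0 lv]] := line_vector (fiber Q).
pose O (n : nat) : set (PTS S) := [set X | exists w, [/\ dom c (base X),
    `|c (base X) - c (base Q)| < n.+1%:R^-1, line (fiber X) w, w <> (fun=> 0) &
    `|w c - v c| < n.+1%:R^-1]].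
have On n : nbhs Q (O n).
  apply/(PTS_nbhsP _ pc lv v0); exists n.+1%:R^-1; first by rewrite invr_gt0 ltr0n.
  by move=> X w cX Xe Xw w0 we; exists w.
have ex n N : exists k, (N <= k)%N /\ O n (u k).
  apply: contrapT => noK; apply: no; exists (O n) => //; exists N => // k /= Nk OK.
  by apply: noK; exists k.
have [K KP] := @choice (nat * nat)%type nat
  (fun nN k => (nN.2 <= k)%N /\ O nN.1 (u k)) (fun nN => ex nN.1 nN.2).
pose i := fix i n : nat := if n is m.+1 then K (m.+1, (i m).+1) else K (0%N, 0%N).
have iP n : O n (u (i n)) by case: n => [|n]; exact: (KP (_, _)).2.
have i_inc : {homo i : m n / (m < n)%N}.
  apply: homo_ltn; first exact: ltn_trans.
  by move=> n; exact: (KP (n.+1, (i n).+1)).1.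
apply: (H i i_inc) => A /(PTS_nbhsP _ pc lv v0)[e e0 eA].
have small : \forall n \near \oo, n.+1%:R^-1 < e.
  exists (Num.truncn e^-1) => // n /= Nn; rewrite invf_plt ?posrE //.
  have /truncn_itv /andP[_ H2] : 0 <= e^-1 by rewrite invr_ge0 ltW.
  by apply: (lt_le_trans H2); rewrite ler_nat; lia.
apply: (@filterS _ \oo _ _ _ _ small) => n ne /=.
have [w [cX Xe Xw w0 we]] := iP n.
by apply: (eA _ w) => //; exact: lt_trans ne.
Qed.

End Bundle.

(** * Properties of the homeomorphisms that preserve C^1 curves in both directions *)

Lemma continuous_normC (R : realType) (V : normedModType R) (T : topologicalType)
    (h : V -> T) (x : V) (A : set T) : {for x, continuous h} -> nbhs (h x) A ->
  exists2 r : R, 0 < r & forall y, `|y - x| < r -> A (h y).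
Proof.
move=> ch nA; have nh : nbhs x (h @^-1` A) by exact: ch.
exact: (nbhs_normC _ _).1 nh.
Qed.

Section Forward.
Context {R : realType} (S : smoothSurface R).
Implicit Types (p q : S) (f g : S -> S) (c : chart R S) (X Q : PTS S).

(** The cones of radius d around w meet the cone of radius e / 2 around w0 for
    all d, so a rescaling of w is close to that cone. *)
Lemma ray_in_cone (w w0 : plane R) (e : R) : w != 0 -> 0 < e ->
  (forall d : R, 0 < d -> exists x1 b1 x2 b2,
     [/\ 0 < x1, 0 < x2, `|b1 - w0| < e / 2, `|b2 - w| < d & x1 *: b1 = x2 *: b2]) ->
  exists2 a : R, 0 < a & `|a *: w - w0| < e.
Proof.
move=> w00 e0 H; have nw : 0 < `|w| by rewrite normr_gt0.
have M0 : 0 < `|w0| + e by rewrite ltr_wpDl.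
(* The first bound keeps b2 away from 0, so that the scale is bounded; with the
   second bound the scaled error is at most e / 2. *)
pose d := Num.min (`|w| / 2) (e * `|w| / (4 * (`|w0| + e))).
have d0 : 0 < d by rewrite lt_min !divr_gt0 // mulr_gt0.
have [x1 [b1 [x2 [b2 [x10 x20 b1w b2w E]]]]] := H d d0.
have b1E : b1 = (x2 / x1) *: b2.
  by rewrite mulrC -scalerA -E scalerA mulVf ?gt_eqF // scale1r.
have a0 : 0 < x2 / x1 by rewrite divr_gt0.
exists (x2 / x1) => //; move: b1w a0; rewrite b1E; set a := x2 / x1 => b1w a0.
have b2n : `|w| / 2 <= `|b2|.
  have := ler_normD (w - b2) b2; rewrite subrK distrC.
  by move: b2w; rewrite lt_min => /andP[b2w _]; lra.
have ab : a * `|b2| <= `|w0| + e.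
  have := ler_normD (a *: b2 - w0) w0; rewrite subrK normrZ gtr0_norm //.
  by lra.
have ad : a * d <= e / 2.
  have d2 : d <= e * `|w| / (4 * (`|w0| + e)) by rewrite ge_min lexx orbT.
  have a2 : a <= 2 * (`|w0| + e) / `|w|.
    rewrite ler_pdivlMr //; apply: (le_trans _ (_ : 2 * (a * `|b2|) <= _)).
      by rewrite mulrCA ler_pM2l //; lra.
    by rewrite ler_pM2l.
  apply: (@le_trans _ _ (2 * (`|w0| + e) / `|w| * (e * `|w| / (4 * (`|w0| + e))))).
    by apply: ler_pM => //; exact: ltW.
  rewrite le_eqVlt; apply/orP; left; apply/eqP; field.
  by rewrite !gt_eqF.
have -> : a *: w - w0 = (a *: w - a *: b2) + (a *: b2 - w0) by rewrite addrA subrK.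
rewrite (le_lt_trans (ler_normD _ _)) // -scalerBr normrZ gtr0_norm //.
have : a * `|w - b2| < a * d by rewrite ltr_pM2l // distrC.
by lra.
Qed.

(** The cone around the image w0 of v0 contains the image of a cone around v0,
    which is in the sector of every v close to v0. The sector of the image w of
    v therefore meets the cone around w0. *)
Lemma line_image_continuous f p q (phi : PT p -> PT q) :
  (forall l, line_image f l (phi l)) -> continuous phi.
Proof.
move=> fphi l0 A Aphi.
have [c ac cp] := atlas_cover p; have pc : chart_at p c by [].
have [c' ac' cq] := atlas_cover q; have qc : chart_at q c' by [].
have [v0 [tv0 v00 lv0]] := line_vector l0.
have [w0 [mw0 w00 fv0 _]] := line_image_vector (fphi l0) lv0 v00.
have [e e0 eA] := (PT_nbhsP _ qc mw0 w00).1 Aphi.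
pose N := sector_set c' q (w0 c') (e / 2).
have : sector q w0 N.
  by apply/(sectorP _ (line_tangent mw0) qc); exists (e / 2) => //; rewrite divr_gt0.
move=> /fv0/(sectorP _ tv0 pc)[d d0 dN].
apply/(PT_nbhsP _ pc lv0 v00); exists d => // l v lv vn0 vd.
have [w [mw wn0 fv _]] := line_image_vector (fphi l) lv vn0.
have vN : sector p v (f @^-1` N).
  apply/(sectorP _ (line_tangent lv) pc); exists (d - `|v c - v0 c|).
    by rewrite subr_gt0.
  move=> y [cy [x [b [/andP[x0 xd] bd cyE]]]]; apply: dN; split=> //.
  exists x, b; split=> //.
    by rewrite x0 (lt_le_trans xd) // gerBl.
  rewrite -(subrK (v c) b) -addrA.
  by rewrite (le_lt_trans (ler_normD _ _)) // -ltrBrDr.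
have [|a a0 aw] := @ray_in_cone (w c') (w0 c') e (tangent_neq0 qc (line_tangent mw) wn0) e0.
  move=> r r0.
  have : sector q w (sector_set c' q (w c') r).
    by apply/(sectorP _ (line_tangent mw) qc); exists r.
  move=> /fv nr.
  have [y [[_ [x1 [b1 [/andP[x10 _] b1w E1]]]] [_ [x2 [b2 [/andP[x20 _] b2w E2]]]]]] :=
    filter_ex (filterI vN nr).
  exists x1, b1, x2, b2; split=> //.
  by apply: (addrI (c' q)); rewrite -E1 -E2.
apply: (eA _ (fun c => a *: w c)) => //.
  by rewrite (line_spanned mw wn0); exists a.
move=> aw0; apply: wn0; apply/funext => b.
by have /(congr1 (fun z => z b))/eqP := aw0; rewrite scaler_eq0 gt_eqF //= => /eqP.
Qed.

(** The inverse of the induced map is the one induced by g. *)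
Lemma dbar_homeo f g p : inverse_homeo f g -> maps_C1_curves f ->
  maps_C1_curves g -> homeo (@dbar R S f p).
Proof.
move=> fg mf mg; have [cf cg fK gK] := fg.
have [fi gi] := (can_inj fK, can_inj gK).
have ex (m : PT (f p)) : exists l : PT p, line_image f l m.
  have [l gl] := line_image_exists m cg gi mg (fK p).
  exists l; apply: (@line_image_inverse _ _ g f _ _ m l) => //.
have [k kP] := choice ex.
exists k; split.
- by apply: (@line_image_continuous f) => l; exact: dbar_line_image.
- apply: (@line_image_continuous g) => m.
  exact: (line_image_inverse fg mg erefl (kP m)).
- move=> l; have H1 := dbar_line_image l cf fi mf.
  have H2 := kP (dbar f l).
  exact: (line_image_unique (line_image_inverse fg mg erefl H2)
    (line_image_inverse fg mg erefl H1)).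
- by move=> m; exact: (dbar_eq cf fi mf (kP m)).
Qed.

Lemma dbarS_converges_along f Q (u : nat -> PTS S) : continuous f -> injective f ->
  maps_C1_curves f -> converges_along (fiber Q) (base \o u) ->
  converges_along (fiber (dbarS f Q)) (base \o (dbarS f \o u)).
Proof.
move=> cf fi mf.
have [v [tv v0 lv]] := line_vector (fiber Q).
have [w [mw w0 fv fvN]] := line_image_vector (dbar_line_image (fiber Q) cf fi mf) lv v0.
move=> /(converges_alongP _ lv v0)[np uv].
apply/(@converges_alongP _ _ _ (fiber (dbarS f Q)) w _ mw w0); split.
  by move=> n /= /fi; exact: np.
move=> B [B1 B2]; have : bisector (base Q) v (f @^-1` B).
  by split; [exact: fv|exact: fvN].
exact: uv.
Qed.

Lemma homo_ge_id (i : nat -> nat) n : {homo i : m n / (m < n)%N} -> (n <= i n)%N.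
Proof. by move=> ii; elim: n => // n IH; exact: leq_ltn_trans IH (ii _ _ (ltnSn n)). Qed.

(** If a subsequence of the image converged to (f p, m), a C^1 curve ga would
    pass through its points tangentially to its lines. The image of ga by g is
    a C^1 curve ka through the original points tangent to the original lines,
    so these lines would enter every neighbourhood of the tangent of ka at p,
    which is the line of Q. *)
Lemma transverse_image f g Q (u : nat -> PTS S) : inverse_homeo f g ->
  maps_C1_curves f -> maps_C1_curves g -> transverse_for Q u ->
  transverse_for (dbarS f Q) (dbarS f \o u).
Proof.
move=> fg mf mg; have [cf cg fK gK] := fg.
have [fi gi] := (can_inj fK, can_inj gK).
move=> [Qu nosub]; have Qfu := dbarS_converges_along cf fi mf Qu.
split=> // i ii ui.
have [D nD [N0 _ N0D]] := no_subsequence nosub.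
set p := base Q in Qu Qfu *; set q := f p.
have [w [tw w0 mw]] := line_vector (fiber (dbarS f Q)).
have [_ fuw] := (converges_alongP _ mw w0).1 Qfu.
pose y n := f (base (u (i n))).
have yw : y @ \oo --> bisector q w.
  move=> B /fuw[M _ MB]; exists M => // n /= Mn; apply: MB => /=.
  exact: leq_trans (homo_ge_id n ii).
(* A side of the line, along which infinitely many of the points come. *)
have [G [UG FG]] := @ultraFilterLemma nat \oo _.
have Gy : y @ G --> bisector q w by move=> B /yw; exact: FG.
have [w1 [mw1 w10 Gw1]] : exists w1, [/\ line (fiber (dbarS f Q)) w1,
    w1 <> (fun=> 0) & y @ G --> sector q w1].
  have [H|H] := bisector_ultra (fmap_ultra y UG) Gy; first by exists w.
  by exists (negv w); split=> //; [exact: line_negv|exact: negv_neq0].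
have tw1 := line_tangent mw1.
have [c' ac' cq] := atlas_cover q; have qc : chart_at q c' by [].
have [|ga [Cga ga0 [a a0 gav] gaP]] := @curve_through _ _ q c' (w1 c')
   (fun=> [set yd | exists n s, [/\ (N0 <= n)%N, yd.1 = y n /\ dom c' (y n),
      line (dbar f (fiber (u (i n)))) s, s <> (fun=> 0) & yd.2 = s c']])
   qc (tangent_neq0 qc tw1 w10).
  move=> _ e e0.
  have g1 : G [set n | sector_set c' q (w1 c') e (y n)].
    by apply: Gw1; apply/(sectorP _ tw1 qc); exists e.
  have g2 : G [set n | (N0 <= n)%N] by apply: FG; exists N0.
  have g3 : G [set n | exists s, [/\ line (dbar f (fiber (u (i n)))) s,
      s <> (fun=> 0) & `|s c' - w1 c'| < e]].
    apply: FG; apply: (ui [set X | exists s, [/\ line (fiber X) s,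
      s <> (fun=> 0) & `|s c' - w1 c'| < e]]).
    apply/(@PTS_nbhsP _ _ (dbarS f Q) c' w1 _ qc mw1 w10); exists e => //.
    by move=> X s _ _ Xs s0 se; exists s.
  have [n [[/= n1 n2] [s [sn s0 se]]]] := filter_ex (filterI (filterI g1 g2) g3).
  by exists (y n), (s c'); split=> //; exists n, s; split=> //; split=> //; exact: n1.1.
have [ka Cka kaE] : C1_curve (g @` range ga) by apply: mg; exists ga.
have gka t : range ka ((g \o ga) t) by rewrite -kaE; exists (ga t) => //; exists t.
have [s0 _ kas0] := gka 0.
have gq : g q = p by rewrite /q fK.
have kap : ka s0 = p by rewrite kas0 /= ga0.
have yE n : g (y n) = base (u (i n)) by rewrite /y fK.
(* The parameter on ka of the points of g \o ga. *)
have [h [d d0 [h0 hP]]] := lift_through (C1_simple_closed Cka)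
  (simple_closed_comp cg gi (C1_simple_closed Cga)).1 gka kas0.
have mQ : line (fiber (dbarS f Q)) (velocity ga 0).
  have [tg _] := velocity_tangent 0 Cga; rewrite ga0 in tg.
  rewrite (line_spanned mw1 w10); exists a.
  apply: (tangent_space_inj qc tg); first exact: tangent_spaceZ.
  by rewrite velocityE // ga0.
have lQ : line (fiber Q) = spanned (velocity ka s0).
  apply: (line_image_velocity cg gi Cga Cka kaE ga0 kap gq mQ).
  apply: (line_image_inverse fg mg erefl).
  exact: dbar_line_image.
have [tk k0] := velocity_tangent s0 Cka; rewrite kap in tk.
have vQ : line (fiber Q) (velocity ka s0).
  by rewrite lQ; exists 1; apply/funext => b; rewrite scale1r.
have [c ac cp] := atlas_cover p; have pc : chart_at p c by [].
have [e e0 eO] := (PTS_nbhsP _ pc vQ k0).1 nD.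
have [cka _ dka] := Cka.
have kc : chart_at (ka s0) c by rewrite kap.
have [_ dkc _] := dka _ _ kc.
have n1 : nbhs s0 [set s | dom c (ka s)] := cka s0 _ (dom_nbhs kc.2).
have n2 : nbhs s0 [set s | `|c (ka s) - c p| < e].
  have cc : {for s0, continuous (c \o ka)}.
    by apply: continuous_comp; [exact: cka|exact: to_plane_continuous kc.2].
  by apply: (cc [set z | `|z - c p| < e]); rewrite /= kap; exact: near_normC.
have n3 : nbhs s0 [set s | `|derive1 (c \o ka) s - velocity ka s0 c| < e].
  by rewrite velocityE //; exact: (dkc _ (near_normC _ e0)).
have hc : {for (0 : R), continuous h}.
  by have [|_ _] := hP 0; rewrite ?subrr ?normr0.
pose B := [set s | dom c (ka s)] `&` ([set s | `|c (ka s) - c p| < e] `&`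
     [set s | `|derive1 (c \o ka) s - velocity ka s0 c| < e]).
have nk : nbhs (h 0) B by rewrite h0; exact: (filterI n1 (filterI n2 n3)).
have [r r0 rP] := continuous_normC hc nk.
have m0 : 0 < Num.min d r by rewrite lt_min d0.
have [t [z [/andP[t0 tm] [n [s [nN0 /= [gat cyn] sn sn0 zE]]] [b b0 gavt]]]] := gaP true _ m0.
move: tm; rewrite lt_min => /andP[td tr].
have tn : `|t - 0| < r by rewrite subr0 gtr0_norm.
have [kd [ke kv]] := rP t tn.
have tnd : `|t - 0| < d by rewrite subr0 gtr0_norm.
have [gaE _ _] := hP t tnd.
have kaX : ka (h t) = base (u (i n)) by rewrite -gaE /= gat yE.
apply: (N0D (i n)); first by rewrite /=; exact: leq_trans nN0 (homo_ge_id n ii).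
have mX : line (dbar f (fiber (u (i n)))) (velocity ga t).
  have [tg _] := velocity_tangent t Cga; rewrite gat in tg.
  have yc : chart_at (y n) c' by [].
  rewrite (line_spanned sn sn0); exists b.
  apply: (tangent_space_inj yc tg).
    exact: tangent_spaceZ (line_tangent sn).
  by rewrite velocityE ?gat // gavt zE.
have lX : line (fiber (u (i n))) = spanned (velocity ka (h t)).
  apply: (line_image_velocity cg gi Cga Cka kaE gat kaX (yE n) mX).
  apply: (line_image_inverse fg mg erefl).
  exact: dbar_line_image.
have [_ kt0] := velocity_tangent (h t) Cka.
apply: (eO _ (velocity ka (h t)) _ _ _ kt0).
- by rewrite -kaX.
- by rewrite -kaX.
- by rewrite lX; exists 1; apply/funext => x; rewrite scale1r.
rewrite [velocity ka (h t) c]velocityE //; by split=> //; exact: ac.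
Qed.

End Forward.

(** * The tangent lines of a preimage curve *)

Section DirectionField.
Context {R : realType} (S : smoothSurface R).
Implicit Types (p q : S) (f g : S -> S) (c : chart R S) (v w : family S).

Lemma negv_not_ray p v (a : R) : tangent_space p v -> v <> (fun=> 0) -> 0 < a ->
  negv v <> fun c => a *: v c.
Proof.
move=> tv v0 a0 E; have [c ac cp] := atlas_cover p.
have pc : chart_at p c by [].
have := tangent_neq0 pc tv v0; apply/negP; rewrite negbK.
have /eqP := congr1 (fun z => z c) E; rewrite /negv /=.
rewrite -subr_eq0 -opprD oppr_eq0 -[X in X + _]scale1r -scalerDl scaler_eq0.
by rewrite gt_eqF // addr_gt0.
Qed.

(** Along an ultrafilter refining F the approach is along some v' whose image
    is the ray of w. As lines are separated by their images, v' is on the line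
    of v, and the sign is decided by the images of the two sides. *)
Lemma sector_lift f p q v w (F : set_system S) : ProperFilter F ->
  continuous f -> injective f -> maps_C1_curves f -> f p = q ->
  (forall (l l' : PT p) (m : PT q), line_image f l m -> line_image f l' m -> l = l') ->
  tangent_space p v -> v <> (fun=> 0) -> tangent_space q w -> w <> (fun=> 0) ->
  f @ sector p v --> sector q w -> f @ sector p (negv v) --> sector q (negv w) ->
  F --> p -> F [set x | x <> p] -> f @ F --> sector q w -> F --> sector p v.
Proof.
move=> FF cf fi mf fp linj tv v0 tw w0 fv fvN Fp Fnp Fw A vA.
apply: filter_ultraP => G UG FG.
have Gp : G --> p by move=> B /Fp; exact: FG.
have [v' [tv' v'0 Gv']] := sector_of_ultra UG Gp (FG _ Fnp).
have [w' [tw' w'0 fv' fv'N]] := sector_image cf fi mf fp tv' v'0.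
have Gw' : f @ G --> sector q w' by exact: (cvg_comp _ _ Gv' fv').
have Gw : f @ G --> sector q w by move=> B /Fw; exact: FG.
have [a a0 wE] := sector_unique _ tw' tw w'0 w0 Gw' Gw.
have {}fv' : f @ sector p v' --> sector q w by rewrite wE sector_scaleE.
have {}fv'N : f @ sector p (negv v') --> sector q (negv w).
  by rewrite wE negvZ sector_scaleE.
have [l lv] := line_through tv v0; have [l' lv'] := line_through tv' v'0.
have [m mw] := line_through tw w0.
have ll' : l = l'.
  by apply: (linj _ _ m); [exists v, w|exists v', w].
rewrite -ll' in lv'; have [b v'E] := line_scale lv v0 lv'.
have b0 : b != 0 by apply: (@scale_neq0 _ S v); rewrite -v'E.
have [bn|bp] := ltrP b 0; last first.
  apply: Gv'; rewrite v'E sector_scaleE //.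
  by rewrite lt_neqAle eq_sym b0.
have fv'' : f @ sector p v' --> sector q (negv w).
  by rewrite v'E -negv_scale sector_scaleE // oppr_gt0.
have [d d0 E] := sector_unique _ tw (tangent_negv tw) w0 (negv_neq0 w0) fv' fv''.
by have := negv_not_ray tw w0 d0 E.
Qed.

Lemma near_sides (T : Type) (d : R -> T) (t : R) (B : set T) :
  (\forall x \near (0 : R)^'+, B (d (t + x))) ->
  (\forall x \near (0 : R)^'+, B (d (t - x))) ->
  exists2 r : R, 0 < r & forall s, s != t -> `|s - t| < r -> B (d s).
Proof.
move=> /nbhs_normC[r1 r10 B1] /nbhs_normC[r2 r20 B2].
exists (Num.min r1 r2); first by rewrite lt_min r10.
move=> s st; rewrite lt_min => /andP[s1 s2].
have [ts|ts|ts] := ltgtP s t.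
- by rewrite -(subKr t s); apply: B2; rewrite ?subr_gt0 // subr0 distrC.
- by rewrite -(subrK t s) addrC; apply: B1; rewrite ?subr_gt0 // subr0.
- by rewrite ts eqxx in st.
Qed.

Variables (f g : S -> S) (beta : R -> S).
Hypotheses (fg : inverse_homeo f g) (mf : maps_C1_curves f)
  (hd : forall p, homeo (@dbar R S f p))
  (ht : forall u : nat -> PTS S, transverse u -> transverse (dbarS f \o u))
  (Cb : C1_param beta).

Let delta := g \o beta.

Let cf : continuous f. Proof. by case: fg. Qed.
Let cg : continuous g. Proof. by case: fg. Qed.
Let fK : cancel f g. Proof. by case: fg. Qed.
Let gK : cancel g f. Proof. by case: fg. Qed.
Let fi : injective f := can_inj fK.
Let gi : injective g := can_inj gK.

Let sdelta : simple_closed delta.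
Proof. exact: simple_closed_comp cg gi (C1_simple_closed Cb). Qed.

Let fdelta t : f (delta t) = beta t.
Proof. by rewrite /delta /= gK. Qed.

Let linj p (l l' : PT p) (m : PT (f p)) :
  line_image f l m -> line_image f l' m -> l = l'.
Proof.
move=> lm l'm; have [k [_ _ dK _]] := hd p.
by rewrite -(dK l) -(dK l') (dbar_eq cf fi mf lm) (dbar_eq cf fi mf l'm).
Qed.

(** The direction of delta is the preimage of the tangent line of beta, which
    exists as the induced map is onto. Injectivity lifts the convergence of beta
    along its velocity to delta ([sector_lift]). *)
Lemma direction_exists t : exists v, [/\ tangent_space (delta t) v, v <> (fun=> 0),
  (fun x => delta (t + x)) @ (0 : R)^'+ --> sector (delta t) v,
  (fun x => delta (t - x)) @ (0 : R)^'+ --> sector (delta t) (negv v) &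
  f @ sector (delta t) v --> sector (beta t) (velocity beta t) /\
  f @ sector (delta t) (negv v) --> sector (beta t) (negv (velocity beta t))].
Proof.
have [tb b0] := velocity_tangent t Cb.
rewrite -(fdelta t) in tb *.
have [m mb] := line_through tb b0.
have [k [_ _ _ kK]] := hd (delta t).
have lm : line_image f (k m) m by rewrite -[X in line_image _ _ X]kK; exact: dbar_line_image.
have [v [tv v0 lv]] := line_vector (k m).
have [w [mw w0 fv fvN]] := line_image_vector lm lv v0.
have [a aE] := line_scale mw w0 mb.
have a0 : a != 0 by apply: (@scale_neq0 _ S w); rewrite -aE.
have [u [tu u0 fu fuN]] : exists u, [/\ tangent_space (delta t) u, u <> (fun=> 0),
    f @ sector (delta t) u --> sector (f (delta t)) (velocity beta t) &
    f @ sector (delta t) (negv u) --> sector (f (delta t)) (negv (velocity beta t))].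
  have [an|ap] := ltrP a 0; last first.
    have {}ap : 0 < a by rewrite lt_neqAle eq_sym a0.
    by exists v; split=> //; rewrite aE ?negvZ sector_scaleE.
  have Na : 0 < - a by rewrite oppr_gt0.
  exists (negv v); rewrite negvK; split=> //.
  - exact: tangent_negv.
  - exact: negv_neq0.
  - by rewrite aE -negv_scale sector_scaleE.
  - by rewrite aE -negv_scale negvZ sector_scaleE // negvK.
have dsmall (e : R) : `|e| = 1 -> (0 : R)^'+ [set x | delta (t + e * x) <> delta t].
  move=> e1; near=> x => /= E.
  have x0 : 0 < x by near: x; exact: nbhs_right_gt.
  have x1 : x < 1 by near: x; exact: nbhs_right_lt.
  have tx : `|t + e * x - t| < 1.
    by rewrite addrC addKr normrM e1 mul1r gtr0_norm.
  have /eqP := simple_closed_inj sdelta tx E.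
  rewrite -subr_eq0 addrC addKr mulf_eq0 (gt_eqF x0) orbF.
  by move/eqP => e0; move: e1; rewrite e0 normr0 => /eqP; rewrite eq_sym oner_eq0.
have c0 : (0 : R)^'+ --> (0 : R) by exact: cvg_within.
have c1 : (fun x => t + x) @ (0 : R)^'+ --> t.
  by rewrite -[X in _ --> X]addr0; apply: cvgD => //; exact: cvg_cst.
have c2 : (fun x => t - x) @ (0 : R)^'+ --> t.
  by rewrite -[X in _ --> X]subr0; apply: cvgB => //; exact: cvg_cst.
exists u; split=> //.
- apply: (@sector_lift f (delta t) (f (delta t)) u (velocity beta t)) => //.
  + exact: linj.
  + exact: (cvg_comp _ _ c1 (sdelta.1 t)).
  + have := dsmall 1; rewrite normr1 => /(_ erefl).
    by apply: (@filterS _ (0 : R)^'+) => x /=; rewrite mul1r.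
  + have E : f \o (fun x => delta (t + x)) = (fun x => beta (t + x)).
      by apply/funext => x /=; exact: fdelta.
    have F1 : (f \o (fun x => delta (t + x))) @ (0 : R)^'+
        --> sector (f (delta t)) (velocity beta t).
      by rewrite E fdelta; exact: velocity_right.
    exact: F1.
- apply: (@sector_lift f (delta t) (f (delta t)) (negv u) (negv (velocity beta t))) => //.
  + exact: linj.
  + exact: tangent_negv.
  + exact: negv_neq0.
  + exact: tangent_negv.
  + exact: negv_neq0.
  + by rewrite !negvK.
  + exact: (cvg_comp _ _ c2 (sdelta.1 t)).
  + have := dsmall (-1); rewrite normrN normr1 => /(_ erefl).
    by apply: (@filterS _ (0 : R)^'+) => x /=; rewrite mulN1r.
  + have E : f \o (fun x => delta (t - x)) = (fun x => beta (t - x)).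
      by apply/funext => x /=; exact: fdelta.
    have F1 : (f \o (fun x => delta (t - x))) @ (0 : R)^'+
        --> sector (f (delta t)) (negv (velocity beta t)).
      by rewrite E fdelta; exact: velocity_left.
    exact: F1.
Unshelve. all: by end_near. Qed.

(** If the tangent lines of delta did not converge, the points of delta with
    these lines would form a transverse sequence, but their images are points of
    beta with its tangent lines, which do converge. *)
Lemma direction_continuous (V : R -> family S) :
  (forall t, tangent_space (delta t) (V t) /\ V t <> (fun=> 0)) ->
  (forall t, (fun x => delta (t + x)) @ (0 : R)^'+ --> sector (delta t) (V t)) ->
  (forall t, (fun x => delta (t - x)) @ (0 : R)^'+ --> sector (delta t) (negv (V t))) ->
  (forall t, f @ sector (delta t) (V t) --> sector (beta t) (velocity beta t) /\
  f @ sector (delta t) (negv (V t)) --> sector (beta t) (negv (velocity beta t))) ->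
  forall t0 c (e : R), chart_at (delta t0) c -> 0 < e ->
    \forall t \near t0, exists2 a : R, a != 0 & `|a *: V t c - V t0 c| < e.
Proof.
move=> tV Vr Vl fV t0 c e pc e0; apply: contrapT => nn.
have ex (n : nat) : exists t, [/\ `|t - t0| < n.+1%:R^-1,
    `|t - t0| < 1 & forall a : R, a != 0 -> ~ `|a *: V t c - V t0 c| < e].
  apply: contrapT => no; apply: nn; apply/nbhs_normC.
  exists (Num.min n.+1%:R^-1 1); first by rewrite lt_min invr_gt0 ltr0n ltr01.
  move=> t; rewrite lt_min => /andP[t1 t2]; apply: contrapT => na; apply: no.
  by exists t; split=> // a a0 ae; apply: na; exists a.
have [t_ tP] := choice ex.
have [l_ lP] : {l_ : forall t, PT (delta t) & forall t, line (l_ t) (V t)}.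
  have H t : {l : PT (delta t) | line l (V t)}.
    by apply: cid; have [h1 h2] := tV t; exact: line_through.
  by exists (fun t => sval (H t)) => t; exact: svalP (H t).
pose u n := ProjPoint (l_ (t_ n)); pose Q := ProjPoint (l_ t0).
have lQ : line (fiber Q) (V t0) := lP t0.
have [tV0 V00] := tV t0.
have tn0 n : t_ n != t0.
  apply/eqP => tE; have [_ _ /(_ 1)] := tP n.
  by rewrite tE scale1r subrr normr0 oner_eq0; apply.
have t_cvg (r : R) : 0 < r -> \forall n \near \oo, `|t_ n - t0| < r.
  move=> r0; exists (Num.truncn r^-1) => // n /= Nn.
  have [tn _ _] := tP n; apply: (lt_trans tn).
  rewrite invf_plt ?posrE //.
  have /truncn_itv /andP[_ H2] : 0 <= r^-1 by rewrite invr_ge0 ltW.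
  by apply: (lt_le_trans H2); rewrite ler_nat; lia.
have tu : transverse_for Q u.
  split.
    apply/(converges_alongP _ lQ V00); split.
      move=> n /= E; have [_ t1 _] := tP n.
      by have := tn0 n; rewrite (simple_closed_inj sdelta t1 E) eqxx.
    move=> B [B1 B2]; have [r r0 rB] := @near_sides _ delta t0 B (Vr t0 _ B1) (Vl t0 _ B2).
    apply: (@filterS _ \oo _ _ _ _ (t_cvg r r0)) => n nr.
    exact: (rB _ (tn0 n) nr).
  move=> i ii ui.
  have nQ : nbhs Q [set X | exists w, [/\ line (fiber X) w, w <> (fun=> 0) &
      `|w c - V t0 c| < e]].
    apply/(@PTS_nbhsP _ _ Q c (V t0) _ pc lQ V00); exists e => // X w _ _ Xw w0 we.
    by exists w.
  have [N _ NP] := ui _ nQ.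
  have [w [/= uw w0 we]] := NP N (leqnn N).
  have [_ Vn0] := tV (t_ (i N)).
  have [a wE] := line_scale (lP _) Vn0 uw.
  have [_ _ /(_ a)] := tP (i N); apply; last by rewrite wE in we.
  by apply: (@scale_neq0 _ S (V (t_ (i N)))); rewrite -wE.
have [Q' [Q'u nosub]] := ht (ex_intro _ Q tu).
have Qu := dbarS_converges_along cf fi mf tu.1.
have [w [_ w0 lw]] := line_vector (fiber Q').
have [w' [_ w'0 lw']] := line_vector (fiber (dbarS f Q)).
have [_ c1] := (converges_alongP _ lw w0).1 Q'u.
have [_ c2] := (converges_alongP _ lw' w'0).1 Qu.
have cb p v : bisector p v --> p by move=> A pA; split; exact: sector_nbhs.
have bE : base Q' = base (dbarS f Q).
  apply: (@cvg_unique _ (@carrier_hausdorff _ S)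
    ((base \o (dbarS f \o u)) @ \oo)).
    exact: cvg_trans c1 (cb _ _).
  exact: cvg_trans c2 (cb _ _).
(* The image sequence is transverse for some Q'; since it converges along a
   line to a unique point and along a unique line, Q' is the image of Q. *)
have QE : Q' = dbarS f Q.
  rewrite bE in c1.
  have tw : tangent_space (base (dbarS f Q)) w.
    by rewrite -bE; exact: line_tangent lw.
  have [a w'E] := bisector_unique _ tw (line_tangent lw') w0 w'0 c1 c2.
  apply: (@PTS_eq _ _ _ _ w' bE) => //.
  by rewrite (line_spanned lw w0); exists a.
have lineb t : line (fiber (dbarS f (ProjPoint (l_ t)))) (velocity beta t).
  have [_ Vt0] := tV t.
  have /= := line_image_vector (dbar_line_image (l_ t) cf fi mf) (lP t) Vt0.
  move=> [z [mz z0 fz _]].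
  have [tb b0] := velocity_tangent t Cb.
  have [fVt _] := fV t; rewrite -(fdelta t) in tb fVt.
  have [a _ bzE] := sector_unique _ (line_tangent mz) tb z0 b0 fz fVt.
  by rewrite (line_spanned mz z0); exists a.
apply: (nosub id) => // A; rewrite QE.
have [c' ac' cq] := atlas_cover (beta t0).
have qc : chart_at (beta t0) c' by [].
have qc' : chart_at (base (dbarS f Q)) c' by rewrite /= fdelta.
have [_ b0] := velocity_tangent t0 Cb.
move=> /(PTS_nbhsP _ qc' (lineb t0) b0)[r r0 rA].
have [cbeta _ dbeta] := Cb.
have [_ dcont _] := dbeta _ _ qc.
have n1 : nbhs t0 (beta @^-1` dom c') := cbeta t0 _ (dom_nbhs cq).
have n2 : nbhs t0 [set t | `|c' (beta t) - c' (beta t0)| < r].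
  have cc : {for t0, continuous (c' \o beta)}.
    by apply: continuous_comp; [exact: cbeta|exact: to_plane_continuous cq].
  exact: (cc _ (near_normC _ r0)).
have n3 : nbhs t0 [set t | `|derive1 (c' \o beta) t - derive1 (c' \o beta) t0| < r].
  exact: (dcont _ (near_normC _ r0)).
have [d d0 dP] := (nbhs_normC _ _).1 (filterI n1 (filterI n2 n3)).
apply: (@filterS _ \oo _ _ _ _ (t_cvg d d0)) => n /dP[/= k1 [k2 k3]].
have [_ bn0] := velocity_tangent (t_ n) Cb.
have bc : chart_at (beta (t_ n)) c' by [].
apply: (rA _ (velocity beta (t_ n)) _ _ (lineb _) bn0).
- by rewrite /= fdelta.
- by rewrite /= !fdelta.
- by rewrite !velocityE.
Qed.

End DirectionField.

(** * Differentiation with respect to a coordinate *)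

Section RelativeDerivative.
Context {R : realType}.
Implicit Types (X Y : R -> R) (s t : R).

(** The derivative dF/dX at t. It makes sense for paths that are not
    differentiable in t but are so after a reparametrization by X. *)
Definition rderiv (V : normedModType R) X (F : R -> V) t (d : V) : Prop :=
  (fun s => (X s - X t)^-1 *: (F s - F t)) @ t^' --> d.

(** X is a local coordinate at t: it is continuous and locally separates t from
    the nearby points. *)
Definition separates X t : Prop := (fun s => X s - X t) @ t^' --> (0 : R)^'.

Lemma separates_neq X t : separates X t -> \forall s \near t^', X s - X t != 0.
Proof.
move=> sX; have n0 : (0 : R)^' [set x | x != 0].
  by apply: (@filterS _ (nbhs (0 : R)) _ setT) => //; exact: filterT.
exact: (sX _ n0).
Qed.

Lemma separates_cvg0 X t : separates X t -> (fun s => X s - X t) @ t^' --> (0 : R).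
Proof. by move=> sX; apply: (cvg_trans sX); exact: cvg_within. Qed.

Lemma rderiv_comp (V W : normedModType R) X (F : R -> V) (T : V -> W) t d :
  separates X t -> rderiv X F t d -> differentiable T (F t) ->
  rderiv X (T \o F) t ('d T (F t) d).
Proof.
move=> sX dF dT.
pose k s := (X s - X t, (X s - X t)^-1 *: (F s - F t)).
have ck : k @ t^' --> filter_prod (0 : R)^' (nbhs d).
  move=> A [[P Q] /= [P0 Qd] PQA].
  apply: (@filterS2 _ t^' _ _ _ _ _ (sX _ P0) (dF _ Qd)) => s Ps Qs.
  exact: (PQA (k s)).
have := cvg_comp _ _ ck (diff_quotient_cvg (d := d) dT).
apply: cvg_trans; apply: near_eq_cvg.
apply: (@filterS _ t^' _ _ _ _ (separates_neq sX)) => s s0 /=.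
by rewrite scalerA divff // scale1r [F t + _]addrC subrK.
Qed.

Lemma rderiv_near_eq (V : normedModType R) X (F G : R -> V) t d :
  (\forall s \near t, F s = G s) -> rderiv X F t d -> rderiv X G t d.
Proof.
move=> FG; apply: cvg_trans; apply: near_eq_cvg.
have FGt := nbhs_singleton FG.
have nFG : \forall s \near t^', F s = G s.
  by apply: (@filterS _ (nbhs t) _ _ _ _ FG) => s.
by apply: (@filterS _ t^' _ _ _ _ nFG) => s ->; rewrite FGt.
Qed.

Lemma rderiv_cst (V : normedModType R) X t (a : V) : rderiv X (cst a) t 0.
Proof.
rewrite /rderiv; have -> : (fun s => (X s - X t)^-1 *: (cst a s - cst a t)) = cst 0.
  by apply/funext => s /=; rewrite subrr scaler0.
exact: cvg_cst.
Qed.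

Lemma rderivD (V : normedModType R) X (F G : R -> V) t a b :
  rderiv X F t a -> rderiv X G t b -> rderiv X (fun s => F s + G s) t (a + b).
Proof.
move=> dF dG; rewrite /rderiv.
have -> : (fun s => (X s - X t)^-1 *: (F s + G s - (F t + G t))) =
    (fun s => (X s - X t)^-1 *: (F s - F t) + (X s - X t)^-1 *: (G s - G t)).
  by apply/funext => s; rewrite -scalerDr opprD addrACA.
exact: cvgD.
Qed.

Lemma rderiv_cvg (V : normedModType R) X (F : R -> V) t d :
  separates X t -> rderiv X F t d -> {for t, continuous F}.
Proof.
move=> sX dF A nA.
have c1 : (fun s => F t + (X s - X t) *: ((X s - X t)^-1 *: (F s - F t))) @ t^'
    --> F t + (0 : R) *: d.
  apply: cvgD; first exact: cvg_cst.
  by apply: cvgZ => //; exact: separates_cvg0.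
rewrite scale0r addr0 in c1.
have : t^' [set s | A (F s)].
  apply: (@filterS2 _ t^' _ _ _ _ _ (c1 _ nA) (separates_neq sX)) => s /= + s0.
  by rewrite scalerA divff // scale1r addrC subrK.
rewrite /dnbhs /within /=; apply: (@filterS _ (nbhs t)) => s.
have [->|st] := eqVneq s t; first by move=> _; exact: nbhs_singleton nA.
exact.
Qed.

Lemma rderiv_ratio (V : normedModType R) X Y (F : R -> V) t a d : separates X t ->
  rderiv X Y t a -> a != 0 -> rderiv X F t d -> rderiv Y F t (a^-1 *: d).
Proof.
move=> sX dY a0 dF.
have C : (fun s => ((X s - X t)^-1 *: (Y s - Y t))^-1 *:
    ((X s - X t)^-1 *: (F s - F t))) @ t^' --> a^-1 *: d.
  exact: (cvgZ (cvgV a0 dY) dF).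
apply: cvg_trans C; apply: near_eq_cvg.
apply: (@filterS _ t^' _ _ _ _ (separates_neq sX)) => s s0 /=.
rewrite scalerA; congr (_ *: _).
by rewrite /GRing.scale /= invfM invrK mulrAC divff ?mul1r.
Qed.

(** Two increasing coordinates are compared through the speeds of one and the
    same path. *)
Lemma rderiv_speed (V : normedModType R) X Y (F : R -> V) t a b :
  (\forall s \near t^', (0 < X s - X t) = (0 < Y s - Y t)) ->
  separates X t -> separates Y t -> rderiv X F t a -> rderiv Y F t b -> a != 0 ->
  rderiv Y X t (`|b| / `|a|).
Proof.
move=> XY sX sY dX dY a0.
have na0 : `|a| != 0 by rewrite normr_eq0.
have C : (fun s => `|(Y s - Y t)^-1 *: (F s - F t)| /
    `|(X s - X t)^-1 *: (F s - F t)|) @ t^' --> `|b| / `|a|.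
  exact: (cvgM (cvg_norm dY) (cvgV na0 (cvg_norm dX))).
apply: cvg_trans C; apply: near_eq_cvg.
have nF : \forall s \near t^', F s != F t.
  have nb : nbhs a [set z | z != 0].
    apply/nbhs_normC; exists `|a|; first by rewrite normr_gt0.
    by move=> z; apply: contraTneq => ->; rewrite sub0r normrN ltxx.
  apply: (@filterS _ t^' _ _ _ _ (dX _ nb)) => s /=; apply: contra => /eqP ->.
  by rewrite subrr scaler0.
apply: (@filterS2 _ t^' _ _ _ _ _ (filterI XY nF)
  (filterI (separates_neq sX) (separates_neq sY))) => s /= [xy Fs] [x0 y0].
rewrite !normrZ !normfV.
have f0 : `|F s - F t| != 0 by rewrite normr_eq0 subr_eq0.
have nx0 : `|X s - X t| != 0 by rewrite normr_eq0.
have ny0 : `|Y s - Y t| != 0 by rewrite normr_eq0.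
have -> : `|Y s - Y t|^-1 * `|F s - F t| / (`|X s - X t|^-1 * `|F s - F t|) =
    `|X s - X t| / `|Y s - Y t| by field; rewrite f0 nx0 ny0.
move: xy x0 y0; have [x0|x0|x0] := ltrgtP 0 (X s - X t); last by move=> _ /negP[].
  by move=> /esym y0 _ _; rewrite !gtr0_norm // mulrC.
move=> /esym/negbT; rewrite -leNgt => y0 _ yn0.
have {yn0}y0 : Y s - Y t < 0 by rewrite lt_neqAle yn0.
by rewrite !ltr0_norm // invrN mulrNN mulrC.
Qed.

End RelativeDerivative.

(** * Coordinates along a curve with continuous directions *)

Section NoExtremum.
Context {R : realType}.
Implicit Types (X : R -> R) (s t : R).

(** A maximum or a minimum is interior unless X is constant. *)
Lemma segment_extremum X (a b : R) : a < b -> {within `[a, b], continuous X} ->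
  X a = X b -> exists2 m, a < m < b &
    (forall s, a < s < b -> X s <= X m) \/ (forall s, a < s < b -> X m <= X s).
Proof.
move=> ab cX Xab.
have sub s : a < s < b -> s \in `[a, b].
  by rewrite in_itv /= => /andP[/ltW -> /ltW ->].
have [m mab mM] := EVT_max (ltW ab) cX.
have [n nab nM] := EVT_min (ltW ab) cX.
have inner s : s \in `[a, b] -> X s <> X a -> a < s < b.
  rewrite in_itv /= !le_eqVlt => /andP[/orP[/eqP<-//|->]] /orP[/eqP->|-> //].
  by rewrite Xab.
have [mE|/inner mi] := pselect (X m = X a); last first.
  by exists m; [exact: mi|left => s /sub; exact: mM].
have [nE|/inner ni] := pselect (X n = X a); last first.
  by exists n; [exact: ni|right => s /sub; exact: nM].
exists ((a + b) / 2); first by apply/andP; split; lra.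
left => s /sub sab; apply: (le_trans (mM _ sab)); rewrite mE -nE; apply: nM.
by apply: sub; apply/andP; split; lra.
Qed.

(** Equal values at two points would give an extremum in between, so X is
    strictly monotone; its behaviour at t0 tells in which direction. *)
Lemma no_extremum_monotone X (t0 e : R) :
  (forall t, `|t - t0| < e -> {for t, continuous X}) ->
  (forall t, `|t - t0| < e -> exists2 r, 0 < r &
     (forall x, 0 < x < r -> X (t - x) < X t < X (t + x)) \/
     (forall x, 0 < x < r -> X (t + x) < X t < X (t - x))) ->
  (exists2 r, 0 < r & forall x, 0 < x < r -> X (t0 - x) < X t0 < X (t0 + x)) ->
  forall s t, `|s - t0| < e -> `|t - t0| < e -> s < t -> X s < X t.
Proof.
move=> cX mX [r0 r00 r0P] s t se te st.
have inE x : (x \in `]t0 - e, t0 + e[) = (`|x - t0| < e).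
  by rewrite in_itv /= ltr_distl.
have e0 : 0 < e by apply: le_lt_trans se.
have cW : {within [set` `]t0 - e, t0 + e[], continuous X}.
  by apply: continuous_in_subspaceT => x /set_mem /=; rewrite inE; exact: cX.
have noeq a b : `|a - t0| < e -> `|b - t0| < e -> a < b -> X a <> X b.
  move=> ae be ab Xab.
  have [|m /andP[am mb] ext] := segment_extremum ab _ Xab.
    apply: continuous_subspaceW cW => x /=; rewrite in_itv /= inE => /andP[ax xb].
    by move: ae be; rewrite !ltr_norml; lra.
  have [|r r_gt0 rP] := mX m; first by move: ae be; rewrite !ltr_norml; lra.
  pose x := Num.min (r / 2) (Num.min ((m - a) / 2) ((b - m) / 2)).
  have x0 : 0 < x by rewrite !lt_min !divr_gt0 // subr_gt0.
  have xr : x <= r / 2 by rewrite ge_min lexx.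
  have xa : x <= (m - a) / 2 by rewrite /x !ge_min lexx !orbT.
  have xb : x <= (b - m) / 2 by rewrite /x !ge_min lexx !orbT.
  have i1 : a < m - x < b by apply/andP; split; lra.
  have i2 : a < m + x < b by apply/andP; split; lra.
  have xx : 0 < x < r by apply/andP; split; lra.
  case: ext => ext; have := ext _ i1; have := ext _ i2;
    case: rP => /(_ x xx)/andP[]; lra.
have [] := itv_continuous_inj_mono cW.
- move=> a b; rewrite !inE => ae be Xab.
  have [ab|ab|//] := ltgtP a b; first by case: (noeq a b).
  by case: (noeq b a).
- by move=> H; apply: H; rewrite ?inE.
move=> H; pose x := Num.min (r0 / 2) (e / 2).
have x0 : 0 < x by rewrite lt_min !divr_gt0.
have xr : x <= r0 / 2 by rewrite ge_min lexx.
have xe : x <= e / 2 by rewrite ge_min lexx orbT.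
have /andP[_ X1] : X (t0 - x) < X t0 < X (t0 + x) by apply: r0P; apply/andP; split; lra.
have : X (t0 + x) < X t0.
  apply: H; rewrite ?inE ?subrr ?normr0 //; last by rewrite ltrDl.
  by rewrite addrC addKr gtr0_norm //; lra.
by move=> X2; have := lt_trans X1 X2; rewrite ltxx.
Qed.

End NoExtremum.

Section LocalCoordinate.
Context {R : realType} (S : smoothSurface R).
Implicit Types (c : chart R S) (v w : family S) (s t : R).

Variables (delta : R -> S) (V : R -> family S).
Hypotheses (sdelta : simple_closed delta)
  (tV : forall t, tangent_space (delta t) (V t) /\ V t <> (fun=> 0))
  (Vr : forall t, (fun x => delta (t + x)) @ (0 : R)^'+ --> sector (delta t) (V t))
  (Vl : forall t,
    (fun x => delta (t - x)) @ (0 : R)^'+ --> sector (delta t) (negv (V t)))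
  (Vc : forall t0 c (e : R), chart_at (delta t0) c -> 0 < e ->
    \forall t \near t0, exists2 a : R, a != 0 & `|a *: V t c - V t0 c| < e).

Let dotv_cvg (v z : plane R) : dot v @ z --> dot v z.
Proof.
have c1 : (fun b : plane R => b.1) @ z --> z.1 by exact: cvg_fst.
have c2 : (fun b : plane R => b.2) @ z --> z.2 by exact: cvg_snd.
by apply: cvgD; apply: cvgM => //; exact: cvg_cst.
Qed.

Let dotZ (v z : plane R) (a : R) : dot v (a *: z) = a * dot v z.
Proof. by rewrite /dot /= /GRing.scale /= mulrDr !(mulrCA a). Qed.

Let dotD (v z y : plane R) : dot v (z + y) = dot v z + dot v y.
Proof. by rewrite /dot /=; ring. Qed.

Let dotB (v z y : plane R) : dot v (z - y) = dot v z - dot v y.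
Proof. by rewrite /dot /=; ring. Qed.

(** The coordinate is the component of delta along V t0 in the chart. For t near
    t0, V t is close to a multiple of V t0, so that the difference quotients of
    delta with respect to X converge to the normalization of V t from both
    sides. The two sides of delta at t are opposite, hence X has no local
    extremum at t, which excludes cusps, and X is increasing by
    [no_extremum_monotone]. *)
Lemma local_coordinate t0 c : chart_at (delta t0) c ->
  let X := fun t => dot (V t0 c) (c (delta t)) in
  exists2 e : R, 0 < e & [/\
    forall t, `|t - t0| < e -> dom c (delta t),
    forall t, `|t - t0| < e -> {for t, continuous X},
    forall s t, `|s - t0| < e -> `|t - t0| < e -> s < t -> X s < X t &
    exists D : R -> plane R, forall t, `|t - t0| < e ->
      [/\ rderiv X (c \o delta) t (D t), D t != 0 & {for t, continuous D}]].
Proof.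
move=> pc X; have [tV0 V0] := tV t0.
pose v0 := V t0 c; have v00 : v0 != 0 by exact: (tangent_neq0 pc tV0 V0).
have vv := plane_neq0 v00.
have [r r0 rP] : exists2 r : R, 0 < r & forall z, `|z - v0| < r -> 0 < dot v0 z.
  apply/nbhs_normC; apply: (@dotv_cvg v0 v0 [set x | 0 < x]).
  by apply: open_nbhs_nbhs; split=> //; exact: open_gt.
have nd : nbhs t0 [set t | dom c (delta t)] := sdelta.1 t0 _ (dom_nbhs pc.2).
have [e e0 eP] := (nbhs_normC _ _).1 (filterI nd (Vc pc r0)).
have domc t : `|t - t0| < e -> dom c (delta t) by move=> /eP[].
have dot0 t : `|t - t0| < e -> dot v0 (V t c) != 0.
  move=> /eP[_ /= [a a0 /rP]]; rewrite dotZ => H.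
  by apply: contraTneq H => ->; rewrite mulr0 ltxx.
have cd t : `|t - t0| < e -> {for t, continuous (c \o delta)}.
  move=> te; apply: continuous_comp; first exact: sdelta.1.
  by apply: to_plane_continuous; exact: domc.
have cX t : `|t - t0| < e -> {for t, continuous X}.
  move=> te; exact: (cvg_comp _ _ (cd t te) (@dotv_cvg v0 _)).
exists e => //.
pose D t := (dot v0 (V t c))^-1 *: V t c.
pose Phi t q := (dot v0 (c q - c (delta t)))^-1 *: (c q - c (delta t)).
have psi (z : plane R) : dot v0 z != 0 ->
    (fun b => (dot v0 b)^-1 *: b) @ z --> (dot v0 z)^-1 *: z.
  by move=> z0; apply: cvgZ; [apply: cvgV => //; exact: dotv_cvg|move=> A].
have Phi_sector t w : `|t - t0| < e -> tangent_space (delta t) w ->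
    dot v0 (w c) != 0 ->
    Phi t @ sector (delta t) w --> (dot v0 (w c))^-1 *: w c.
  move=> te tw w0 A /(psi _ w0)/nbhs_normC[d d0 dA].
  have tc : chart_at (delta t) c by split; [exact: pc.1|exact: domc].
  apply/(sectorP _ tw tc); exists d => // q [_ [x [b [/andP[x0 _] bd cqE]]]].
  rewrite /Phi /= cqE addrC addKr dotZ invfM scalerA mulrAC mulVf ?gt_eqF // mul1r.
  exact: dA.
have rdX t : `|t - t0| < e -> rderiv X (c \o delta) t (D t).
  move=> te A nA; have [tVt Vt0] := tV t; have d0 := dot0 t te.
  have A1 := Phi_sector t (V t) te tVt d0 A nA.
  have Nd0 : dot v0 (negv (V t) c) != 0.
    by rewrite /negv -scaleN1r dotZ mulN1r oppr_eq0.
  have A2 : sector (delta t) (negv (V t)) (Phi t @^-1` A).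
    apply: (Phi_sector t (negv (V t)) te (tangent_negv tVt) Nd0).
    rewrite /negv -scaleN1r dotZ mulN1r scalerA invrN mulrN1 opprK; exact: nA.
  have [d d_gt0 dP] := @near_sides _ _ delta t _ (Vr A1) (Vl A2).
  have nd' := near_normC t d_gt0.
  rewrite /dnbhs /within /=; apply: (@filterS _ (nbhs t) _ _ _ _ nd') => s sd st.
  have := dP s st sd; rewrite /Phi /= /X dotB; exact.
have local t : `|t - t0| < e -> exists2 d : R, 0 < d &
    if 0 < dot v0 (V t c) then forall x, 0 < x < d -> X (t - x) < X t < X (t + x)
    else forall x, 0 < x < d -> X (t + x) < X t < X (t - x).
  move=> te; have [tVt Vt0] := tV t; have d0 := dot0 t te.
  have tc : chart_at (delta t) c by split; [exact: pc.1|exact: domc].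
  have side w (P : set R) : tangent_space (delta t) w -> nbhs (dot v0 (w c)) P ->
      sector (delta t) w [set q | exists y : R, 0 < y /\
        exists2 z, P z & dot v0 (c q) = dot v0 (c (delta t)) + y * z].
    move=> tw nP; apply/(sectorP _ tw tc).
    have [d d_gt0 dP] := (nbhs_normC _ _).1 (dotv_cvg nP).
    exists d => // q [_ [x [b [/andP[x0 _] bd cqE]]]] /=.
    exists x; split=> //; exists (dot v0 b); first exact: dP.
    by rewrite cqE dotD dotZ.
  have Ndot : dot v0 (negv (V t) c) = - dot v0 (V t c).
    by rewrite /negv -scaleN1r dotZ mulN1r.
  have pos (w : R) : 0 < w -> nbhs w [set z | 0 < z].
    by move=> w0; apply: open_nbhs_nbhs; split=> //; exact: open_gt.
  have neg (w : R) : w < 0 -> nbhs w [set z | z < 0].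
    by move=> w0; apply: open_nbhs_nbhs; split=> //; exact: open_lt.
  have comb (P Q : set R) : nbhs (dot v0 (V t c)) P -> nbhs (- dot v0 (V t c)) Q ->
      exists2 d : R, 0 < d & forall x, 0 < x < d ->
        (exists y : R, 0 < y /\ exists2 z, P z & X (t + x) = X t + y * z) /\
        (exists y : R, 0 < y /\ exists2 z, Q z & X (t - x) = X t + y * z).
    move=> nP nQ.
    have := Vr (side _ _ tVt nP) => /nbhs_normC[d1 d10 H1].
    rewrite -Ndot in nQ.
    have := Vl (side _ _ (tangent_negv tVt) nQ) => /nbhs_normC[d2 d20 H2].
    exists (Num.min d1 d2); first by rewrite lt_min d10.
    move=> x /andP[x0]; rewrite lt_min => /andP[x1 x2]; split.
      by apply: H1 => //; rewrite subr0 gtr0_norm.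
    by apply: H2 => //; rewrite subr0 gtr0_norm.
  have [dn|dp|dE] := ltrgtP (dot v0 (V t c)) 0; last by rewrite dE eqxx in d0.
    have Nd : 0 < - dot v0 (V t c) by rewrite oppr_gt0.
    have [d d_gt0 dP] := comb _ _ (neg _ dn) (pos _ Nd).
    exists d => // x /dP[[y [y0 [z z0 ->]]] [y' [y'0 [z' z'0 ->]]]].
    by rewrite gtrDl ltrDl pmulr_rlt0 // z0 mulr_gt0.
  have Nd : - dot v0 (V t c) < 0 by rewrite oppr_lt0.
  have [d d_gt0 dP] := comb _ _ (pos _ dp) (neg _ Nd).
  exists d => // x /dP[[y [y0 [z z0 ->]]] [y' [y'0 [z' z'0 ->]]]].
  by rewrite gtrDl ltrDl pmulr_rlt0 // z'0 mulr_gt0.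
have mono : forall s t, `|s - t0| < e -> `|t - t0| < e -> s < t -> X s < X t.
  apply: no_extremum_monotone => //.
    move=> t /local[d d0 dP]; exists d => //.
    by move: dP; case: ifP => _ dP; [left|right].
  have [|d d0] := local t0; first by rewrite subrr normr0.
  by rewrite vv => dP; exists d.
split=> //.
exists D => t te; split; first exact: rdX.
  rewrite scaler_eq0 invr_eq0 negb_or dot0 //.
  have [tVt Vt0] := tV t.
  by apply: (tangent_neq0 _ tVt Vt0); split; [exact: pc.1|exact: domc].
move=> A /(psi _ (dot0 t te))/nbhs_normC[d d0 dA].
have tc : chart_at (delta t) c by split; [exact: pc.1|exact: domc].
apply: (@filterS _ (nbhs t) _ _ _ _ (Vc tc d0)) => s [a a0 /dA].
by rewrite /= dotZ invfM scalerA mulrAC mulVf // mul1r.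
Qed.

End LocalCoordinate.

Section SmoothStep.
Context {R : realType}.
Implicit Types (u x : R).

(** A C^1 function equal to 0 before 0 and to 1 after 1, with a positive
    derivative in between. *)
Definition smoothstep u : R := 2 * pos2 u - 4 * pos2 (u - 1/2) + 2 * pos2 (u - 1).

Definition smoothstep' u : R :=
  2 * (2 * Num.max 0 u) - 4 * (2 * Num.max 0 (u - 1/2)) +
  2 * (2 * Num.max 0 (u - 1)).

Lemma is_derive_smoothstep u : is_derive u 1 smoothstep (smoothstep' u).
Proof.
have sh a : is_derive u 1 (fun u => pos2 (u - a)) (2 * Num.max 0 (u - a)).
  have d1 : is_derive u 1 (fun u => u - a) 1.
    apply: is_derive_of_bound => e e0; exists e => // k ke.
    have -> : u + k - a - (u - a) - k * 1 = 0 by ring.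
    by rewrite normr0 mulr_ge0 // ltW.
  have := @is_derive1_comp R pos2 (fun u => u - a) u _ _ (is_derive_pos2 _) d1.
  by rewrite mulr1.
have d0 := is_deriveZ 2 (is_derive_pos2 u).
have d1 := is_deriveZ 4 (sh (1/2)).
have d2 := is_deriveZ 2 (sh 1).
exact: (is_deriveD (is_deriveB d0 d1) d2).
Qed.

Lemma smoothstep_le0 u : u <= 0 -> smoothstep u = 0.
Proof. by move=> u0; rewrite /smoothstep !pos2_eq0; lra. Qed.

Lemma smoothstep_ge1 u : 1 <= u -> smoothstep u = 1.
Proof.
move=> u1; rewrite /smoothstep /pos2 !max_r; [|lra..].
by field.
Qed.

Lemma smoothstep'_ge0 u : 0 <= smoothstep' u /\ (0 < u < 1 -> 0 < smoothstep' u).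
Proof.
rewrite /smoothstep'; have [|] := leP 0 u; have [|] := leP 0 (u - 1/2);
  have [|] := leP 0 (u - 1) => *; split; try (move=> /andP[*]); lra.
Qed.

Lemma smoothstep'_continuous : continuous smoothstep'.
Proof.
have m a : continuous (fun u => Num.max 0 (u - a)).
  move=> u; apply: (@continuous_comp _ _ _ (fun u => u - a)); last exact: max0_cvg.
  exact: addc_continuous.
have mM (f : R -> R) k : continuous f -> continuous (fun u => k * f u).
  by move=> cf u; apply: (@cvgM _ _ _ _ (cst k)); [exact: cvg_cst|exact: cf].
move=> u; apply: (@cvgD _ _ _ _ _
  (fun u => 2 * (2 * Num.max 0 u) - 4 * (2 * Num.max 0 (u - 1/2)))).
  apply: (@cvgB _ _ _ _ _ (fun u => 2 * (2 * Num.max 0 u))).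
    exact: (mM (fun u => 2 * Num.max 0 u) 2 (mM _ 2 max0_cvg)).
  exact: (mM (fun u => 2 * Num.max 0 (u - 1/2)) 4 (mM _ 2 (m (1/2)))).
exact: (mM (fun u => 2 * Num.max 0 (u - 1)) 2 (mM _ 2 (m 1))).
Qed.

End SmoothStep.

Section Coordinate.
Context {R : realType} (S : smoothSurface R).
Implicit Types (c : chart R S) (s t : R) (X Y : R -> R) (k : int).

Variable delta : R -> S.
Hypothesis sdelta : simple_closed delta.

(** The last clause makes delta a regular C^1 path when X is taken as its
    parameter. X is periodic, so as to be a coordinate near all the translates
    of t0 as well. *)
Definition coordinate X t0 (e : R) : Prop :=
  [/\ forall t k, X (t + k%:~R) = X t,
      forall s t, `|s - t0| < e -> `|t - t0| < e -> s < t -> X s < X t,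
      forall t, `|t - t0| < e -> {for t, continuous X} &
      forall t c, `|t - t0| < e -> chart_at (delta t) c ->
        exists D : R -> plane R, [/\ \forall s \near t, rderiv X (c \o delta) s (D s),
          D t != 0 & {for t, continuous D}]].

Lemma near_ball_point t0 (e t : R) : `|t - t0| < e ->
  \forall s \near t, `|s - t0| < e.
Proof.
move=> te; apply/nbhs_normC; exists (e - `|t - t0|); first by rewrite subr_gt0.
move=> s; rewrite ltrBrDr => H; rewrite /= -(subrK t s) -addrA.
exact: le_lt_trans (ler_normD _ _) H.
Qed.

Lemma increasing_separates X t0 (e t : R) :
  (forall s t, `|s - t0| < e -> `|t - t0| < e -> s < t -> X s < X t) ->
  `|t - t0| < e -> {for t, continuous X} -> separates X t.
Proof.
move=> iX te cX A /nbhs_normC[d d0 dA].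
have n1 : nbhs t [set s | `|X s - X t| < d] := cX _ (near_normC (X t) d0).
apply: (@filterS2 _ (nbhs t) _ _ _ _ _ n1 (near_ball_point te)) => s /= sd se st.
apply: dA; rewrite ?subr0 // subr_eq0.
have [lt|lt|eq] := ltgtP s t.
- by rewrite lt_eqF //; exact: iX.
- by rewrite gt_eqF //; exact: iX.
- by rewrite eq eqxx in st.
Qed.

Lemma coordinate_separates X t0 e t : coordinate X t0 e -> `|t - t0| < e ->
  separates X t.
Proof. by move=> [_ iX cX _] te; exact: (increasing_separates iX te (cX t te)). Qed.

Lemma coordinate_shrink X t0 (e e' : R) : e' <= e -> coordinate X t0 e ->
  coordinate X t0 e'.
Proof.
move=> ee [pX iX cX dX]; split=> //.
- by move=> s t se te; apply: iX; exact: lt_le_trans ee.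
- by move=> t te; apply: cX; exact: lt_le_trans ee.
- by move=> t c te; apply: dX; exact: lt_le_trans ee.
Qed.

Lemma rderiv_shift (W : normedModType R) X (F : R -> W) t (a : R) d :
  (forall s, X (s + a) = X s) -> (forall s, F (s + a) = F s) ->
  rderiv X F t d -> rderiv X F (t + a) d.
Proof.
move=> pX pF dF A nA; have := dF A nA.
rewrite /dnbhs /within /= => /nbhs_normC[r r0 rA].
apply/nbhs_normC; exists r => // s sr sta.
have := rA (s - a); rewrite /= -addrA -opprD [a + t]addrC => /(_ sr).
rewrite -(inj_eq (addIr a)) subrK => /(_ sta).
by rewrite -(pX (s - a)) -(pF (s - a)) -(pX t) -(pF t) subrK.
Qed.

Lemma coordinate_shift X t0 e k : coordinate X t0 e ->
  coordinate X (t0 + k%:~R) e.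
Proof.
move=> [pX iX cX dX].
have sh s : `|s - (t0 + k%:~R)| < e -> `|s - k%:~R - t0| < e.
  by rewrite opprD addrA addrAC.
have pXN s : X (s - k%:~R) = X s by rewrite -(pX (s - k%:~R) k) subrK.
have pd s : delta (s + k%:~R) = delta s by exact: simple_closed_period.
have pdN s : delta (s - k%:~R) = delta s by rewrite -(pd (s - k%:~R)) subrK.
split=> //.
- move=> s t /sh se /sh te st; rewrite -(pXN s) -(pXN t).
  by apply: iX => //; rewrite ltrD2r.
- move=> t /sh te.
  have -> : X = (X \o (fun s => s - k%:~R)) by apply/funext => s /=; rewrite pXN.
  by apply: continuous_comp; [exact: addc_continuous|exact: cX].
- move=> t c /sh te tc; rewrite -pdN in tc.
  have [D [nD D0 cD]] := dX _ _ te tc.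
  have cs : {for t, continuous (fun s : R => s - k%:~R)} by exact: addc_continuous.
  exists (D \o (fun s => s - k%:~R)); split; [|exact: D0|].
    have : \forall s \near t, rderiv X (c \o delta) (s - k%:~R) (D (s - k%:~R)).
      exact: (cs _ nD).
    apply: (@filterS _ (nbhs t)) => s ds.
    rewrite -[s in rderiv _ _ s _](subrK k%:~R).
    by apply: rderiv_shift => // x /=; rewrite pd.
  exact: continuous_comp cs cD.
Qed.

(** Two coordinates are C^1 functions of each other: the ratio of the lengths
    of the derivatives of delta, in one chart, is the derivative of X with
    respect to Y. *)
Lemma coordinate_compare X Y t0 t1 e e' t : coordinate X t0 e ->
  coordinate Y t1 e' -> `|t - t0| < e -> `|t - t1| < e' ->
  exists ka : R -> R, [/\ \forall s \near t, rderiv Y X s (ka s), 0 < ka t &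
    {for t, continuous ka}].
Proof.
move=> CX CY te te'; have [_ iX cX dX] := CX; have [_ iY cY dY] := CY.
have [c ac ct] := atlas_cover (delta t); have tc : chart_at (delta t) c by [].
have [D [nD D0 cD]] := dX _ _ te tc; have [D' [nD' D'0 cD']] := dY _ _ te' tc.
exists (fun s => `|D' s| / `|D s|); split.
- have nD0 : \forall s \near t, D s != 0.
    have nb : nbhs (D t) [set z | z != 0] by exact: open_nbhs_nbhs (conj open_nonzero D0).
    exact: (cD _ nb).
  apply: (@filterS3 _ (nbhs t) _ _ _ _ _ _ (filterI nD nD')
    (filterI (near_ball_point te) (near_ball_point te')) nD0).
  move=> s [ds ds'] [se se'] Ds0.
  apply: (rderiv_speed _ (coordinate_separates CX se) (coordinate_separates CY se') ds ds') => //.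
  have nn : \forall r \near s^', `|r - t0| < e /\ `|r - t1| < e'.
    apply: (@filterS2 _ (nbhs s) _ _ _ _ _ (near_ball_point se) (near_ball_point se')).
    by move=> r r1 r2 _.
  have nq : \forall r \near s^', r != s by exact: nbhs_dnbhs_neq.
  apply: (@filterS2 _ s^' _ _ _ _ _ nn nq) => r [r1 r2] rs.
  rewrite !subr_gt0; have [lt|lt|eq] := ltgtP s r; last by rewrite eq eqxx in rs.
    by rewrite (iX s r se r1 lt) (iY s r se' r2 lt).
  by rewrite (lt_gtF (iX r s r1 se lt)) (lt_gtF (iY r s r2 se' lt)).
- by rewrite divr_gt0 // normr_gt0.
apply: cvgM; first exact: cvg_norm.
by apply: cvgV; [rewrite normr_eq0|exact: cvg_norm].
Qed.

End Coordinate.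

(** * Gluing the coordinates into one parameter *)

Section Gluing.
Context {R : realType} (S : smoothSurface R).
Implicit Types (c : chart R S) (s t : R) (X Y : R -> R) (k : int).

Variables (delta : R -> S) (V : R -> family S).
Hypotheses (sdelta : simple_closed delta)
  (tV : forall t, tangent_space (delta t) (V t) /\ V t <> (fun=> 0))
  (Vr : forall t, (fun x => delta (t + x)) @ (0 : R)^'+ --> sector (delta t) (V t))
  (Vl : forall t,
    (fun x => delta (t - x)) @ (0 : R)^'+ --> sector (delta t) (negv (V t)))
  (Vc : forall t0 c (e : R), chart_at (delta t0) c -> 0 < e ->
    \forall t \near t0, exists2 a : R, a != 0 & `|a *: V t c - V t0 c| < e).

(** Only the passage from the chart of the coordinate to another chart is left;
    it multiplies the derivative by the differential of the transition. *)
Lemma coordinate_exists t0 : exists X, exists2 e : R, 0 < e <= 1/4 &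
  coordinate delta X t0 e.
Proof.
have [c ac ct] := atlas_cover (delta t0); have pc : chart_at (delta t0) c by [].
have [e e0 [domc cX iX [D dX]]] := local_coordinate sdelta tV Vr Vl Vc pc.
set X := fun t => dot (V t0 c) (c (delta t)) in cX iX dX.
exists X, (Num.min e (1/4)).
  by rewrite lt_min e0 ge_min lexx orbT andbT; lra.
apply: (@coordinate_shrink _ _ delta X t0 e); first by rewrite ge_min lexx.
split=> //.
  by move=> t k; rewrite /X simple_closed_period.
move=> t c' te tc'.
have tc : chart_at (delta t) c by split=> //; exact: domc.
pose T := transition c c'; pose U := c @` (dom c `&` dom c').
have oU : open U by apply: chart_image_open; exact: dom_open.
have Ut : U (c (delta t)) by exists (delta t) => //; split; [exact: tc.2|exact: tc'.2].
have [/(_ 1%N) C1 _] := atlas_compatible ac tc'.1.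
have [_ Dt0 cD] := dX t te.
have nc' : \forall s \near t, dom c' (delta s) := sdelta.1 t _ (dom_nbhs tc'.2).
have nc : \forall s \near t, dom c (delta s) := sdelta.1 t _ (dom_nbhs tc.2).
have nE : \forall s \near t, \forall x \near s, (T \o (c \o delta)) x = (c' \o delta) x.
  have : \forall s \near t, \forall x \near s, dom c (delta x) by exact: (near_join nc).
  apply: (@filterS _ (nbhs t)) => s.
  by apply: (@filterS _ (nbhs s)) => x cx; rewrite /= /T transition_val.
exists (fun s => (fun y u : plane R => 'd T y u) (c (delta s)) (D s)); split.
- apply: (@filterS3 _ (nbhs t) _ _ _ _ _ _ (filterI nc nc') nE (near_ball_point te)).
  move=> s [cs cs'] Es se; have [ds _ _] := dX s se.
  have sX : separates X s by exact: (increasing_separates iX se (cX s se)).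
  have dT : differentiable T (c (delta s)) by apply: C1.1; exists (delta s).
  exact: (rderiv_near_eq Es (rderiv_comp (F := c \o delta) sX ds dT)).
- exact: (transition_diff_neq0 tc tc' Dt0).
have cc : {for t, continuous (c \o delta)}.
  by apply: continuous_comp; [exact: sdelta.1|exact: to_plane_continuous tc.2].
have c1 : (fun s => (c (delta s), D s)) @ t --> (c (delta t), D t).
  move=> A [[P Q] /= [Pn Qn] PQA].
  apply: (@filterS2 _ (nbhs t) _ _ _ _ _ (cc _ Pn) (cD _ Qn)) => s Ps Qs.
  exact: (PQA (c (delta s), D s)).
exact: (cvg_comp _ _ c1 (diff_joint_continuous (w := D t) oU C1 Ut)).
Qed.

Definition step X t0 (e : R) t : R :=
  if t < t0 - e / 2 then 0 else if t0 + e / 2 < t then 1 else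
  smoothstep ((X t - X (t0 - e / 2)) / (X (t0 + e / 2) - X (t0 - e / 2))).

(** A degree one map of the circle: it increases by 1 around each translate of
    t0, smoothly with respect to X, and is locally constant elsewhere. *)
Definition periodic_step X t0 (e : R) t : R :=
  (Num.floor (t - (t0 - e / 2)))%:~R +
  step X t0 e (t - (Num.floor (t - (t0 - e / 2)))%:~R).

Lemma periodic_step1 X t0 e t :
  periodic_step X t0 e (t + 1) = periodic_step X t0 e t + 1.
Proof.
rewrite /periodic_step.
have -> : Num.floor (t + 1 - (t0 - e / 2)) = Num.floor (t - (t0 - e / 2)) + 1.
  apply: floor_def; have /andP[h1 h2] := floor_itv (t - (t0 - e / 2)).
  by apply/andP; move: h1 h2; rewrite !intrD; split; lra.
have -> : t + 1 - (Num.floor (t - (t0 - e / 2)) + 1)%:~R =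
    t - (Num.floor (t - (t0 - e / 2)))%:~R by rewrite intrD; ring.
by rewrite intrD addrAC.
Qed.

Let step_left X t0 (e : R) t : t < t0 - e / 2 -> step X t0 e t = 0.
Proof. by rewrite /step => ->. Qed.

Let step_right X t0 (e : R) t : 0 < e -> t0 + e / 2 < t -> step X t0 e t = 1.
Proof.
move=> e0 ht; rewrite /step ht; case: ifP => // H.
by have := lt_trans ht H; lra.
Qed.

Let step_smooth X t0 (e : R) t : 0 < e -> coordinate delta X t0 e ->
  `|t - t0| < e ->
  step X t0 e t =
    smoothstep ((X t - X (t0 - e / 2)) / (X (t0 + e / 2) - X (t0 - e / 2))).
Proof.
move=> e0 [_ iX _ _] te.
have ae : `|t0 - e / 2 - t0| < e by rewrite addrC addKr normrN gtr0_norm; lra.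
have be : `|t0 + e / 2 - t0| < e by rewrite addrC addKr gtr0_norm; lra.
have ab : X (t0 - e / 2) < X (t0 + e / 2) by apply: iX => //; lra.
rewrite /step; case: ifP => [ta|_].
  rewrite smoothstep_le0 // ler_pdivrMr ?subr_gt0 // mul0r subr_le0 ltW //.
  exact: iX.
case: ifP => // tb; rewrite smoothstep_ge1 // ler_pdivlMr ?subr_gt0 // mul1r.
by rewrite lerD2r ltW //; exact: iX.
Qed.

(** Near each time the integer part can be frozen, because the step is constant
    outside an interval shorter than the period. *)
Let periodic_step_local X t0 (e : R) t : 0 < e <= 1/4 ->
  let k := Num.floor (t - (t0 - e / 2)) in
  \forall s \near t, periodic_step X t0 e s = k%:~R + step X t0 e (s - k%:~R).
Proof.
move=> /andP[e0 e4] k.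
have /andP[k1 k2] := floor_itv (t - (t0 - e / 2)).
rewrite -/k intrD in k1 k2.
have d0 : 0 < Num.min (1/2) (t0 - e / 2 + 1 + k%:~R - t).
  by rewrite lt_min; apply/andP; split; lra.
have nd := near_normC t d0.
apply: (@filterS _ (nbhs t) _ _ _ _ nd) => s.
rewrite /= lt_min !ltr_norml => /andP[/andP[s1 s2] /andP[s3 s4]].
rewrite /periodic_step; have [sk|sk] := leP (t0 - e / 2 + k%:~R) s.
  have -> // : Num.floor (s - (t0 - e / 2)) = k.
  by apply: floor_def; rewrite intrD; apply/andP; split; lra.
have -> : Num.floor (s - (t0 - e / 2)) = k - 1.
  by apply: floor_def; rewrite subrK intrB; apply/andP; split; lra.
rewrite intrB.
have -> : step X t0 e (s - k%:~R) = 0 by apply: step_left; lra.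
have -> : step X t0 e (s - (k%:~R - 1)) = 1 by apply: step_right => //; lra.
by rewrite subrK addr0.
Qed.

Let rderiv_real X Y (T T' : R -> R) t ka : separates Y t -> rderiv Y X t ka ->
  (forall x : R, is_derive x 1 T (T' x)) -> rderiv Y (T \o X) t (ka * T' (X t)).
Proof.
move=> sY dX dT.
have dd : differentiable T (X t).
  by apply/derivable1_diffP; have [] := dT (X t).
have E : 'd T (X t) ka = ka * T' (X t).
  rewrite diff1E // derive1E; have [_ ->] := dT (X t); by [].
have H := rderiv_comp sY dX dd.
exact: (eq_ind _ (fun z => rderiv Y (T \o X) t z) H _ E).
Qed.

(** Near a translate of the interval the step is a C^1 function of X, itself a
    C^1 function of Y; elsewhere the step is locally constant. The derivative is
    positive in the interior of the interval. *)
Lemma periodic_step_rderiv X t0 (e : R) Y t1 (e1 : R) : 0 < e <= 1/4 ->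
  coordinate delta X t0 e -> 0 < e1 -> coordinate delta Y t1 e1 ->
  exists E : R -> R, [/\
    \forall s \near t1, rderiv Y (periodic_step X t0 e) s (E s),
    0 <= E t1, (exists k : int, `|t1 - k%:~R - t0| < e / 2) -> 0 < E t1 &
    {for t1, continuous E}].
Proof.
move=> ee CX e10 CY; have /andP[e0 e4] := ee.
pose k := Num.floor (t1 - (t0 - e / 2)).
have nloc := @periodic_step_local X t0 e t1 ee; rewrite -/k in nloc.
have /andP[k1 k2] := floor_itv (t1 - (t0 - e / 2)); rewrite -/k intrD in k1 k2.
have Cs := coordinate_shift sdelta k CX.
pose a := t0 - e / 2; pose b := t0 + e / 2; pose la := (X b - X a)^-1.
have [pX iX cX _] := CX.
have ae : `|a - t0| < e by rewrite /a addrC addKr normrN gtr0_norm; lra.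
have be : `|b - t0| < e by rewrite /b addrC addKr gtr0_norm; lra.
have ab : X a < X b by apply: iX => //; rewrite /a /b; lra.
have la0 : 0 < la by rewrite invr_gt0 subr_gt0.
have d00 : `|t1 - t1| < e1 by rewrite subrr normr0.
have [te|te] := ltrP `|t1 - (t0 + k%:~R)| e.
  have [ka [nka ka0 cka]] := coordinate_compare Cs CY te d00.
  pose T (x : R) : R := k%:~R + smoothstep ((x - X a) / (X b - X a)).
  pose T' x := smoothstep' ((x - X a) / (X b - X a)) * la.
  have dT (x : R) : is_derive x 1 T (T' x).
    have d1 : is_derive x 1 (fun x : R => (x - X a) / (X b - X a)) la.
      apply: is_derive_of_bound => r r0; exists r => // h hr.
      rewrite -/la; have -> : (x + h - X a) * la - (x - X a) * la - h * la = 0 by ring.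
      by rewrite normr0 mulr_ge0 // ltW.
    have d2 := @is_derive1_comp R smoothstep _ x _ _ (is_derive_smoothstep _) d1.
    have d3 := is_deriveD (is_derive_cst (k%:~R : R) x 1) d2.
    by apply: (@is_derive_eq _ _ _ T x 1 _ _ d3); rewrite add0r.
  have nT : \forall s \near t1, periodic_step X t0 e s = (T \o X) s.
    apply: (@filterS2 _ (nbhs t1) _ _ _ _ _ nloc (near_ball_point te)) => s -> se.
    rewrite step_smooth //; last by rewrite addrAC -addrA -opprD.
    by rewrite /= /T -(pX (s - k%:~R) k) subrK.
  have nnT : \forall s \near t1, \forall x \near s, (T \o X) x = periodic_step X t0 e x.
    apply: (@filterS _ (nbhs t1) _ _ _ _ (near_join nT)) => s.
    by apply: (@filterS _ (nbhs s)) => x ->.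
  exists (fun s => ka s * T' (X s)); split.
  - apply: (@filterS3 _ (nbhs t1) _ _ _ _ _ _ nka nnT (near_ball_point d00)).
    move=> s ds Es se; apply: (rderiv_near_eq Es).
    exact: (rderiv_real (coordinate_separates CY se) ds dT).
  - rewrite mulr_ge0 //; first exact: ltW.
    by rewrite mulr_ge0 ?(ltW la0) //; case: (smoothstep'_ge0 ((X t1 - X a) / (X b - X a))).
  - move=> [k' k'E]; rewrite mulr_gt0 // mulr_gt0 //.
    have kk : k = k'.
      apply: floor_def; rewrite intrD; move: k'E; rewrite ltr_norml => /andP[h1 h2].
      by apply/andP; split; lra.
    have [_] := smoothstep'_ge0 ((X t1 - X a) / (X b - X a)); apply.
    have /ltr_normlP[h1 h2] := k'E.
    have i0 : `|t1 - k'%:~R - t0| < e by apply: (lt_trans k'E); lra.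
    have X1 : X a < X t1.
      by rewrite -(subrK k'%:~R t1) pX; apply: iX => //; rewrite /a; lra.
    have X2 : X t1 < X b.
      by rewrite -(subrK k'%:~R t1) pX; apply: iX => //; rewrite /b; lra.
    rewrite divr_gt0 ?subr_gt0 // ltr_pdivrMr ?subr_gt0 // mul1r ltrD2r.
    exact: X2.
  - have [_ _ /(_ _ te) cX1 _] := Cs.
    have cg : continuous (fun x => (x - X a) * la).
      move=> x; apply: cvgM; last exact: cvg_cst.
      by apply: cvgB; [exact: cvg_id|exact: cvg_cst].
    apply: cvgM => //; apply: cvgM; last exact: cvg_cst.
    apply: (@continuous_comp _ _ _ (fun s => (X s - X a) * la) smoothstep').
      exact: (@continuous_comp _ _ _ X (fun x => (x - X a) * la) t1 cX1 (cg _)).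
    exact: smoothstep'_continuous.
have bk : b + k%:~R < t1.
  rewrite /b; move: te; rewrite real_ler_normr ?num_real // => /orP[] h; lra.
have nb : \forall s \near t1, b + k%:~R < s.
  by apply: open_nbhs_nbhs; split=> //; exact: open_gt.
have nE : \forall s \near t1, periodic_step X t0 e s = cst (k%:~R + 1) s.
  apply: (@filterS2 _ (nbhs t1) _ _ _ _ _ nloc nb) => s -> bs.
  by rewrite step_right //; move: bs; rewrite /b; lra.
have nnE : \forall s \near t1, \forall x \near s,
    cst (k%:~R + 1) x = periodic_step X t0 e x.
  apply: (@filterS _ (nbhs t1) _ _ _ _ (near_join nE)) => s.
  by apply: (@filterS _ (nbhs s)) => x ->.
exists (cst 0); split=> //.
- apply: (@filterS _ (nbhs t1) _ _ _ _ nnE) => s Es.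
  exact: (rderiv_near_eq Es (rderiv_cst _ _ _)).
- move=> [k' k'E]; exfalso; move: k'E; rewrite ltr_norml => /andP[h1 h2].
  have kk : k = k'.
    by apply: floor_def; rewrite intrD; apply/andP; split; lra.
  by move: bk; rewrite /b kk; lra.
- exact: cvg_cst.
Qed.

End Gluing.

Section Reparametrization.
Context {R : realType} (S : smoothSurface R).
Implicit Types (c : chart R S) (s t : R) (X Y : R -> R) (k : int).

Variable delta : R -> S.
Hypotheses (sdelta : simple_closed delta)
  (coord : forall t0, exists X, exists2 e : R, 0 < e <= 1/4 & coordinate delta X t0 e).

Let sum_steps_rderiv (Xf : R -> R -> R) (ef : R -> R) Y t1 (e1 : R) (r : seq R) :
  (forall t0, 0 < ef t0 <= 1/4 /\ coordinate delta (Xf t0) t0 (ef t0)) ->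
  0 < e1 -> coordinate delta Y t1 e1 ->
  exists E : R -> R, [/\
    \forall s \near t1,
      rderiv Y (fun t => \sum_(i <- r) periodic_step (Xf i) i (ef i) t) s (E s),
    0 <= E t1,
    (exists2 i, i \in r & exists k : int, `|t1 - k%:~R - i| < ef i / 2) -> 0 < E t1 &
    {for t1, continuous E}].
Proof.
move=> XP e10 CY; elim: r => [|i r [E [dE E0 Epos cE]]].
  exists (cst 0); split=> //; [|by move=> [i]|exact: cvg_cst].
  have -> : (fun t => \sum_(i <- [::]) periodic_step (Xf i) i (ef i) t) = cst 0.
    by apply/funext => t; rewrite big_nil.
  apply: (@filterS _ (nbhs t1) _ setT); last exact: filterT.
  by move=> s _; exact: rderiv_cst.
have [ei Ci] := XP i.
have [F [dF F0 Fpos cF]] := periodic_step_rderiv sdelta ei Ci e10 CY.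
exists (fun s => F s + E s); split.
- have -> : (fun t => \sum_(j <- i :: r) periodic_step (Xf j) j (ef j) t) =
      (fun t => periodic_step (Xf i) i (ef i) t +
        \sum_(j <- r) periodic_step (Xf j) j (ef j) t).
    by apply/funext => t; rewrite big_cons.
  apply: (@filterS2 _ (nbhs t1) _ _ _ _ _ dF dE) => s ds1 ds2; exact: rderivD.
- exact: addr_ge0.
- move=> [j]; rewrite inE => /orP[/eqP->|jr] jP; first by rewrite ltr_pwDl ?Fpos.
  by rewrite ltr_wpDl // Epos //; exists j.
- exact: cvgD.
Qed.

(** By compactness of [0, 1], finitely many of the intervals where the steps
    increase cover the circle; tau is the average of their steps. Its derivative
    is nonnegative for each step, and positive for one of them at each point. *)
Lemma global_parameter : exists tau : R -> R,
  (forall t, tau (t + 1) = tau t + 1) /\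
  forall t1, exists Y, exists2 e1 : R, 0 < e1 & coordinate delta Y t1 e1 /\
    exists E : R -> R, [/\ \forall s \near t1, rderiv Y tau s (E s), 0 < E t1 &
      {for t1, continuous E}].
Proof.
have [t0|F FP] := @choice _ _ (fun t0 (Xe : (R -> R) * R) =>
    0 < Xe.2 <= 1/4 /\ coordinate delta Xe.1 t0 Xe.2).
  by have [X [e e0 CX]] := coord t0; exists (X, e).
have cov : cover_compact `[0 : R, 1] by rewrite -compact_cover; exact: segment_compact.
have [||D' _ DP] := cov R setT (fun i => [set t | `|t - i| < (F i).2 / 2]).
- move=> i _; rewrite openE => t /= ti; exact: near_ball_point.
- move=> t _; exists t => //=; rewrite subrr normr0 divr_gt0 //.
  by have [/andP[]] := FP t.
pose r : seq R := finmap.enum_fset D'.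
have rP t : 0 <= t <= 1 -> exists2 i, i \in r & `|t - i| < (F i).2 / 2.
  move=> t01; have [|i /= iD ti] := DP t; first by rewrite /= in_itv.
  by exists i.
pose N : R := \sum_(i <- r) 1.
have N0 : 0 < N.
  have [|i ir _] := rP 0; first by rewrite lexx ler01.
  by rewrite /N (big_rem i ir) /= ltr_pwDl // sumr_ge0.
pose sigma t := \sum_(i <- r) periodic_step (F i).1 i (F i).2 t.
exists (fun t => N^-1 * sigma t); split.
  move=> t; rewrite /sigma; under eq_bigr do rewrite periodic_step1.
  by rewrite big_split /= mulrDr -/N mulVf // gt_eqF.
move=> t1; have [Y [e1 /andP[e10 _] CY]] := coord t1.
exists Y, e1 => //; split=> //.
have [E [dE _ Epos cE]] := sum_steps_rderiv r FP e10 CY.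
exists (fun s => N^-1 * E s); split.
- apply: (@filterS _ (nbhs t1) _ _ _ _ dE) => s dEs.
  rewrite /rderiv.
  have -> : (fun x => (Y x - Y s)^-1 *: (N^-1 * sigma x - N^-1 * sigma s)) =
      (fun x => N^-1 * ((Y x - Y s)^-1 *: (sigma x - sigma s))).
    by apply/funext => x; rewrite -mulrBr /GRing.scale /= mulrCA.
  by apply: cvgM; [exact: cvg_cst|exact: dEs].
- rewrite mulr_gt0 ?invr_gt0 //; apply: Epos.
  have /andP[k1 k2] := floor_itv t1; rewrite intrD in k2.
  have [|i ir ti] := rP (t1 - (Num.floor t1)%:~R); first by apply/andP; split; lra.
  by exists i => //; exists (Num.floor t1).
- by apply: cvgM => //; exact: cvg_cst.
Qed.

End Reparametrization.

Section Regular.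
Context {R : realType} (S : smoothSurface R).
Implicit Types (c : chart R S) (s t : R) (X Y : R -> R) (k : int).

(** Near t0 the increments of tau have the sign of those of X. *)
Lemma rderiv_increasing X (tau : R -> R) t0 (e E : R) : 0 < e ->
  (forall s t, `|s - t0| < e -> `|t - t0| < e -> s < t -> X s < X t) ->
  rderiv X tau t0 E -> 0 < E ->
  exists2 r, 0 < r & forall x, 0 < x < r -> tau (t0 - x) < tau t0 < tau (t0 + x).
Proof.
move=> e0 iX dX E0.
have nE : nbhs E [set z | 0 < z].
  by apply: open_nbhs_nbhs; split=> //; exact: open_gt.
have := dX _ nE; rewrite /dnbhs /within /= => /nbhs_normC[r r0 rP].
have t0e : `|t0 - t0| < e by rewrite subrr normr0.
exists (Num.min r e); first by rewrite lt_min r0.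
move=> x /andP[x0]; rewrite lt_min => /andP[xr xe].
have ax : `|t0 - x - t0| = x by rewrite addrAC subrr add0r normrN gtr0_norm.
have bx : `|t0 + x - t0| = x by rewrite addrAC subrr add0r gtr0_norm.
apply/andP; split.
  have lt : X (t0 - x) < X t0 by apply: iX; rewrite ?ax // gtrBl.
  have := rP (t0 - x); rewrite /= ax => /(_ xr).
  rewrite neq_lt gtrBl x0 => /(_ isT).
  by rewrite /GRing.scale /= nmulr_rgt0 ?invr_lt0 subr_lt0.
have lt : X t0 < X (t0 + x) by apply: iX; rewrite ?bx // ltrDl.
have := rP (t0 + x); rewrite /= bx => /(_ xr).
rewrite neq_lt ltrDl x0 orbT => /(_ isT).
by rewrite /GRing.scale /= pmulr_rgt0 ?invr_gt0 subr_gt0.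
Qed.

(** tau takes the values tau 0 + n, hence is onto by the intermediate value
    theorem; the inverse of an increasing bijection is continuous. *)
Lemma circle_homeo (tau : R -> R) : continuous tau ->
  (forall s t, s < t -> tau s < tau t) -> (forall t, tau (t + 1) = tau t + 1) ->
  exists rho, [/\ continuous rho, cancel tau rho, cancel rho tau &
    forall s (k : int), rho (s + k%:~R) = rho s + k%:~R].
Proof.
move=> ct it t1.
have itW s t : tau s < tau t -> s < t.
  by have [//|ts|->] := ltgtP s t; [have := it _ _ ts; lra|lra].
have tauN (n : nat) t : tau (t + n%:R) = tau t + n%:R.
  elim: n t => [|n IH] t; first by rewrite !addr0.
  by rewrite -natr1 !addrA t1 IH.
have tauZ t (k : int) : tau (t + k%:~R) = tau t + k%:~R.
  case: k => n; first exact: tauN.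
  by rewrite NegzE intrN -[in RHS](subrK (n.+1%:~R) t) tauN addrK.
have surj y : exists t, tau t = y.
  have /andP[k1 k2] := floor_itv (y - tau 0); rewrite intrD in k2.
  set k : R := (Num.floor _)%:~R in k1 k2.
  have tk : tau k = tau 0 + k by rewrite -[in LHS](add0r k) tauZ.
  have tk1 : tau (k + 1) = tau 0 + k + 1 by rewrite t1 tk.
  have [|||t _ <-] := @IVT _ tau k (k + 1) y; [lra|exact: continuous_subspaceT| |by exists t].
  by rewrite tk tk1 min_l ?max_r; [apply/andP; split|..]; lra.
have [rho rhoP] := choice surj.
have tauI : injective tau.
  by move=> s t E; have [/it|/it|//] := ltgtP s t; rewrite E ltxx.
have rhoK : cancel tau rho by move=> t; apply: tauI; rewrite rhoP.
exists rho; split=> //; last first.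
  by move=> s k; apply: tauI; rewrite rhoP tauZ rhoP.
move=> y A /nbhs_normC[e e0 eA].
have y1 : tau (rho y - e) < y by rewrite -[X in _ < X]rhoP; apply: it; lra.
have y2 : y < tau (rho y + e) by rewrite -[X in X < _]rhoP; apply: it; lra.
have n1 : \forall z \near y, tau (rho y - e) < z.
  by apply: open_nbhs_nbhs; split=> //; exact: open_gt.
have n2 : \forall z \near y, z < tau (rho y + e).
  by apply: open_nbhs_nbhs; split=> //; exact: open_lt.
apply: (@filterS2 _ (nbhs y) _ _ _ _ _ n1 n2) => z; rewrite -{1 2}(rhoP z).
by move=> /itW z1 /itW z2; apply: eA; rewrite ltr_norml; apply/andP; split; lra.
Qed.

(** The parametrization delta \o tau^-1 has as derivative, for every coordinate
    X, the quotient of the derivatives of delta and of tau with respect to X,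
    which is continuous and does not vanish. *)
Lemma regular_reparametrization (delta : R -> S) : simple_closed delta ->
  (forall t0, exists X, exists2 e : R, 0 < e <= 1/4 & coordinate delta X t0 e) ->
  C1_curve (range delta).
Proof.
move=> sdelta coord; have [cdelta idelta] := sdelta.
have [tau [tau1 tauP]] := global_parameter sdelta coord.
have ctau : continuous tau.
  move=> t; have [Y [e e0 [CY [E [dE _ _]]]]] := tauP t.
  apply: (rderiv_cvg _ (nbhs_singleton dE)).
  by apply: (coordinate_separates CY); rewrite subrr normr0.
have inc t : exists2 r, 0 < r &
    forall x, 0 < x < r -> tau (t - x) < tau t < tau (t + x).
  have [Y [e e0 [[_ iY _ _] [E [dE E0 _]]]]] := tauP t.
  exact: (rderiv_increasing e0 iY (nbhs_singleton dE) E0).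
have itau s t : s < t -> tau s < tau t.
  move=> st; pose e := `|s| + `|t| + 1.
  apply: (@no_extremum_monotone _ tau 0 e); rewrite ?subr0 //.
  - by move=> x _; exact: ctau.
  - by move=> x _; have [r r0 rP] := inc x; exists r => //; left.
  - by rewrite /e; have := normr_ge0 t; lra.
  - by rewrite /e; have := normr_ge0 s; lra.
have [rho [crho tauK rhoK rhoZ]] := circle_homeo ctau itau tau1.
pose gamma := delta \o rho.
have rgamma : range delta = range gamma.
  apply/seteqP; split=> [_ [t _ <-]|_ [s _ <-]]; last by exists (rho s).
  by exists (tau t) => //; rewrite /gamma /= tauK.
rewrite rgamma; exists gamma => //; apply: C1_param_local.
  split.
    by move=> s; apply: (@continuous_comp _ _ _ rho delta); [exact: crho|exact: cdelta].
  move=> s t; split=> [/idelta[k E]|[k ->]]; last first.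
    by rewrite /gamma /= rhoZ simple_closed_period.
  by exists k; apply: (can_inj rhoK); rewrite rhoZ.
move=> s0; have [c ac cs0] := atlas_cover (gamma s0).
have pc : chart_at (gamma s0) c by [].
pose t0 := rho s0; have [Y [e e0 [CY [E [dE E0 cE]]]]] := tauP t0.
have [_ iY cY dY] := CY.
have t0e : `|t0 - t0| < e by rewrite subrr normr0.
have [D [dD D0 cD]] := dY t0 c t0e pc.
have nE0 : \forall t \near t0, E t != 0.
  have npos : nbhs (E t0) [set z | 0 < z].
    by apply: open_nbhs_nbhs; split=> //; exact: open_gt.
  by apply: (@filterS _ (nbhs t0) _ _ _ _ (cE _ npos)) => t /=; apply: lt0r_neq0.
have nd : \forall t \near t0,
    rderiv tau (c \o delta) t ((E t)^-1 *: D t).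
  apply: (@filterS3 _ (nbhs t0) _ _ _ _ _ _ (filterI dE nE0) dD (near_ball_point t0e)).
  move=> t [dt Et] Dt te; exact: (rderiv_ratio (coordinate_separates CY te) dt Et Dt).
have crho0 s : (fun h => rho (s + h)) @ (0 : R)^' --> (rho s)^'.
  move=> A; rewrite /dnbhs /within /= => nA.
  have cs : (fun h => rho (s + h)) @ (0 : R) --> rho s.
    have : (fun h : R => s + h) @ (0 : R) --> s.
      rewrite -[X in _ --> X]addr0; apply: cvgD; [exact: cvg_cst|exact: cvg_id].
    by move=> H; exact: (cvg_comp _ _ H (crho s)).
  apply: (@filterS _ (nbhs (0 : R)) _ _ _ _ (cs _ nA)) => h /= + h0; apply.
  apply: contra h0 => /eqP/(can_inj rhoK) E'.
  by apply/eqP; clear -E'; lra.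
have trans s : rderiv tau (c \o delta) (rho s) ((E (rho s))^-1 *: D (rho s)) ->
    derivable (c \o gamma) s 1 /\
    derive1 (c \o gamma) s = (E (rho s))^-1 *: D (rho s).
  move=> H; apply: derive1_of_quotient.
  have := cvg_comp _ _ (crho0 s) H; apply: cvg_trans; apply: near_eq_cvg.
  by apply: nearW => h /=; rewrite !rhoK [s + h]addrC addrK.
have ns : \forall s \near s0, rderiv tau (c \o delta) (rho s) ((E (rho s))^-1 *: D (rho s)).
  exact: (crho s0 _ nd).
exists c; split=> //.
- by apply: (@filterS _ (nbhs s0) _ _ _ _ ns) => s /trans[].
- have [_ dE0] := trans _ (nbhs_singleton ns).
  rewrite /prop_for /continuous_at; apply: (eq_ind_r (fun l => _ @ s0 --> l) _ dE0).
  have c1 : (fun t => (E t)^-1 *: D t) @ t0 --> (E t0)^-1 *: D t0.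
    by apply: cvgZ => //; apply: cvgV => //; exact: lt0r_neq0.
  have c2 := cvg_comp _ _ (crho s0) c1.
  apply: cvg_trans c2; apply: near_eq_cvg.
  by apply: (@filterS _ (nbhs s0) _ _ _ _ ns) => s /trans[_ ->].
- have [_ dE0] := trans _ (nbhs_singleton ns).
  have nz : (E t0)^-1 *: D t0 <> 0.
    by apply/eqP; rewrite scaler_eq0 invr_eq0 negb_or lt0r_neq0.
  exact: (eq_ind_r (fun z => z <> 0) nz dE0).
Qed.

End Regular.

(** * The characterization *)

(** The directions of g \o beta exist by the bijectivity of the induced maps and
    are continuous by transversality; this makes g \o beta regular after a
    reparametrization. *)
Lemma inverse_maps_C1_curves (R : realType) (S : smoothSurface R) (f g : S -> S) :
  inverse_homeo f g -> maps_C1_curves f ->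
  (forall p : S, homeo (@dbar R S f p)) ->
  (forall u : nat -> PTS S, transverse u -> transverse (dbarS f \o u)) ->
  maps_C1_curves g.
Proof.
move=> fg mf hd ht alpha [beta Cb ->]; have [_ cg _ gK] := fg.
have sdelta := simple_closed_comp cg (can_inj gK) (C1_simple_closed Cb).
have [V VP] := choice (direction_exists fg mf hd Cb).
have tV t : tangent_space (g (beta t)) (V t) /\ V t <> (fun=> 0) by case: (VP t).
have Vr t : (fun x => g (beta (t + x))) @ (0 : R)^'+ --> sector (g (beta t)) (V t).
  by case: (VP t).
have Vl t : (fun x => g (beta (t - x))) @ (0 : R)^'+ --> sector (g (beta t)) (negv (V t)).
  by case: (VP t).
have fV t : f @ sector (g (beta t)) (V t) --> sector (beta t) (velocity beta t) /\
    f @ sector (g (beta t)) (negv (V t)) --> sector (beta t) (negv (velocity beta t)).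
  by case: (VP t).
have Vc := direction_continuous fg mf ht Cb tV Vr Vl fV.
have -> : g @` range beta = range (g \o beta) by rewrite image_comp.
exact: (regular_reparametrization sdelta (coordinate_exists sdelta tV Vr Vl Vc)).
Qed.

Theorem theorem1 (R : realType) (S : smoothSurface R) (f : S -> S)
    (hf : homeo f) :
  Homeo1 f <->
  [/\ maps_C1_curves f,
      forall p : S, homeo (@dbar R S f p)
    & forall u : nat -> PTS S, transverse u -> transverse (dbarS f \o u)].
Proof.
split=> [[g [fg mf mg]]|[mf hd ht]].
  split=> [//|p|u [Q Qu]]; first exact: dbar_homeo fg mf mg.
  by exists (dbarS f Q); exact: transverse_image fg mf mg Qu.
have [g fg] := hf.
by exists g; split=> //; exact: inverse_maps_C1_curves fg mf hd ht.
Qed.
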